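(* Let $n \ge 2$, $T>0$ and $(\mathbf x^\circ,\mathbf b^\circ)\in\mathcal Z_n$. Let $g:\mathbb R\to\mathbb R$ be Lipschitz continuous and let $f:\mathbb R\setminus\{0\}\to\mathbb R$ satisfy: (1) $f$ is odd; (2) $f\in C^2((0,\infty))$; (3) $f\ge 0$, $f'\le 0$ and $f''\ge 0$ on $(0,\infty)$; (4) $x f'(x)\to-\infty$ as $x\downarrow 0$; (5) for some $a\in(-1,\infty)$ there is $C>0$ such that $f(x)\le C/x^{1+a}$ for all $x\in(0,1)$. Then the particle system $(P_n)$ has a solution $(\mathbf x,\mathbf b)$ on $[0,T]$ with initial datum $(\mathbf x^\circ,\mathbf b^\circ)$, and this solution is unique modulo relabeling. Moreover, with $S$ the set of all collision times of $(\mathbf x,\mathbf b)$, the following hold (the constants may depend on $n,T,\mathbf x^\circ,\mathbf b^\circ,f,g$). (i) (Lower bound on distance between neighbors of equal sign.) There exists $c>0$ such that $d^\pm(t)\ge c$ for all $t\in[0,T]$. (ii) (Lower bound on distance between neighbors of opposite sign.) Let $i<j$ be neighboring particles with opposite sign at time $t_0\ge 0$. Then there exist constants $C,c>0$ such that $$x_j(t)-x_i(t)\ge\big(c-C(t-t_0)\big)^{\frac1{2+a}}\qquad\text{for all } t_0\le t\le t_0+c/C.$$ (iii) (Upper bound prior to collision.) For any $\tau\in S$ and any particles $i<j$ which collide at $\tau$ and are neighbors prior to $\tau$, there exists $C>0$ such that $$x_j(t)-x_i(t)\le C(\tau-t)^{\frac1{2+a}}\qquad\text{for all }t\in[0,\tau].$$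 (iv) (Lower bound prior to collision.) Assume that there exist $a'\in(-1,a]$ and $c',\varepsilon_0>0$ such that $|xf'(x)|\ge c'/x^{1+a'}$ for all $x\in(0,\varepsilon_0)$. Then, for each collision point $(\tau,y)$, there exist a constant $c>0$ and indices $i<j$ such that $x_i(\tau)=x_j(\tau)=y$, $b_i(\tau-)\ne0$, $b_j(\tau-)\neq 0$ and $$x_j(t)-y>c(\tau-t)^{\frac1{2+a'}},\qquad x_i(t)-y<-c(\tau-t)^{\frac1{2+a'}}$$ for all $t<\tau$ large enough (i.e. close enough to $\tau$). (v) (Stability with respect to $\mathbf x^\circ$ and $g$.) Write $S=\{\tau_1,\dots,\tau_K\}$ with $0=:\tau_0<\tau_1<\dots<\tau_K\le\tau_{K+1}:=T$. Let $g^\sigma:\mathbb R\to\mathbb R$ be Lipschitz continuous with $\|g^\sigma-g\|_\infty\to0$ as $\sigma\to0$. Let $(\mathbf x^{\sigma,\circ},\mathbf b^\circ)\in\mathcal Z_n$ be such that $\mathbf x^{\sigma,\circ}\to\mathbf x^\circ$ as $\sigma\to0$. Let $(\mathbf x^\sigma,\mathbf b^\sigma)$ be the solution of $(P_n)$ with initial datum $(\mathbf x^{\sigma,\circ},\mathbf b^\circ)$ and with external force $g^\sigma$ instead of $g$. Then, for each $k=0,\dots,K$, there exists a relabeling of $(\mathbf x^\sigma,\mathbf b^\sigma)$ (a permutation of the indices, which may depend on $k$ and $\sigma$) such that, for the relabeled solution, - $\mathbf x^\sigma\to\mathbf x$ in $C([\tau_k,\tau_{k+1}];\mathbb R^n)$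 as $\sigma\to0$, and - on any $[t_0,t_1]\subset(\tau_k,\tau_{k+1})$, $\mathbf b^\sigma=\mathbf b$ for all $\sigma$ small enough.
   Context: **State space.** $\mathcal Z_n:=\{(\mathbf x,\mathbf b)\in\mathbb R^n\times\{-1,0,1\}^n:\ \text{if } i<j \text{ and } b_ib_j\ne0,\text{ then }x_i<x_j\}$. Here $\mathbf x=(x_1,\dots,x_n)$ are particle positions and $\mathbf b=(b_1,\dots,b_n)$ their charges. A particle $i$ is charged if $|b_i|=1$ and neutral if $b_i=0$. **One-sided limits.** $h(t-):=\lim_{s\uparrow t}h(s)$. **The system $(P_n)$ and its solutions.** Set $f(0):=0$ by convention. A map $(\mathbf x,\mathbf b):[0,T]\to\mathcal Z_n$ is a solution of $(P_n)$ with initial datum $(\mathbf x^\circ,\mathbf b^\circ)$ and external force $g$ if there is a finite set $S_0\subset(0,T]$ such that: - (Regularity) $\mathbf x\in C([0,T])\cap C^1((0,T)\setminus S_0)$, and $b_1,\dots,b_n:[0,T]\to\{-1,0,1\}$ are right-continuous; - (Initial condition) $(\mathbf x(0),\mathbf b(0))=(\mathbf x^\circ,\mathbf b^\circ)$; - (Annihilation rule) each $b_i$ jumps at most once; if $b_i$ jumps at $t\in[0,T]$, then $t\in S_0$, $|b_i(t-)|=1$ and $b_i(t)=0$; moreover $\sum_{i:x_i(t)=y}b_i(t)=\sum_{i:x_i(t)=y}b_i(t-)$ for all $t\in(0,T]$ and all $y\in\mathbb R$; - (ODE) on $(0,T)\setminus S_0$, for all $i$, $\displaystyle \frac{d}{dt}x_i=\frac1n\sum_{j\ne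 i}b_ib_jf(x_i-x_j)+b_ig(x_i)$. **Collisions.** A point $(\tau,y)\in S_0\times\mathbb R$ is a collision point if $\sum_{i:x_i(\tau)=y}b_i(\tau-)$ has at least two nonzero summands; $\tau$ is then a collision time, and the particles $i$ with $x_i(\tau)=y$ and $b_i(\tau-)\ne0$ are the particles which collide at $(\tau,y)$ (collide at $\tau$ with each other). **Neighbors.** Particles $i<j$ are neighbors at time $t$ if $b_i(t)b_j(t)\ne0$ and $b_k(t)=0$ for all $i<k<j$; ''neighbors prior to $\tau$'' means neighbors at all times $t<\tau$ close enough to $\tau$. **Minimal distances.** $d^\pm(t):=\inf\{x_j(t)-x_i(t): i<j\text{ are neighbors at time }t\text{ and }b_i(t)=b_j(t)=\pm1\}\in(0,\infty]$. **Uniqueness modulo relabeling.** At a collision there may be a choice of which of several colliding particles (of the same charge) keeps its charge; uniqueness is meant up to this choice. That is, any two solutions with the same initial datum coincide after a relabeling (permutation) of particle indices which is allowed to change at collision times; in particular the union of the particle trajectories is the same. All times are understood to lie in $[0,T]$. *)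

(* Defs.v *)
From HB Require Import structures.
From mathcomp Require Export all_boot all_order all_algebra all_fingroup.
From mathcomp Require Export all_classical all_reals all_analysis.
Export Order.TTheory GRing.Theory Num.Theory.
Export numFieldNormedType.Exports.

Set Implicit Arguments.
Unset Strict Implicit.
Unset Printing Implicit Defensive.

Local Open Scope ring_scope.
Local Open Scope classical_set_scope.

Section ParticleSystem.
Context {R : realType} {n : nat}.

(* Charges are stored as reals so that they can be multiplied with forces. *)
Definition Zn : set ('rV[R]_n * 'rV[R]_n) :=
  [set z : 'rV[R]_n * 'rV[R]_n | (forall i, z.2 0 i \in [:: -1; 0; 1]) /\
           (forall i j : 'I_n, (i < j)%N -> z.2 0 i * z.2 0 j != 0 ->
              z.1 0 i < z.1 0 j)].

(* A total function on R stands for a function on [0, T]: only its values on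
   [0, T] are ever constrained. *)
Implicit Types (f g : R -> R) (T t tau y : R) (x b : R -> 'rV[R]_n).

(* h(t-); the default value of lim is never met along a solution, since a
   {-1,0,1}-valued function on [0, T] with at most one jump has left limits. *)
Definition left_lim (h : R -> R) t : R := lim (h s @[s --> t^'-]).

Definition jumps_at T (h : R -> R) t : Prop :=
  `[0, T]%classic t /\ ~ (h s @[s --> within `[0, T] (nbhs t)] --> h t).

Definition velocity f g (x b : 'rV[R]_n) (i : 'I_n) : R :=
  n%:R^-1 * (\sum_(j < n | j != i) b 0 i * b 0 j * f (x 0 i - x 0 j))
  + b 0 i * g (x 0 i).

Record solution_with f g T (x0 b0 : 'rV[R]_n) (S0 : set R) x b : Prop := SolutionWith {
  sol_finite : finite_set S0 ;
  sol_times : S0 `<=` `]0, T] ;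
  sol_Zn : forall t, 0 <= t <= T -> Zn (x t, b t) ;
  sol_cont : {within `[0, T], continuous x} ;
  sol_C1 : forall t i, 0 < t < T -> ~ S0 t ->
    derivable (fun s => x s 0 i) t 1 /\
    {for t, continuous (fun s => x s 0 i)^`()} ;
  sol_right_cont : forall t i, 0 <= t < T ->
    b s 0 i @[s --> t^'+] --> b t 0 i ;
  sol_init : x 0 = x0 /\ b 0 = b0 ;
  sol_jump_once : forall i s t,
    jumps_at T (fun s => b s 0 i) s -> jumps_at T (fun s => b s 0 i) t -> s = t ;
  sol_jump : forall i t, jumps_at T (fun s => b s 0 i) t ->
    [/\ S0 t, `|left_lim (fun s => b s 0 i) t| = 1 & b t 0 i = 0] ;
  sol_charge : forall t y, 0 < t <= T ->
    \sum_(i < n | x t 0 i == y) b t 0 i =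
    \sum_(i < n | x t 0 i == y) left_lim (fun s => b s 0 i) t ;
  sol_ode : forall t i, 0 < t < T -> ~ S0 t ->
    (fun s => x s 0 i)^`() t = velocity f g (x t) (b t) i }.

Definition is_solution f g T (x0 b0 : 'rV[R]_n) x b : Prop :=
  exists S0, solution_with f g T x0 b0 S0 x b.

Definition colliding x b tau y : {set 'I_n} :=
  [set i | (x tau 0 i == y) && (left_lim (fun s => b s 0 i) tau != 0)]%SET.

Definition collision_point (S0 : set R) x b tau y : Prop :=
  S0 tau /\ (2 <= #|colliding x b tau y|)%N.

Definition collision_times (S0 : set R) x b : set R :=
  [set tau | exists y, collision_point S0 x b tau y].

Definition collide_at (S0 : set R) x b tau (i j : 'I_n) : Prop :=
  exists y, [/\ collision_point S0 x b tau y,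
                i \in colliding x b tau y & j \in colliding x b tau y].

Definition neighbors (b : 'rV[R]_n) (i j : 'I_n) : Prop :=
  [/\ (i < j)%N, b 0 i * b 0 j != 0 &
      forall k : 'I_n, (i < k < j)%N -> b 0 k = 0].

Definition neighbors_prior_to b tau (i j : 'I_n) : Prop :=
  \forall t \near tau^'-, neighbors (b t) i j.

(* [min_dist 1] and [min_dist (-1)] are d^+ and d^-; the infimum of the empty
   set is +oo. *)
Definition min_dist (s : R) x b t : \bar R :=
  ereal_inf [set d | exists i j, [/\ neighbors (b t) i j,
    b t 0 i = s, b t 0 j = s & d = (x t 0 j - x t 0 i)%:E]].

Definition relabel (p : 'S_n) (v : 'rV[R]_n) : 'rV[R]_n := \row_i v 0 (p i).

(* [p t] is the relabeling in force at time t; it is constant on each interval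
   [s, t] such that ]s, t] contains no collision time (charges being
   right-continuous, a change at a collision time is effective at that time). *)
Definition eq_mod_relabeling T (S : set R) x b x' b' : Prop :=
  exists p : R -> 'S_n,
    (forall s t, 0 <= s -> s <= t -> t <= T ->
       (forall tau, S tau -> ~ (s < tau <= t)) -> p s = p t) /\
    (forall t, 0 <= t <= T ->
       x' t = relabel (p t) (x t) /\ b' t = relabel (p t) (b t)).

Definition sup_norm (h : R -> R) : \bar R :=
  ereal_sup (range (fun u => `|h u|%:E)).

End ParticleSystem.

(* Main.v *)
(* Equal charges stay apart: at a pair of neighbours of equal sign with minimal
   distance, the other charges, whose signs alternate apart from such pairs, push
   it together by no more than its own repulsion, so only [g] can make the
   distance shrink, exponentially at worst; at a jump a new pair of equal
   neighbours encloses an alternating block of net charge at most 1, which charge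
   conservation excludes. Hence a colliding cluster is alternating, its extreme
   particles are pulled inwards up to a bounded speed, and an opposite pair at
   distance d closes at a speed at most 2 f(d) / n plus a constant, and at least
   comparable to |d f'(d)|; integrating these two inequalities gives the powers
   of the time to collision.

   For the stability, away from collisions the force is Lipschitz and Gronwall
   applies. Near a collision point the hull estimate keeps the perturbed cluster
   close to that point, and since d f'(d) diverges it collapses to at most one
   charge within a time that is small with its diameter; its net charge being
   conserved, the survivors agree with the unperturbed ones up to a permutation.
   Uniqueness is the case of a vanishing perturbation. Existence follows from
   Picard iteration for cut-off forces: the hull estimate yields a limit at the
   first collision time, one charge is kept in every cluster of nonzero net
   charge, and the number of charged particles decreases. *)

Require Import Defs.
From mathcomp Require Import ring lra zify.

Set Implicit Arguments.
Unset Strict Implicit.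
Unset Printing Implicit Defensive.

Local Open Scope ring_scope.
Local Open Scope classical_set_scope.

(** * Continuity, mean values and barriers on intervals *)

Section Calculus.
Context {R : realType}.
Implicit Types (a b c d t s u v e C M : R) (h k : R -> R).

(** Forces are summed by comparison with a ladder: successive charges of equal sign are [c] apart
    and opposite ones cancel, so a signed sum of a nonincreasing [phi] is at most its sum over an
    arithmetic progression of step [c]. Convexity of [f] enters through the choice of [phi]: the
    decrements [f u - f (u + d)], whose ladder telescopes to the repulsion [f d] of the pair, and
    the excess of [f] over an affine function, which reduces a collapsing cluster to its net charge
    and first moment.

    The perturbed forces are close to [g] only in the sup norm, with no control of their Lipschitz
    constants, so gap estimates carry an additive error besides the constant of [g]. Perturbed
    collisions happen at slightly different times: positions can be matched up to the collision
    times, charges only away from them. A collision at [T] leaves no time to collapse and is treated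
    apart. Finally, the estimates give a permutation for each accuracy, whereas one permutation must
    serve all accuracies; finiteness of the symmetric group provides it. *)

Definition cts a b h := forall t, a <= t <= b -> forall e, 0 < e ->
  exists2 d, 0 < d & forall s, a <= s <= b -> `|s - t| < d -> `|h s - h t| < e.

Lemma ctsP a b h : {within `[a, b], continuous h} <-> cts a b h.
Proof.
split.
- move/subspace_continuousP => H t tab e e0.
  have /cvgrPdist_lt/(_ e e0) := H t tab.
  rewrite /within/= => /nbhs_ballP[d /= d0 Hd].
  exists d => // s sab sd; rewrite distrC; apply: Hd => //=.
  by rewrite /ball/= distrC.
- move=> H; apply/subspace_continuousP => t tab.
  apply/cvgrPdist_lt => e e0.
  have [d d0 Hd] := H t tab e e0.
  rewrite /within/=; apply/nbhs_ballP; exists d => //= s.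
  rewrite /ball/= => sd sab; rewrite distrC; apply: Hd => //.
  by rewrite distrC.
Qed.

Lemma cts_sub a b a' b' h : cts a b h -> a <= a' -> b' <= b -> cts a' b' h.
Proof.
move=> H aa bb t tab e e0; have [|d d0 Hd] := H t _ e e0; first lra.
by exists d => // s sab; apply: Hd; lra.
Qed.

Lemma cts_ext a b h k : (forall t, a <= t <= b -> h t = k t) -> cts a b h -> cts a b k.
Proof.
move=> E H t tab e e0; have [d d0 Hd] := H t tab e e0.
by exists d => // s sab sd; rewrite -!E//; exact: Hd.
Qed.

Lemma cts_add a b h k : cts a b h -> cts a b k -> cts a b (fun t => h t + k t).
Proof.
move=> H K t tab e e0; have e2 : 0 < e / 2 by lra.
have [d d0 Hd] := H t tab _ e2; have [d' d0' Hd'] := K t tab _ e2.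
exists (Num.min d d'); first by rewrite lt_min d0.
move=> s sab; rewrite lt_min => /andP[sd sd'].
have -> : h s + k s - (h t + k t) = (h s - h t) + (k s - k t) by ring.
by rewrite (le_lt_trans (ler_normD _ _))//; have := Hd s sab sd; have := Hd' s sab sd'; lra.
Qed.

Lemma cts_scale a b h c : cts a b h -> cts a b (fun t => c * h t).
Proof.
move=> H t tab e e0; have c0 : 0 < `|c| + 1 by have := normr_ge0 c; lra.
have [|d d0 Hd] := H t tab (e / (`|c| + 1)); first by rewrite divr_gt0.
exists d => // s sab sd; rewrite -mulrBr normrM.
have := Hd s sab sd; rewrite ltr_pdivlMr// => K.
by apply: le_lt_trans K; rewrite mulrC ler_wpM2l//; lra.
Qed.

Lemma cts_opp a b h : cts a b h -> cts a b (fun t => - h t).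
Proof. by move=> /(cts_scale (-1)); apply: cts_ext => t _; rewrite mulN1r. Qed.

Lemma cts_sub2 a b h k : cts a b h -> cts a b k -> cts a b (fun t => h t - k t).
Proof. by move=> H /cts_opp; exact: cts_add. Qed.

Lemma continuous_cts a b h : (forall t, a <= t <= b -> {for t, continuous h}) -> cts a b h.
Proof.
move=> H t tab e e0.
have /cvgrPdist_lt/(_ e e0)/nbhs_ballP[d /= d0 Hd] := H t tab.
by exists d => // s sab sd; rewrite distrC; apply: Hd; rewrite /ball/= distrC.
Qed.

Lemma cts_cst a b c : cts a b (fun=> c).
Proof. by apply: continuous_cts => t _; exact: cst_continuous. Qed.

Lemma cts_id a b : cts a b id.
Proof. by apply: continuous_cts => t _; exact: cvg_id. Qed.

Lemma derive_cts a b h k : (forall t, a <= t <= b -> is_derive t 1 h (k t)) -> cts a b h.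
Proof.
move=> H; apply: continuous_cts => t tab; apply: differentiable_continuous.
by apply/derivable1_diffP; have [] := H t tab.
Qed.

Lemma cts_sum a b (I : eqType) (r : seq I) (P : pred I) (h : I -> R -> R) :
  (forall i, P i -> cts a b (h i)) -> cts a b (fun t => \sum_(i <- r | P i) h i t).
Proof.
move=> H; elim: r => [|i r IH].
  by apply: cts_ext (@cts_cst a b 0) => t _; rewrite big_nil.
case Pi: (P i).
  by apply: cts_ext (cts_add (H i Pi) IH) => t _; rewrite big_cons Pi.
by apply: cts_ext IH => t _; rewrite big_cons Pi.
Qed.

Lemma cts_bounded a b h : a <= b -> cts a b h -> exists2 M, 0 < M & forall t, a <= t <= b -> `|h t| <= M.
Proof.
move=> ab /ctsP H.
have [c _ Hc] := EVT_max ab H.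
have [d _ Hd] := EVT_min ab H.
exists (`|h c| + `|h d| + 1); first by have := normr_ge0 (h c); have := normr_ge0 (h d); lra.
move=> t tab; have /= := Hc t; have /= := Hd t; rewrite in_itv/= tab => /(_ isT) h1 /(_ isT) h2.
by rewrite ler_norml; have := ler_norm (h c); have := ler_normr (h d) (- h d);
  have := lerNnormlW (lexx `|h d|); have := normr_ge0 (h c); have := normr_ge0 (h d); lra.
Qed.

Lemma cts_closed_ge a b h c : a < b -> cts a b h -> (forall t, a <= t < b -> c <= h t) -> c <= h b.
Proof.
move=> ab H K; rewrite leNgt; apply/negP => hc.
have [||d d0 Hd] := H b _ (c - h b); [lra|lra|].
pose s := Num.max a (b - d / 2).
have sE : a <= s /\ b - d / 2 <= s by rewrite /s !le_max !lexx orbT.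
have sb : s < b by rewrite /s gt_max ab /=; lra.
have h1 : c <= h s by apply: K; lra.
have : `|h s - h b| < c - h b by apply: Hd; [lra|rewrite ltr_norml; lra].
by rewrite ltr_norml; lra.
Qed.

(** Passage from one point of [F] to the next: the interval is split at a point of [F] inside it,
    which is interior to neither half, so the list of remaining points gets shorter. *)
Lemma finite_itv_ind (F : set R) a b (P : R -> Prop) : finite_set F -> a <= b -> P a ->
  (forall s s', a <= s -> s < s' -> s' <= b -> (forall u, F u -> ~ (s < u < s')) ->
     P s -> P s') -> P b.
Proof.
move=> /finite_seqP[l Fl] ab Pa H.
have [N] := ubnP (size l).
have {}H s s' : a <= s -> s < s' -> s' <= b -> (forall u, u \in l -> ~ (s < u < s')) ->
     P s -> P s'.
  by move=> h1 h2 h3 h4; apply: H => // u; rewrite Fl; exact: h4.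
elim: N a b l {Fl} ab Pa H => // N IH a b l ab Pa H lN.
have [E|nab] := eqVneq a b; first by rewrite -E.
have {nab}ab : a < b by rewrite lt_neqAle nab.
have [/hasP[u ul /andP[au ub]]|/hasPn nu] := boolP (has (fun u => a < u < b) l); last first.
  by apply: (H a b) => // u ul ?; move: (nu u ul) => /negP.
have sz : (size [seq v <- l | v != u] < N)%N.
  rewrite ltnS in lN; apply: leq_trans lN; rewrite size_filter -(count_predC (fun v => v != u) l) -[ltnLHS]addn0 ltn_add2l.
  by rewrite -has_count; apply/hasP; exists u => //=; rewrite negbK.
have Pu : P u.
  apply: (IH a u _ _ Pa _ sz); first lra.
  move=> s s' h1 h2 h3 h4; apply: H => //; first lra.
  move=> v vl; have [->|vu] := eqVneq v u; first lra.
  by apply: h4; rewrite mem_filter vu.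
apply: (IH u b _ _ Pu _ sz); first lra.
move=> s s' h1 h2 h3 h4; apply: H => //; first lra.
move=> v vl; have [->|vu] := eqVneq v u; first lra.
by apply: h4; rewrite mem_filter vu.
Qed.

Lemma MVT_ge0 a b h k (F : set R) : finite_set F -> a <= b -> cts a b h ->
  (forall t, a < t < b -> ~ F t -> is_derive t 1 h (k t) /\ 0 <= k t) -> h a <= h b.
Proof.
move=> FF ab H D.
apply: (@finite_itv_ind F a b (fun t => h a <= h t)) => // s s' h1 h2 h3 h4 h5.
apply: le_trans h5 _.
have D' t : s < t < s' -> is_derive t 1 h (k t) /\ 0 <= k t.
  by move=> ts; apply: D; [lra|move=> Ft; exact: h4 Ft ts].
have [||c cs] := @MVT _ h k s s' h2.
- by move=> x; rewrite in_itv/= => xs; have [] := D' x xs.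
- by apply/ctsP; apply: cts_sub H _ _; lra.
rewrite in_itv/= in cs; have [_ k0] := D' c cs.
move=> E; have : 0 <= k c * (s' - s) by apply: mulr_ge0 => //; lra.
lra.
Qed.

Lemma MVT_le a b h k C (F : set R) : finite_set F -> a <= b -> cts a b h ->
  (forall t, a < t < b -> ~ F t -> is_derive t 1 h (k t) /\ k t <= C) -> h b - h a <= C * (b - a).
Proof.
move=> FF ab H D.
have := @MVT_ge0 a b (fun t => C * t - h t) (fun t => C * 1 - k t) F FF ab.
move=> K; have {K} : C * a - h a <= C * b - h b.
  apply: K; first by apply: cts_sub2 => //; apply: cts_scale; exact: cts_id.
  move=> t tab Ft; have [Dt kt] := D t tab Ft; split; last lra.
  exact: is_deriveB.
lra.
Qed.

Lemma MVT_norm a b h k C (F : set R) : finite_set F -> a <= b -> cts a b h ->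
  (forall t, a < t < b -> ~ F t -> is_derive t 1 h (k t) /\ `|k t| <= C) -> `|h b - h a| <= C * (b - a).
Proof.
move=> FF ab H D; rewrite ler_norml; apply/andP; split; last first.
  apply: (MVT_le FF ab H) => t h1 h2; have [D1] := D t h1 h2; rewrite ler_norml => /andP[_ D2].
  by split; [exact: D1|].
have := @MVT_le a b (fun t => - h t) (fun t => - k t) C F FF ab (cts_opp H).
move=> K; have {K} : - h b - - h a <= C * (b - a).
  apply: K => t h1 h2; have [D1 ] := D t h1 h2; rewrite ler_norml => /andP[D2 _].
  split; [exact: is_deriveN|lra].
lra.
Qed.

Lemma is_derive_left c k v : is_derive c 1 k v -> 0 < v ->
  exists2 e, 0 < e & forall t, c - e < t < c -> k t < k c.
Proof.
move=> [D Dv] v0.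
have K : h^-1 *: (k (h *: 1 + c) - k c) @[h --> 0^'] --> v by rewrite -Dv; exact: D.
have := cvgr_gt _ K 0 v0.
move=> /(_ (dnbhs_filter _))/nbhs_ballP [e /= e0 He]; exists e => // t te.
have := He (t - c); rewrite /ball/= sub0r normrN => /(_ _ _).
have -> : (t - c) *: 1 + c = t by rewrite /GRing.scale/= mulr1 subrK.
have tc : t - c != 0 by lra.
move=> /(_ _ tc) Q; have : 0 < (t - c)^-1 *: (k t - k c) by apply: Q; rewrite ltr_norml; lra.
rewrite /GRing.scale/= => Q'.
have : (t - c)^-1 < 0 by rewrite invr_lt0; lra.
move=> Q2; rewrite -subr_lt0; by rewrite nmulr_rgt0 in Q'.
Qed.

(** The times up to which [P] holds throughout have a supremum; the last premise gives [P] there,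
    and the premise before it carries [P] beyond, unless the supremum is [b]. *)
Lemma real_induction a b (P : R -> Prop) : P a ->
  (forall t, a <= t < b -> (forall s, a <= s <= t -> P s) -> exists2 e, 0 < e & forall s, t < s < t + e -> P s) ->
  (forall t, a < t <= b -> (forall s, a <= s < t -> P s) -> P t) ->
  forall t, a <= t <= b -> P t.
Proof.
move=> Pa Hr Hl t0 t0ab.
pose A := [set t | a <= t <= b /\ forall s, a <= s <= t -> P s].
have Aa : A a by split; [lra|move=> s sa; have -> : s = a by lra].
have supA : has_sup A by split; [exists a|exists b => t [/andP[]]].
have aS : a <= sup A by apply: ub_le_sup => //; exact: supA.2.
have Sb : sup A <= b by apply: ge_sup; [exists a|move=> t [/andP[]]].
have below s : a <= s < sup A -> P s.
  move=> /andP[as_ sS].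
  have sS0 : 0 < sup A - s by lra.
  have [t [tab Pt] st] := sup_adherent sS0 supA.
  by apply: Pt; lra.
have PS : forall s, a <= s <= sup A -> P s.
  move=> s sab; have [sS|sS] := ltP s (sup A); first by apply: below; lra.
  have -> : s = sup A by lra.
  have [aS'|aS'] := ltP a (sup A); first by apply: Hl; [lra|exact: below].
  by have -> : sup A = a by lra.
have [Sb'|Sb'] := ltP (sup A) b; last by apply: PS; lra.
have [|e e0 He] := Hr (sup A) _ PS; first lra.
pose s1 := Num.min (sup A + e / 2) b.
have s1E : s1 <= sup A + e / 2 /\ s1 <= b by rewrite /s1 !ge_min !lexx orbT.
have s1S : sup A < s1 by rewrite /s1 lt_min Sb' andbT; lra.
suff : s1 <= sup A by lra.
apply: ub_le_sup; first exact: supA.2.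
split; first lra.
move=> s sab; have [sS|sS] := leP s (sup A); first by apply: PS; lra.
by apply: He; lra.
Qed.

(** At the first time when some [k i] sinks to a level [- e], it is minimal among all of them and
    has a positive derivative, so it was even lower just before. The derivative is prescribed only
    for a minimal value in the band above [- eta], because the speed estimates below hold only for
    configurations that barely violate the bound. *)
Lemma barrier_free (I : finType) (Q : pred I) (k dk : I -> R -> R) a b (eta : R) : a <= b -> 0 < eta ->
  (forall i, Q i -> cts a b (k i)) ->
  (forall i, Q i -> 0 <= k i a) ->
  (forall t i, a < t < b -> Q i -> - eta < k i t <= 0 -> (forall j, Q j -> k i t <= k j t) ->
     is_derive t 1 (k i) (dk i t) /\ 0 < dk i t) ->
  forall i, Q i -> 0 <= k i b.
Proof.
move=> ab eta0 kc ka H i0 Qi0.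
have [E|nab] := eqVneq a b; first by rewrite -E; exact: ka.
have {nab}ab : a < b by rewrite lt_neqAle nab.
(* Levels [- e] with [e > 0] leave room at the start, where [k i] may vanish; then [e] tends to
   0. *)
suff K : forall e, 0 < e < eta -> - e <= k i0 b.
  rewrite leNgt; apply/negP => kb.
  have := K (Num.min (eta / 2) (- k i0 b / 2)).
  have [h1|h1] := leP (eta / 2) (- k i0 b / 2); lra.
move=> e e0.
have K t : a <= t < b -> forall i, Q i -> - e < k i t.
  move=> tab.
  apply: (@real_induction a t (fun t => forall i, Q i -> - e < k i t)); last lra.
  - by move=> i Qi; have := ka i Qi; lra.
  - move=> u uat Pu.
    have D i : exists d, 0 < d /\ (Q i -> forall s, a <= s <= b -> `|s - u| < d -> - e < k i s).
      have [Qi|nQi] := boolP (Q i); last by exists 1; split.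
      have := Pu u _ i Qi; have h1 : a <= u <= u by lra.
      move=> /(_ h1) h2.
      have [||d d0 Hd] := kc i Qi u _ (k i u + e); [lra|lra|].
      exists d; split => // _ s sab su.
      by have := Hd s sab su; rewrite ltr_norml; lra.
    have [d Hd] := choice D.
    pose m := \big[Num.min/(b - u)]_i d i.
    have m0 : 0 < m.
      rewrite /m; elim/big_ind: _ => [|x y x0 y0|i _]; [lra|by rewrite lt_min x0|by have [] := Hd i].
    exists m => // s su i Qi; have [_ Hi] := Hd i; apply: Hi => //.
      have : m <= b - u by exact: bigmin_le_id.
      lra.
    have : m <= d i by exact: bigmin_le_cond.
    rewrite ltr_norml; lra.
  - move=> u uat Pu i Qi; rewrite ltNge; apply/negP => kiu.
    have ge j : Q j -> - e <= k j u.
      move=> Qj; apply: (@cts_closed_ge a u (k j)); first lra.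
        by apply: cts_sub (kc j Qj) _ _; lra.
      by move=> s sau; apply: ltW; apply: Pu.
    have kE : k i u = - e by have := ge i Qi; lra.
    have [|||D dk0] := H u i _ Qi; [lra|lra|by move=> j Qj; rewrite kE; exact: ge|].
    have [d d0 Hd] := is_derive_left D dk0.
    pose s := Num.max a (u - d / 2).
    have sE : a <= s /\ u - d / 2 <= s by rewrite /s !le_max !lexx orbT.
    have su : s < u by rewrite /s gt_max; lra.
    have := Hd s; have := Pu s _ i Qi; lra.
by apply: (@cts_closed_ge a b (k i0) _ ab (kc i0 Qi0)) => t tab; apply: ltW; apply: K.
Qed.

Lemma barrier (I : finType) (Q : pred I) (k dk : I -> R -> R) a b (eta : R) (F : set R) :
  finite_set F -> a <= b -> 0 < eta ->
  (forall i, Q i -> cts a b (k i)) ->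
  (forall i, Q i -> 0 <= k i a) ->
  (forall t i, a < t < b -> ~ F t -> Q i -> - eta < k i t <= 0 -> (forall j, Q j -> k i t <= k j t) ->
     is_derive t 1 (k i) (dk i t) /\ 0 < dk i t) ->
  forall t i, a <= t <= b -> Q i -> 0 <= k i t.
Proof.
move=> FF ab eta0 kc ka H t i tab Qi; move: i Qi.
apply: (@finite_itv_ind F a t (fun t => forall i, Q i -> 0 <= k i t)) => //; first lra.
move=> s s' h1 h2 h3 h4 h5.
apply: (@barrier_free I Q k dk s s' eta) => //; first lra.
- by move=> i Qi; apply: cts_sub (kc i Qi) _ _; lra.
- move=> u i us Qi; apply: H => //; first lra.
  by move=> Fu; exact: h4 Fu us.
Qed.

End Calculus.

(** * Alternating charges *)

Section SignedLists.
Context {R : realType}.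

Definition nonincr_pos (phi : R -> R) :=
  (forall u, 0 < u -> 0 <= phi u) /\ (forall u v, 0 < u -> u <= v -> phi v <= phi u).

Section Ladder.
Context (phi : R -> R) (c : R).
Context (phiP : nonincr_pos phi) (c_gt0 : 0 < c).

Let B N q := \sum_(m < N) phi (q + m%:R * c).

Let arg_gt0 (q : R) (m : nat) : 0 < q -> 0 < q + m%:R * c.
Proof. by move=> q0; rewrite ltr_pwDl// mulr_ge0// ltW. Qed.

Let B_ge0 N (q : R) : 0 < q -> 0 <= B N q.
Proof. by move=> q0; apply: sumr_ge0 => m _; apply: phiP.1; exact: arg_gt0. Qed.

Let B_nincr N (q q' : R) : 0 < q -> q <= q' -> B N q' <= B N q.
Proof. by move=> q0 qq; apply: ler_sum => m _; apply: phiP.2; [exact: arg_gt0|rewrite lerD2r]. Qed.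

Let BS N (q : R) : B N.+1 q = phi q + B N (q + c).
Proof.
rewrite /B big_ord_recl mul0r addr0; congr (_ + _).
by apply: eq_bigr => m _; congr phi; rewrite lift0 -natr1; ring.
Qed.

Let B_leS N (q : R) : 0 < q -> B N q <= B N.+1 q.
Proof. by move=> q0; rewrite /B big_ord_recr/= lerDl; apply: phiP.1; exact: arg_gt0. Qed.

(** Here [s] gives signs and [p] positions counted from a test particle. A negative term pays for
    the first rung of the ladder, since [phi] is nonincreasing; a positive term uses up a rung, and
    if the next term is positive too, it lies at least [c] further. Hence the two claims: after a
    positive head the ladder starts one step later than after a negative head. *)
Lemma signed_sum_le (I : eqType) (s p : I -> R) (l : seq I) (i0 : I) N :
  path (fun i j => (p i <= p j) && ((s i == s j) ==> (p i + c <= p j))) i0 l ->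
  (forall i, i \in i0 :: l -> s i = 1 \/ s i = -1) ->
  (forall i, i \in l -> 0 < p i) -> (size l <= N)%N ->
  (s i0 = 1 -> 0 <= p i0 -> \sum_(i <- l) s i * phi (p i) <= \sum_(m < N) phi (p i0 + c + m%:R * c)) /\
  (s i0 = -1 -> 0 < p i0 -> \sum_(i <- l) s i * phi (p i) <= \sum_(m < N) phi (p i0 + m%:R * c)).
Proof.
elim: l i0 N => [|j l IH] i0 N.
  move=> _ _ _ _; split=> _ p0; rewrite big_nil; apply: B_ge0 => //.
  by rewrite ltr_wpDl.
move=> /= /andP[/andP[pij /implyP sij] pl] sl posl; case: N => // N lN.
have pj0 : 0 < p j by apply: posl; rewrite mem_head.
have [||IH1 IH2] := IH j N pl _ _ lN.
- by move=> i il; apply: sl; rewrite inE il orbT.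
- by move=> i il; apply: posl; rewrite inE il orbT.
have [s1|s1] : s j = 1 \/ s j = -1 by apply: sl; rewrite !inE eqxx orbT.
- have {}IH1 := IH1 s1 (ltW pj0).
  split=> s0 p0; rewrite big_cons s1 mul1r.
  + have pij' : p i0 + c <= p j by apply: sij; rewrite s0 s1.
    apply: (@le_trans _ _ (B N.+1 (p j))); first by rewrite BS lerD2l.
    by apply: B_nincr => //; rewrite ltr_wpDl.
  + apply: (@le_trans _ _ (B N.+1 (p j))); first by rewrite BS lerD2l.
    exact: B_nincr.
- have {}IH2 := IH2 s1 pj0.
  have K : \sum_(i <- j :: l) s i * phi (p i) <= B N (p j + c).
    rewrite big_cons s1 mulN1r; have := B_leS N pj0; rewrite BS.
    by move: IH2; rewrite -/(B N (p j)); lra.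
  split=> s0 p0; apply: (le_trans K).
  + apply: (@le_trans _ _ (B N (p i0 + c))); last by apply: B_leS; rewrite ltr_wpDl.
    by apply: B_nincr; [rewrite ltr_wpDl|rewrite lerD2r].
  + apply: (@le_trans _ _ (B N (p i0))); last exact: B_leS.
    by apply: B_nincr => //; apply: (le_trans pij); rewrite lerDl ltW.
Qed.

End Ladder.

(** Doubling makes every two adjacent terms cancel and leaves the two ends, whatever the parity of
    the length. *)
Lemma alternating_sum (I : eqType) (s : I -> R) (l : seq I) (i0 : I) :
  path (fun i j => s i != s j) i0 l ->
  (forall i, i \in i0 :: l -> s i = 1 \/ s i = -1) ->
  2 * \sum_(i <- i0 :: l) s i = s i0 + s (last i0 l).
Proof.
elim: l i0 => [|j l IH] i0 /=.
  by move=> _ _; rewrite big_seq1; ring.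
move=> /andP[sij pl] sl; rewrite big_cons mulrDr IH//; last first.
  by move=> i il; apply: sl; rewrite inE il orbT.
have [s0|s0] : s i0 = 1 \/ s i0 = -1 by apply: sl; rewrite !inE eqxx.
all: have [s1|s1] : s j = 1 \/ s j = -1 by apply: sl; rewrite !inE eqxx orbT.
all: by move: sij; rewrite s0 s1 ?eqxx// => _; ring.
Qed.

End SignedLists.

(** * Neighbouring charges as consecutive entries of sorted lists *)

Section Config.
Context {R : realType} {n : nat}.
Implicit Types (x b : 'rV[R]_n) (i j k : 'I_n) (c : R).

Definition nbr b i j :=
  [&& (i < j)%N, b 0 i * b 0 j != 0 & [forall k : 'I_n, (i < k < j)%N ==> (b 0 k == 0)]].

Lemma nbrP b i j : reflect (neighbors b i j) (nbr b i j).
Proof.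
apply: (iffP and3P) => -[h1 h2 h3]; split=> //.
  by move=> k kij; apply/eqP; move/forallP: h3 => /(_ k); rewrite kij.
by apply/forallP => k; apply/implyP => kij; apply/eqP; exact: h3.
Qed.

Definition charges b := forall i, b 0 i \in [:: -1; 0; 1].

(** Positions and charges are separate arguments because at a jump the new positions have to be
    combined with the charges before it. *)
Definition sgap c x b := forall i j, nbr b i j -> b 0 i = b 0 j -> c <= x 0 j - x 0 i.

Lemma charge_pm b i : charges b -> b 0 i != 0 -> b 0 i = 1 \/ b 0 i = -1.
Proof.
move=> /(_ i); rewrite !inE => /or3P[] /eqP ->; rewrite ?eqxx//; by [right|left].
Qed.

Lemma charge_sq b i : charges b -> b 0 i != 0 -> b 0 i * b 0 i = 1.
Proof. by move=> B /(charge_pm B)[] ->; ring. Qed.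

Lemma ltn_enum_filter (P : pred 'I_n) : sorted (fun i j : 'I_n => (i < j)%N) [seq k : 'I_n <- enum 'I_n | P k].
Proof.
apply: sorted_filter; first by move=> y z t /=; exact: ltn_trans.
have := iota_ltn_sorted 0 n; rewrite -val_enum_ord sorted_map; exact.
Qed.

Lemma mem_filter_enum (P : pred 'I_n) k : (k \in [seq k : 'I_n <- enum 'I_n | P k]) = P k.
Proof. by rewrite mem_filter mem_enum andbT. Qed.

(** A charged particle between two consecutive entries would satisfy [P] by the convexity premise,
    hence occur in the list, where there is no place between positions [m] and [m.+1]. *)
Lemma nbr_sorted b (P : pred 'I_n) : (forall k, P k -> b 0 k != 0) ->
  (forall i j k, P i -> P j -> (i < k < j)%N -> b 0 k != 0 -> P k) ->
  sorted (nbr b) [seq k : 'I_n <- enum 'I_n | P k].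
Proof.
move=> Pb Pc; set l := [seq k <- _ | _].
have lS : sorted (fun i j : 'I_n => (i < j)%N) l by exact: ltn_enum_filter.
case: (pickP 'I_n) => [i0 _|no]; last by case: l lS => // i s _; have := no i.
have tr : transitive (fun i j : 'I_n => (i < j)%N) by move=> y z t /=; exact: ltn_trans.
have Pn m : (m < size l)%N -> P (nth i0 l m).
  by move=> ml; have := mem_nth i0 ml; rewrite mem_filter => /andP[].
apply/(sortedP i0) => m ml.
have mono := sorted_ltn_nth tr i0 lS.
have ml' : (m < size l)%N by exact: ltnW.
have lt1 : (nth i0 l m < nth i0 l m.+1)%N by exact: mono.
apply/nbrP; split=> //.
  by rewrite mulf_neq0// Pb// Pn.
move=> k kij; apply/eqP/negPn/negP => bk.
have Pk : P k by apply: Pc kij bk; exact: Pn.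
have kl : k \in l by rewrite mem_filter Pk mem_enum.
have ks : (index k l < size l)%N by rewrite index_mem.
have kE := nth_index i0 kl.
have [h|h|h] := ltngtP (index k l) m.
- have : (nth i0 l (index k l) < nth i0 l m)%N by exact: mono.
  by rewrite kE; lia.
- have [h'|h'|h'] := ltngtP (index k l) m.+1.
  + lia.
  + have : (nth i0 l m.+1 < nth i0 l (index k l))%N by exact: mono.
    by rewrite kE; lia.
  + by move: kE kij; rewrite h' => ->; rewrite ltnn andbF.
- by move: kE kij; rewrite h => ->; rewrite ltnn.
Qed.

Lemma ltn_sorted_eq (l l' : seq 'I_n) : sorted (fun i j : 'I_n => (i < j)%N) l ->
  sorted (fun i j : 'I_n => (i < j)%N) l' -> l =i l' -> l = l'.
Proof.
apply: irr_sorted_eq; first by move=> y z t /=; exact: ltn_trans.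
by move=> y /=; rewrite ltnn.
Qed.

Lemma right_path b i : b 0 i != 0 ->
  path (nbr b) i [seq k : 'I_n <- enum 'I_n | (i < k)%N && (b 0 k != 0)].
Proof.
move=> bi.
have -> : path (nbr b) i [seq k : 'I_n <- enum 'I_n | (i < k)%N && (b 0 k != 0)] =
  sorted (nbr b) (i :: [seq k : 'I_n <- enum 'I_n | (i < k)%N && (b 0 k != 0)]) by [].
have -> : i :: [seq k : 'I_n <- enum 'I_n | (i < k)%N && (b 0 k != 0)] =
   [seq k : 'I_n <- enum 'I_n | (i <= k)%N && (b 0 k != 0)].
  apply: ltn_sorted_eq.
  - rewrite /= path_sortedE; last by move=> y z t /=; exact: ltn_trans.
    rewrite ltn_enum_filter andbT; apply/allP => k.
    by rewrite mem_filter => /andP[/andP[]].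
  - exact: ltn_enum_filter.
  - move=> k; rewrite in_cons !mem_filter_enum.
    have [->|ki] := eqVneq k i; first by rewrite leqnn bi.
    have ki' : (val i == val k) = false by rewrite eq_sym; exact: negbTE.
    by rewrite [in RHS]leq_eqVlt ki'.
apply: nbr_sorted => [k /andP[]//|p q k /andP[ip _] _ /andP[pk _] ->].
by rewrite andbT; lia.
Qed.

Lemma left_path b i : b 0 i != 0 ->
  path (fun y z => nbr b z y) i (rev [seq k : 'I_n <- enum 'I_n | (k < i)%N && (b 0 k != 0)]).
Proof.
move=> bi; set l := [seq k <- _ | _].
have -> : path (fun y z => nbr b z y) i (rev l) = sorted (fun y z => nbr b z y) (rev (rcons l i)).
  by rewrite rev_rcons.
rewrite rev_sorted.
have -> : rcons l i = [seq k : 'I_n <- enum 'I_n | (k <= i)%N && (b 0 k != 0)].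
  apply: ltn_sorted_eq.
  - rewrite -[rcons _ _]revK rev_sorted rev_rcons /= path_sortedE; last first.
      by move=> y z t /= h1 h2; exact: ltn_trans h2 h1.
    rewrite rev_sorted ltn_enum_filter andbT; apply/allP => k.
    by rewrite mem_rev mem_filter => /andP[/andP[]].
  - exact: ltn_enum_filter.
  - move=> k; rewrite mem_rcons in_cons !mem_filter_enum.
    have [->|ki] := eqVneq k i; first by rewrite leqnn bi.
    by rewrite [in RHS]leq_eqVlt (negbTE (_ : val k != val i)).
apply: nbr_sorted => [k /andP[]//|p q k _ /andP[qi _] /andP[_ kq] ->].
by rewrite andbT; lia.
Qed.

Lemma sum_filter_charged b (P : pred 'I_n) (F : 'I_n -> R) : (forall k, b 0 k = 0 -> F k = 0) ->
  \sum_(k | P k) F k = \sum_(k <- [seq k : 'I_n <- enum 'I_n | P k && (b 0 k != 0)]) F k.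
Proof.
move=> F0; rewrite big_filter big_enum_cond /=.
rewrite [RHS]big_mkcondr/= big_mkcond [RHS]big_mkcond /=.
by apply: eq_bigr => k _; case: ifP => // _; case: eqVneq => [/F0|].
Qed.

Lemma size_filter_ord (P : pred 'I_n) : (size [seq k : 'I_n <- enum 'I_n | P k] <= n)%N.
Proof. by rewrite size_filter (leq_trans (count_size _ _))// size_enum_ord. Qed.

(** Signs are taken relative to [i], so that [i] itself is a positive head at position 0 and the
    ladder of [signed_sum_le] starts at [c]. *)
Lemma force_right_le c x b i (phi : R -> R) : Zn (x, b) -> 0 < c -> sgap c x b -> b 0 i != 0 ->
  nonincr_pos phi ->
  \sum_(k < n | (i < k)%N) b 0 i * b 0 k * phi (x 0 k - x 0 i) <= \sum_(m < n) phi (m.+1%:R * c).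
Proof.
move=> [/= bch xb] c0 sg bi phiP.
rewrite (@sum_filter_charged b); last by move=> k ->; rewrite mulr0 mul0r.
set l := [seq k <- _ | _].
have P := right_path bi.
have lP k : k \in l -> (i < k)%N /\ b 0 k != 0 by rewrite mem_filter => /andP[/andP[]].
have [||||K _] := @signed_sum_le R phi c phiP c0 'I_n (fun k => b 0 i * b 0 k) (fun k => x 0 k - x 0 i) l i n.
- apply: sub_path P => p q pq /=; have /nbrP[h1 h2 h3] := pq.
  have := xb p q h1 h2; rewrite lerD2r => h; rewrite (ltW h)/=.
  apply/implyP => /eqP /(mulfI bi) h4; have := sg p q pq h4; lra.
- move=> k; rewrite inE => /orP[/eqP->|/lP[_ bk]]; first by left; rewrite charge_sq.
  have [->|->] := charge_pm bch bi; have [->|->] := charge_pm bch bk; rewrite ?mulN1r ?opprK ?mul1r; auto.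
- by move=> k /lP[ik bk]; rewrite subr_gt0; apply: xb => //; rewrite mulf_neq0.
- exact: size_filter_ord.
- move: K; rewrite subrr charge_sq// => /(_ erefl (lexx 0)) K.
  apply: (le_trans K); rewrite le_eqVlt; apply/orP; left; apply/eqP.
  by apply: eq_bigr => m _; congr phi; rewrite -natr1; ring.
Qed.

(** Mirror image of [force_right_le]; the list is reversed so that distances from [i] increase along
    it. *)
Lemma force_left_le c x b i (phi : R -> R) : Zn (x, b) -> 0 < c -> sgap c x b -> b 0 i != 0 ->
  nonincr_pos phi ->
  \sum_(k < n | (k < i)%N) b 0 i * b 0 k * phi (x 0 i - x 0 k) <= \sum_(m < n) phi (m.+1%:R * c).
Proof.
move=> [/= bch xb] c0 sg bi phiP.
rewrite (@sum_filter_charged b); last by move=> k ->; rewrite mulr0 mul0r.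
set l := [seq k <- _ | _].
have P := left_path bi.
have lP k : k \in rev l -> (k < i)%N /\ b 0 k != 0 by rewrite mem_rev mem_filter => /andP[/andP[]].
have E : \sum_(k <- l) b 0 i * b 0 k * phi (x 0 i - x 0 k) = \sum_(k <- rev l) b 0 i * b 0 k * phi (x 0 i - x 0 k).
  by apply: perm_big; rewrite perm_sym perm_rev.
rewrite E.
have [||||K _] := @signed_sum_le R phi c phiP c0 'I_n (fun k => b 0 i * b 0 k) (fun k => x 0 i - x 0 k) (rev l) i n.
- apply: sub_path P => p q pq /=; have /nbrP[h1 h2 h3] := pq.
  have h := xb q p h1 h2; apply/andP; split; first lra.
  apply/implyP => /eqP /(mulfI bi) h4; have := sg q p pq (esym h4); lra.
- move=> k; rewrite inE => /orP[/eqP->|/lP[_ bk]]; first by left; rewrite charge_sq.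
  have [->|->] := charge_pm bch bi; have [->|->] := charge_pm bch bk; rewrite ?mulN1r ?opprK ?mul1r; auto.
- by move=> k /lP[ik bk]; rewrite subr_gt0; apply: xb => //; rewrite mulf_neq0.
- by rewrite size_rev; exact: size_filter_ord.
- move: K; rewrite subrr charge_sq// => /(_ erefl (lexx 0)) K.
  apply: (le_trans K); rewrite le_eqVlt; apply/orP; left; apply/eqP.
  by apply: eq_bigr => m _; congr phi; rewrite -natr1; ring.
Qed.

End Config.

(** * Net charge of alternating blocks *)

Section Blocks.
Context {R : realType} {n : nat}.
Implicit Types (x b : 'rV[R]_n) (i j k : 'I_n) (c : R).

Lemma block_sum b (P : pred 'I_n) i j : charges b -> (forall k, P k -> b 0 k != 0) ->
  (forall p q k, P p -> P q -> (p < k < q)%N -> b 0 k != 0 -> P k) ->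
  (forall p q, P p -> P q -> nbr b p q -> b 0 p != b 0 q) ->
  P i -> P j -> (forall k, P k -> (i <= k <= j)%N) ->
  2 * \sum_(k | P k) b 0 k = b 0 i + b 0 j.
Proof.
move=> bc Pb Pc Pa Pi Pj Pij.
set L := [seq k : 'I_n <- enum 'I_n | P k].
have LS : sorted (nbr b) L by exact: nbr_sorted.
have E1 : L = i :: [seq k : 'I_n <- enum 'I_n | P k && (k != i)].
  apply: ltn_sorted_eq.
  - exact: ltn_enum_filter.
  - rewrite /= path_sortedE; last by move=> y z t /=; exact: ltn_trans.
    rewrite ltn_enum_filter andbT; apply/allP => k; rewrite mem_filter_enum => /andP[/Pij/andP[ik _] ki].
    by rewrite ltn_neqAle ik andbT eq_sym.
  - move=> k; rewrite in_cons !mem_filter_enum.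
    by have [->|ki] := eqVneq k i; [rewrite Pi|rewrite andbT].
have E2 : L = rcons [seq k : 'I_n <- enum 'I_n | P k && (k != j)] j.
  apply: ltn_sorted_eq.
  - exact: ltn_enum_filter.
  - rewrite -[rcons _ _]revK rev_sorted rev_rcons /= path_sortedE; last first.
      by move=> y z t /= h1 h2; exact: ltn_trans h2 h1.
    rewrite rev_sorted ltn_enum_filter andbT; apply/allP => k.
    rewrite mem_rev mem_filter_enum => /andP[/Pij/andP[_ kj] ki].
    by rewrite ltn_neqAle kj andbT.
  - move=> k; rewrite mem_rcons in_cons !mem_filter_enum.
    by have [->|ki] := eqVneq k j; [rewrite Pj|rewrite andbT].
have lastE : last i [seq k : 'I_n <- enum 'I_n | P k && (k != i)] = j.
  have -> : last i [seq k : 'I_n <- enum 'I_n | P k && (k != i)] = last i L by rewrite E1.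
  by rewrite E2 last_rcons.
have -> : \sum_(k | P k) b 0 k = \sum_(k <- L) b 0 k by rewrite big_filter big_enum_cond.
have LP : all P L by apply/allP => k; rewrite mem_filter_enum.
rewrite E1 in LS LP *.
rewrite (@alternating_sum R 'I_n (fun k => b 0 k)) ?lastE//.
- apply: (sub_in_path _ LP LS) => p q Pp Pq pq /=; exact: Pa.
- by move=> k /(allP LP)/Pb; exact: charge_pm.
Qed.

(** By [block_sum] the net charge is the mean of the two extreme charges. *)
Lemma block_sum_charge b (P : pred 'I_n) : charges b -> (forall k, P k -> b 0 k != 0) ->
  (forall p q k, P p -> P q -> (p < k < q)%N -> b 0 k != 0 -> P k) ->
  (forall p q, P p -> P q -> nbr b p q -> b 0 p != b 0 q) ->
  \sum_(k | P k) b 0 k \in [:: -1; 0; 1].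
Proof.
move=> bc Pb Pc Pa.
case: (pickP P) => [i0 Pi0|P0]; last by rewrite big_pred0// !inE eqxx orbT.
have [i Pi Hi] := arg_minnP (fun k : 'I_n => val k) Pi0.
have [j Pj Hj] := arg_maxnP (fun k : 'I_n => val k) Pi0.
have := @block_sum b P i j bc Pb Pc Pa Pi Pj.
have H k : P k -> (i <= k <= j)%N by move=> Pk; apply/andP; split; [exact: Hi|exact: Hj].
move=> /(_ H); set S := \sum_(k | _) _ => SE.
have SE' : S = (b 0 i + b 0 j) / 2 by rewrite -SE; field.
rewrite !inE SE'.
have [->|->] := charge_pm bc (Pb i Pi); have [->|->] := charge_pm bc (Pb j Pj); apply/or3P.
- by constructor 3; apply/eqP; field.
- by constructor 2; apply/eqP; field.
- by constructor 2; apply/eqP; field.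
- by constructor 1; apply/eqP; field.
Qed.

Lemma sum_norm_le (P : pred 'I_n) (F : 'I_n -> R) (M : R) : 0 <= M -> (forall k, P k -> `|F k| <= M) ->
  `|\sum_(k | P k) F k| <= n%:R * M.
Proof.
move=> M0 H; apply: (le_trans (ler_norm_sum _ _ _)).
rewrite big_mkcond /=.
apply: (@le_trans _ _ (\sum_(k < n) M)); last by rewrite sumr_const card_ord mulr_natl.
by apply: ler_sum => k _; case: ifP => // /H.
Qed.

End Blocks.

(** * Speeds of neighbours and of extreme particles *)

Section Forces.
Context {R : realType} {n : nat}.
Implicit Types (x b : 'rV[R]_n) (i j k : 'I_n) (c d u v t D kap gam : R) (f g : R -> R).

(** Convexity is recorded as monotonicity of the derivative, the form in which the estimates use it.
    Oddness includes the point 0 and thus yields [f 0 = 0], which [group_speed] uses for the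
    diagonal terms. *)
Record force f : Prop := Force {
  force_N : forall u, f (- u) = - f u ;
  force_drv : forall u, 0 < u -> is_derive u 1 f (derive1 f u) ;
  force_ge0 : forall u, 0 < u -> 0 <= f u ;
  force_drv_le0 : forall u, 0 < u -> derive1 f u <= 0 ;
  force_drv_le : forall u v, 0 < u -> u <= v -> derive1 f u <= derive1 f v }.

Lemma force_mvt f u v : force f -> 0 < u -> u <= v ->
  derive1 f u * (v - u) <= f v - f u <= derive1 f v * (v - u).
Proof.
move=> F u0 uv.
have H : cts u v f by apply: (@derive_cts R u v f (derive1 f)) => t tuv; apply: force_drv => //; lra.
apply/andP; split.
- have := @MVT_le R u v (fun t => - f t) (fun t => - derive1 f t) (- derive1 f u) set0 (finite_set0 _) uv (cts_opp H).
  move=> K; have {K} : - f v - - f u <= - derive1 f u * (v - u).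
    apply: K => t tuv _; split; first by apply: is_deriveN; apply: force_drv => //; lra.
    by rewrite lerN2; apply: force_drv_le => //; lra.
  lra.
- apply: (@MVT_le R u v f (derive1 f) (derive1 f v) set0 (finite_set0 _) uv H) => t tuv _.
  by split; [apply: force_drv => //; lra|apply: force_drv_le => //; lra].
Qed.

Lemma force_nincr f : force f -> nonincr_pos f.
Proof.
move=> F; split; first exact: force_ge0.
move=> u v u0 uv; have /andP[_ h] := force_mvt F u0 uv.
have : derive1 f v * (v - u) <= 0.
  by apply: mulr_le0_ge0; [apply: force_drv_le0 => //; lra|lra].
lra.
Qed.

Lemma force_lip f c u v : force f -> 0 < c -> c <= u -> c <= v -> `|f u - f v| <= - derive1 f c * `|u - v|.
Proof.
move=> F c0; wlog uv : u v / u <= v.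
  by move=> H cu cv; have [uv|uv] := leP u v; [exact: H|rewrite distrC (distrC u); apply: H => //; lra].
move=> cu cv; rewrite distrC (distrC u).
have u0 : 0 < u by lra.
have /andP[h1 h2] := force_mvt F u0 uv.
have v0 : 0 < v by lra.
have hn := (force_nincr F).2 u v u0 uv.
rewrite ler0_norm ?subr_le0// ger0_norm ?subr_ge0//.
have : derive1 f c * (v - u) <= derive1 f u * (v - u).
  by apply: ler_wpM2r; [lra|apply: force_drv_le => //].
lra.
Qed.

(** By convexity the derivative of [f (u + d) - f u] in [u] is nonnegative. These decrements measure
    how much more strongly a charge acts on the nearer of two particles at distance [d]. *)
Lemma force_diff_nincr f d : force f -> 0 <= d -> nonincr_pos (fun u => f u - f (u + d)).
Proof.
move=> F d0; split.
  by move=> u u0; rewrite subr_ge0; apply: (force_nincr F).2 => //; lra.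
move=> u v u0 uv.
have D t : u <= t <= v -> is_derive t 1 (fun t => f (t + d) - f t) (derive1 f (t + d) - derive1 f t).
  move=> tuv; apply: is_deriveB; last by apply: force_drv => //; lra.
  have t0 : 0 < t + d by lra.
  have := @is_derive1_comp R f (fun t => t + d) t (derive1 f (t + d)) 1 (force_drv F t0).
  rewrite mulr1; apply.
  have := is_deriveD (is_derive_id t (1 : R)) (is_derive_cst d t (1 : R)).
  by rewrite addr0.
have := @MVT_ge0 R u v _ _ set0 (finite_set0 _) uv (derive_cts D).
move=> K; have {K} : f (u + d) - f u <= f (v + d) - f v.
  apply: K => t tuv _; split; first by apply: D; lra.
  by rewrite subr_ge0; apply: force_drv_le => //; lra.
lra.
Qed.

(** The function is the excess of [f] over the affine function of slope [- kap] through the point of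
    the graph at [D]. The bound on [kap] keeps this line below the graph up to [D], where convexity
    makes the excess decrease to 0. The affine part can be summed exactly over a cluster, and the
    excess is left to the ladder. *)
Lemma force_tangent f D kap : force f -> 0 < D -> 0 <= kap -> kap <= - derive1 f D ->
  nonincr_pos (fun u => if u <= D then f u - f D - kap * (D - u) else 0).
Proof.
move=> F D0 k0 kD.
have H u v : 0 < u -> u <= v -> v <= D -> f v - kap * (D - v) <= f u - kap * (D - u).
  move=> u0 uv vD; have /andP[_ h] := force_mvt F u0 uv.
  have : derive1 f v * (v - u) <= - kap * (v - u).
    apply: ler_wpM2r; first lra.
    have := @force_drv_le f F v D; lra.
  lra.
split.
- move=> u u0; case: ifP => // uD; have := H u D u0 uD (lexx D); lra.
- move=> u v u0 uv; case: ifP => vD; case: ifP => uD //.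
  + have := H u v u0 uv vD; lra.
  + lra.
  + have := H u D u0 uD (lexx D); lra.
Qed.

(** The mean value bound between [D] and [2 * D], together with the sign of [f] at [2 * D]. It lets
    a lower bound on [- u * f' u] control [f] itself. *)
Lemma force_half f D : force f -> 0 < D -> - D * derive1 f (2 * D) <= f D.
Proof.
move=> F D0; have D2 : D <= 2 * D by lra.
have /andP[_ h] := force_mvt F D0 D2.
have : 0 <= f (2 * D) by apply: force_ge0 => //; lra.
have -> : - D * derive1 f (2 * D) = - (derive1 f (2 * D) * (2 * D - D)) by ring.
lra.
Qed.

Lemma velocityE f g x b i : force f -> velocity f g x b i =
  n%:R^-1 * (\sum_(k < n | (k < i)%N) b 0 i * b 0 k * f (x 0 i - x 0 k)
           - \sum_(k < n | (i < k)%N) b 0 i * b 0 k * f (x 0 k - x 0 i)) + b 0 i * g (x 0 i).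
Proof.
move=> F; rewrite /velocity; congr (_ * _ + _).
rewrite (bigID (fun k : 'I_n => (k < i)%N)) /=; congr (_ + _).
  apply: eq_bigl => k; have [->|ki] := eqVneq k i; first by rewrite ltnn.
  by [].
rewrite -sumrN; apply: eq_big => k.
  have [->|ki] := eqVneq k i; first by rewrite ltnn.
  by rewrite -leqNgt ltn_neqAle eq_sym ki.
by move=> _; rewrite -mulrN -force_N// opprB.
Qed.

(** No charge lies between neighbours, so the charges left of [j] are [i] and those left of [i],
    seen from [j] at distances larger by that of the pair. The square of a nonzero charge being 1,
    signs relative to [j] turn into signs relative to [i]. *)
Lemma nbr_split_left b x i j (phi : R -> R) : charges b -> nbr b i j ->
  \sum_(k < n | (k < j)%N) b 0 j * b 0 k * phi (x 0 j - x 0 k) =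
  b 0 i * b 0 j * phi (x 0 j - x 0 i) +
  b 0 i * b 0 j * \sum_(k < n | (k < i)%N) b 0 i * b 0 k * phi (x 0 i - x 0 k + (x 0 j - x 0 i)).
Proof.
move=> bc /nbrP[ij bij bk].
have bi : b 0 i != 0 by apply: contraNneq bij => ->; rewrite mul0r.
rewrite (bigD1 i)//=; congr (_ + _); first by ring.
rewrite mulr_sumr big_mkcond [RHS]big_mkcond /=; apply: eq_bigr => k _.
have [ki|ki|ki] := ltngtP k i.
- rewrite (ltn_trans ki ij) (_ : k != i); last by apply: contraTneq ki => ->; rewrite ltnn.
  have -> : x 0 i - x 0 k + (x 0 j - x 0 i) = x 0 j - x 0 k by ring.
  have E := charge_sq bc bi.
  have -> : b 0 i * b 0 j * (b 0 i * b 0 k * phi (x 0 j - x 0 k)) =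
    (b 0 i * b 0 i) * (b 0 j * b 0 k * phi (x 0 j - x 0 k)) by ring.
  by rewrite E mul1r.
- case: ifP => // /andP[kj _]; have -> : b 0 k = 0 by apply: bk; rewrite ki kj.
  by rewrite mulr0 mul0r.
- have -> : k = i by apply: val_inj.
  by rewrite eqxx andbF.
Qed.

Lemma nbr_split_right b x i j (phi : R -> R) : charges b -> nbr b i j ->
  \sum_(k < n | (i < k)%N) b 0 i * b 0 k * phi (x 0 k - x 0 i) =
  b 0 i * b 0 j * phi (x 0 j - x 0 i) +
  b 0 i * b 0 j * \sum_(k < n | (j < k)%N) b 0 j * b 0 k * phi (x 0 k - x 0 j + (x 0 j - x 0 i)).
Proof.
move=> bc /nbrP[ij bij bk].
have bj : b 0 j != 0 by apply: contraNneq bij => ->; rewrite mulr0.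
rewrite (bigD1 j)//=; congr (_ + _).
rewrite mulr_sumr big_mkcond [RHS]big_mkcond /=; apply: eq_bigr => k _.
have [ki|ki|ki] := ltngtP k j.
- case: ifP => // /andP[kj _]; have -> : b 0 k = 0 by apply: bk; rewrite ki kj.
  by rewrite mulr0 mul0r.
- rewrite (ltn_trans ij ki) (_ : k != j); last by apply: contraTneq ki => ->; rewrite ltnn.
  have -> : x 0 k - x 0 j + (x 0 j - x 0 i) = x 0 k - x 0 i by ring.
  have E := charge_sq bc bj.
  have -> : b 0 i * b 0 j * (b 0 j * b 0 k * phi (x 0 k - x 0 i)) =
    (b 0 j * b 0 j) * (b 0 i * b 0 k * phi (x 0 k - x 0 i)) by ring.
  by rewrite E mul1r.
- have -> : k = j by apply: val_inj.
  by rewrite eqxx andbF.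
Qed.

Lemma nincr_sum_le (phi : R -> R) c : nonincr_pos phi -> 0 < c ->
  \sum_(m < n) phi (m.+1%:R * c) <= n%:R * phi c.
Proof.
move=> P c0; apply: (@le_trans _ _ (\sum_(k < n) phi c)); last by rewrite sumr_const card_ord mulr_natl.
by apply: ler_sum => m _; apply: P.2 => //; rewrite ler_peMl ?ler1n// ltW.
Qed.

Lemma inv_n_ge0 : 0 <= n%:R^-1 :> R.
Proof. by rewrite invr_ge0. Qed.

Lemma inv_n_le i (y z : R) : y <= n%:R * z -> n%:R^-1 * y <= z.
Proof.
have n0 : 0 < n%:R :> R by rewrite ltr0n; case: n i => // -[].
by move=> h; rewrite mulrC ler_pdivrMr// mulrC.
Qed.

(** Up to the factor [1 / n], the mutual repulsion contributes [2 * f d] for a pair at distance [d].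
    The charges on either side act on the two particles with a difference that is a signed sum of
    [f u - f (u + d)]; its ladder of step [d] telescopes to at most [f d] per side, so repulsion
    wins and only [g] is left. *)
Lemma same_sign_speed f g x b i j : force f -> Zn (x, b) -> nbr b i j -> b 0 i = b 0 j ->
  sgap (x 0 j - x 0 i) x b ->
  b 0 i * (g (x 0 j) - g (x 0 i)) <= velocity f g x b j - velocity f g x b i.
Proof.
move=> F Z ij bij sg; have [/= bc xb] := Z.
have [ij' bij0 _] := nbrP _ _ _ ij.
have bi : b 0 i != 0 by apply: contraNneq bij0 => ->; rewrite mul0r.
have bj : b 0 j != 0 by rewrite -bij.
have d0 : 0 < x 0 j - x 0 i by rewrite subr_gt0; exact: xb.
set d := x 0 j - x 0 i in sg d0 *.
rewrite !velocityE// (nbr_split_left x f bc ij) (nbr_split_right x f bc ij) -/d.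
have E1 : b 0 i * b 0 j = 1 by rewrite bij charge_sq.
rewrite E1 !mul1r -bij.
have P := force_diff_nincr F (ltW d0).
have H1 := force_left_le Z d0 sg bi P.
have H2 := force_right_le Z d0 sg bj P.
have T : \sum_(m < n) (f (m.+1%:R * d) - f (m.+1%:R * d + d)) <= f d.
  have tel N : \sum_(m < N) (f (m.+1%:R * d) - f (m.+1%:R * d + d)) = f d - f (N.+1%:R * d).
    elim: N => [|m IH]; first by rewrite big_ord0 mul1r subrr.
    rewrite big_ord_recr /= IH.
    have -> : m.+1%:R * d + d = m.+2%:R * d by rewrite -[m.+2%:R]natr1; ring.
    lra.
  rewrite tel; have : 0 <= f (n.+1%:R * d) by apply: force_ge0 => //; rewrite mulr_gt0.
  lra.
have {}H1 := le_trans H1 T; have {}H2 := le_trans H2 T.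
have S1 : \sum_(k < n | (k < i)%N) b 0 i * b 0 k * (f (x 0 i - x 0 k) - f (x 0 i - x 0 k + d)) =
  \sum_(k < n | (k < i)%N) b 0 i * b 0 k * f (x 0 i - x 0 k) -
  \sum_(k < n | (k < i)%N) b 0 i * b 0 k * f (x 0 i - x 0 k + d).
  by rewrite -sumrB; apply: eq_bigr => k _; ring.
have S2 : \sum_(k < n | (j < k)%N) b 0 j * b 0 k * (f (x 0 k - x 0 j) - f (x 0 k - x 0 j + d)) =
  \sum_(k < n | (j < k)%N) b 0 j * b 0 k * f (x 0 k - x 0 j) -
  \sum_(k < n | (j < k)%N) b 0 j * b 0 k * f (x 0 k - x 0 j + d).
  by rewrite -sumrB; apply: eq_bigr => k _; ring.
rewrite S1 in H1; rewrite S2 in H2; rewrite -bij in H2 *.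
move: H1 H2; set A := \sum_(k < n | _) _; set A' := \sum_(k < n | _) _.
set B := \sum_(k < n | _) _; set B' := \sum_(k < n | _) _ => H1 H2.
have K : 0 <= n%:R^-1 * ((f d + A' - B) - (A - (f d + B'))).
  by apply: mulr_ge0; [exact: inv_n_ge0|lra].
rewrite -subr_ge0; apply: (le_trans K); rewrite le_eqVlt; apply/orP; left; apply/eqP; ring.
Qed.

(** Besides the attraction of the pair there are four signed sums, left and right of either
    particle, each worth at most [f c] after division by [n]. *)
Lemma opp_sign_speed f g x b i j c : force f -> Zn (x, b) -> nbr b i j -> b 0 i = - b 0 j ->
  0 < c -> sgap c x b ->
  - (2 * n%:R^-1 * f (x 0 j - x 0 i) + 4 * f c + `|g (x 0 j)| + `|g (x 0 i)|)
    <= velocity f g x b j - velocity f g x b i.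
Proof.
move=> F Z ij bij c0 sg; have [/= bc xb] := Z.
have [ij' bij0 _] := nbrP _ _ _ ij.
have bi : b 0 i != 0 by apply: contraNneq bij0 => ->; rewrite mul0r.
have bj : b 0 j != 0 by apply: contraNneq bij0 => ->; rewrite mulr0.
have d0 : 0 < x 0 j - x 0 i by rewrite subr_gt0; exact: xb.
rewrite !velocityE// (nbr_split_left x f bc ij) (nbr_split_right x f bc ij).
set d := x 0 j - x 0 i in d0 *.
have -> : b 0 i * b 0 j = -1 by rewrite bij mulNr charge_sq.
rewrite !mulN1r.
have P : nonincr_pos (fun u => f (u + d)).
  split; first by move=> u u0; apply: force_ge0 => //; lra.
  by move=> u v u0 uv; apply: (force_nincr F).2; lra.
have Pf := force_nincr F.
have fc : f (c + d) <= f c by apply: Pf.2; lra.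
have H1 := le_trans (force_left_le Z c0 sg bi P) (nincr_sum_le P c0).
have H2 := le_trans (force_right_le Z c0 sg bj P) (nincr_sum_le P c0).
have H3 := le_trans (force_left_le Z c0 sg bi Pf) (nincr_sum_le Pf c0).
have H4 := le_trans (force_right_le Z c0 sg bj Pf) (nincr_sum_le Pf c0).
move: H1 H2 H3 H4 => /(inv_n_le i) H1 /(inv_n_le i) H2 /(inv_n_le i) H3 /(inv_n_le i) H4.
have gb k : b 0 k != 0 -> `|b 0 k * g (x 0 k)| = `|g (x 0 k)|.
  by move=> bk; rewrite normrM; have [->|->] := charge_pm bc bk; rewrite ?normrN normr1 mul1r.
have G1 := gb i bi; have G2 := gb j bj.
have := ler_norm (b 0 i * g (x 0 i)); rewrite G1 => G1'.
have := lerNnormlW (lexx `|b 0 j * g (x 0 j)|); rewrite G2 => G2'.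
lra.
Qed.

Lemma charge_norm b k : charges b -> `|b 0 k| <= 1.
Proof.
by move=> /(_ k); rewrite !inE => /or3P[] /eqP ->; rewrite ?normrN ?normr1 ?normr0.
Qed.

Lemma far_sum_le f b (P : pred 'I_n) i c (y : 'I_n -> R) : force f -> charges b -> 0 < c ->
  (forall k, P k -> b 0 k != 0 -> c <= y k) ->
  `|\sum_(k < n | P k) b 0 i * b 0 k * f (y k)| <= n%:R * f c.
Proof.
move=> F bc c0 H; have fc : 0 <= f c by exact: force_ge0.
apply: sum_norm_le => // k Pk.
have [->|bk] := eqVneq (b 0 k) 0; first by rewrite mulr0 mul0r normr0.
rewrite !normrM; have yk := H k Pk bk.
rewrite [X in _ * X]ger0_norm; last by apply: force_ge0 => //; lra.
apply: (@le_trans _ _ (1 * f (y k))); last by rewrite mul1r; apply: (force_nincr F).2 => //.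
apply: ler_wpM2r; first by apply: force_ge0 => //; lra.
by rewrite -[leRHS]mulr1; apply: ler_pM => //; exact: charge_norm.
Qed.

(** The charges on the left push [i] to the right by at most a ladder of step [c]; those on the
    right are at least [gam] away. *)
Lemma rightmost_speed f g x b i c gam : force f -> Zn (x, b) -> b 0 i != 0 ->
  0 < c -> sgap c x b -> 0 < gam -> (forall k, (i < k)%N -> b 0 k != 0 -> gam <= x 0 k - x 0 i) ->
  velocity f g x b i <= f c + f gam + `|g (x 0 i)|.
Proof.
move=> F Z bi c0 sg g0 H; have [/= bc xb] := Z.
rewrite velocityE//; have Pf := force_nincr F.
have := le_trans (force_left_le Z c0 sg bi Pf) (nincr_sum_le Pf c0).
move=> /(inv_n_le i) H3.
have := @far_sum_le f b (fun k : 'I_n => (i < k)%N) i gam (fun k => x 0 k - x 0 i) F bc g0 H.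
rewrite ler_norml => /andP[H4 _].
have {}H4 : n%:R^-1 * - (\sum_(k < n | (i < k)%N) b 0 i * b 0 k * f (x 0 k - x 0 i)) <= f gam.
  by apply: (inv_n_le i); lra.
have : b 0 i * g (x 0 i) <= `|g (x 0 i)|.
  apply: (le_trans (ler_norm _)); rewrite normrM -[leRHS]mul1r; apply: ler_wpM2r => //; exact: charge_norm.
lra.
Qed.

Lemma leftmost_speed f g x b i c gam : force f -> Zn (x, b) -> b 0 i != 0 ->
  0 < c -> sgap c x b -> 0 < gam -> (forall k, (k < i)%N -> b 0 k != 0 -> gam <= x 0 i - x 0 k) ->
  - (f c + f gam + `|g (x 0 i)|) <= velocity f g x b i.
Proof.
move=> F Z bi c0 sg g0 H; have [/= bc xb] := Z.
rewrite velocityE//; have Pf := force_nincr F.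
have := le_trans (force_right_le Z c0 sg bi Pf) (nincr_sum_le Pf c0).
move=> /(inv_n_le i) H3.
have := @far_sum_le f b (fun k : 'I_n => (k < i)%N) i gam (fun k => x 0 i - x 0 k) F bc g0 H.
rewrite ler_norml => /andP[H4 _].
have {}H4 : n%:R^-1 * - (\sum_(k < n | (k < i)%N) b 0 i * b 0 k * f (x 0 i - x 0 k)) <= f gam.
  by apply: (inv_n_le i); lra.
have : - (b 0 i * g (x 0 i)) <= `|g (x 0 i)|.
  apply: (le_trans (ler_norm _)); rewrite normrN normrM -[leRHS]mul1r; apply: ler_wpM2r => //; exact: charge_norm.
lra.
Qed.

End Forces.

(** * Shrinking of clusters, and equal neighbours at a jump *)

Section GapPersistence.
Context {R : realType} {n : nat}.
Implicit Types (x b : 'rV[R]_n) (i j k : 'I_n) (c d u v t D kap gam e : R) (f g : R -> R).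

Lemma sgap_no_equal c x b (P : pred 'I_n) : sgap c x b ->
  (forall p q, P p -> P q -> (p < q)%N -> x 0 q - x 0 p < c) ->
  forall p q, P p -> P q -> nbr b p q -> b 0 p != b 0 q.
Proof.
move=> sg H p q Pp Pq pq; apply/eqP => bpq.
have [h _ _] := nbrP _ _ _ pq.
have := H p q Pp Pq h; have := sg p q pq bpq; lra.
Qed.

(** On the block between [i] and [j], write [f] as the affine function of [force_tangent] plus the
    excess [phi]. The excess acts through ladders of step [c > D], on which it vanishes, hence with
    nonpositive sum. The affine part depends only on the net charge [S] and the first moment [W] of
    the block, and [W] cancels or is multiplied by 0 when the two velocities are subtracted. Charges
    outside the block enter through four sums bounded by [f gam]. *)
Lemma shrink_speed f g x b i j c gam : force f -> Zn (x, b) -> (i < j)%N ->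
  b 0 i != 0 -> b 0 j != 0 -> 0 < c -> sgap c x b -> x 0 j - x 0 i < c -> 0 < gam ->
  (forall k, (k < i)%N -> b 0 k != 0 -> gam <= x 0 i - x 0 k) ->
  (forall k, (j < k)%N -> b 0 k != 0 -> gam <= x 0 k - x 0 j) ->
  velocity f g x b j - velocity f g x b i <=
  - (n%:R^-1 * Num.min (2 * f (x 0 j - x 0 i)) (- (x 0 j - x 0 i) * derive1 f (x 0 j - x 0 i)))
  + 4 * f gam + `|g (x 0 j)| + `|g (x 0 i)|.
Proof.
move=> F Z ij bi bj c0 sg Dc gam0 Hl Hr; have [/= bc xb] := Z.
have D0 : 0 < x 0 j - x 0 i by rewrite subr_gt0; apply: xb => //; rewrite mulf_neq0.
set D := x 0 j - x 0 i in Dc D0 *.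
have xle p q : b 0 p != 0 -> b 0 q != 0 -> (p <= q)%N -> x 0 p <= x 0 q.
  move=> bp bq; rewrite leq_eqVlt => /orP[/eqP/val_inj->//|pq].
  by apply: ltW; apply: xb => //; rewrite mulf_neq0.
pose P (k : 'I_n) := (i <= k <= j)%N && (b 0 k != 0).
pose S := \sum_(k < n | (i <= k <= j)%N) b 0 k.
have SE : 2 * S = b 0 i + b 0 j.
  have -> : S = \sum_(k < n | P k) b 0 k.
    rewrite /S big_mkcond [RHS]big_mkcond /=; apply: eq_bigr => k _; rewrite /P.
    by case: ifP => //= _; case: eqVneq.
  apply: block_sum => //.
  - by move=> k /andP[].
  - by move=> p q k /andP[/andP[ip _] _] /andP[/andP[_ qj] _] pkq bk; rewrite /P bk andbT; lia.
  - apply: (sgap_no_equal sg) => p q /andP[/andP[ip pj] bp] /andP[/andP[iq qj] bq] pq.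
    have := xle i p bi bp ip; have := xle q j bq bj qj; rewrite /D in Dc; lra.
  - by rewrite /P bi leqnn ltnW.
  - by rewrite /P bj leqnn ltnW.
  - by move=> k /andP[].
(* For [S = 0] the constant part already yields [- 2 * f D]. For [S] equal to both end charges it
   cancels, and the steepest admissible slope yields [D * f' D]. *)
pose kap := if S == 0 then 0 else - derive1 f D.
have kap0 : 0 <= kap.
  by rewrite /kap; case: ifP => // _; rewrite oppr_ge0; exact: force_drv_le0.
have kapD : kap <= - derive1 f D.
  by rewrite /kap; case: ifP => // _; rewrite oppr_ge0; exact: force_drv_le0.
have phiP := force_tangent F D0 kap0 kapD.
set phi := fun u => _ in phiP.
have phi0 : \sum_(m < n) phi (m.+1%:R * c) = 0.
  apply: big1 => m _; rewrite /phi; case: ifP => //.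
  have : c <= m.+1%:R * c by rewrite ler_peMl ?ler1n// ltW.
  lra.
have HL := force_left_le Z c0 sg bj phiP.
have HR := force_right_le Z c0 sg bi phiP.
rewrite phi0 in HL HR.
pose W := \sum_(k < n | (i <= k <= j)%N) b 0 k * (x 0 k - x 0 i).
have ijj : (i <= j <= j)%N by rewrite leqnn ltnW.
have iij : (i <= i <= j)%N by rewrite leqnn ltnW.
(* The terms [- 1] and [- D] take out the contribution of [j] itself to [S] and [W]. *)
have EL : \sum_(k < n | (k < j)%N) b 0 j * b 0 k * f (x 0 j - x 0 k) =
  \sum_(k < n | (k < j)%N) b 0 j * b 0 k * phi (x 0 j - x 0 k)
  + (f D * (b 0 j * S - 1) + kap * (b 0 j * W - D))
  + \sum_(k < n | (k < i)%N) b 0 j * b 0 k * f (x 0 j - x 0 k).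
  have -> : f D * (b 0 j * S - 1) + kap * (b 0 j * W - D) =
    \sum_(k < n | (i <= k <= j)%N && (k != j)) (b 0 j * b 0 k * (f D + kap * (x 0 k - x 0 i))).
    rewrite /S /W (bigD1 j) ?ijj//= (bigD1 j (P := fun k : 'I_n => (i <= k <= j)%N)) ?ijj//=.
    rewrite -/D.
    set A := \sum_(k < n | _) b 0 k; set B := \sum_(k < n | _) _.
    have -> : \sum_(k < n | (i <= k <= j)%N && (k != j)) (b 0 j * b 0 k * (f D + kap * (x 0 k - x 0 i))) = b 0 j * f D * A + b 0 j * kap * B.
      rewrite /A /B !mulr_sumr -big_split /=; apply: eq_bigr => k _; ring.
    have E := charge_sq bc bj.
    have -> : b 0 j * (b 0 j + A) = b 0 j * b 0 j + b 0 j * A by ring.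
    have -> : b 0 j * (b 0 j * D + B) = b 0 j * b 0 j * D + b 0 j * B by ring.
    rewrite E; ring.
  rewrite big_mkcond /= [X in _ = X + _ + _]big_mkcond [X in _ = _ + X + _]big_mkcond.
  rewrite [X in _ = _ + _ + X]big_mkcond -!big_split /=; apply: eq_bigr => k _.
  have [->|bk] := eqVneq (b 0 k) 0; first by rewrite !(mulr0, mul0r) !if_same !addr0.
  have [kj|kj|/val_inj kj] := ltngtP k j.
  - have kj' : k != j by apply: contraTneq kj => ->; rewrite ltnn.
    rewrite kj' !andbT; have [ki|ki] := ltnP k i; rewrite ?addr0 ?addr0.
    + have xki : x 0 k < x 0 i by apply: xb => //; rewrite mulf_neq0.
      have -> : phi (x 0 j - x 0 k) = 0 by rewrite /phi; case: ifP => //; rewrite /D; lra.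
      by rewrite mulr0 !add0r.
    + have xki : x 0 i <= x 0 k by exact: xle.
      rewrite /phi ifT; last by rewrite /D; lra.
      rewrite /D; ring.
  - by rewrite andbF !add0r ifN// -leqNgt; apply: ltnW; exact: ltn_trans kj.
  - by rewrite kj eqxx andbF !add0r ifN// -leqNgt ltnW.
have ER : \sum_(k < n | (i < k)%N) b 0 i * b 0 k * f (x 0 k - x 0 i) =
  \sum_(k < n | (i < k)%N) b 0 i * b 0 k * phi (x 0 k - x 0 i)
  + (f D * (b 0 i * S - 1) + kap * (b 0 i * (D * S - W) - D))
  + \sum_(k < n | (j < k)%N) b 0 i * b 0 k * f (x 0 k - x 0 i).
  have -> : f D * (b 0 i * S - 1) + kap * (b 0 i * (D * S - W) - D) =
    \sum_(k < n | (i <= k <= j)%N && (k != i)) (b 0 i * b 0 k * (f D + kap * (x 0 j - x 0 k))).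
    rewrite /S /W (bigD1 i) ?iij//= (bigD1 i (P := fun k : 'I_n => (i <= k <= j)%N)) ?iij//=.
    set A := \sum_(k < n | _) b 0 k; set B := \sum_(k < n | _) _.
    have -> : \sum_(k < n | (i <= k <= j)%N && (k != i)) (b 0 i * b 0 k * (f D + kap * (x 0 j - x 0 k))) = b 0 i * (f D + kap * D) * A - b 0 i * kap * B.
      rewrite /A /B !mulr_sumr -sumrB /=; apply: eq_bigr => k _; rewrite /D; ring.
    have E := charge_sq bc bi.
    have -> : b 0 i * (b 0 i + A) = b 0 i * b 0 i + b 0 i * A by ring.
    have -> : b 0 i * (D * (b 0 i + A) - (b 0 i * (x 0 i - x 0 i) + B)) = D * (b 0 i * b 0 i) + b 0 i * (D * A - B) by ring.
    rewrite E; ring.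
  rewrite big_mkcond /= [X in _ = X + _ + _]big_mkcond [X in _ = _ + X + _]big_mkcond.
  rewrite [X in _ = _ + _ + X]big_mkcond -!big_split /=; apply: eq_bigr => k _.
  have [->|bk] := eqVneq (b 0 k) 0; first by rewrite !(mulr0, mul0r) !if_same !addr0.
  have [ki|ki|/val_inj ki] := ltngtP i k.
  - have ki' : k != i by apply: contraTneq ki => ->; rewrite ltnn.
    rewrite ki' !andbT /=; have [kj|kj] := ltnP j k; rewrite ?addr0 ?addr0.
    + have xki : x 0 j < x 0 k by apply: xb => //; rewrite mulf_neq0.
      have -> : phi (x 0 k - x 0 i) = 0 by rewrite /phi; case: ifP => //; rewrite /D; lra.
      by rewrite mulr0 !add0r.
    + have xki : x 0 k <= x 0 j by exact: xle.
      rewrite /phi ifT; last by rewrite /D; lra.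
      rewrite /D; ring.
  - by rewrite /= !add0r ifN// -leqNgt; apply: ltnW; exact: ltn_trans ij.
  - by rewrite -ki eqxx andbF !add0r ifN// -leqNgt ltnW.
have far1 : `|\sum_(k < n | (k < i)%N) b 0 j * b 0 k * f (x 0 j - x 0 k)| <= n%:R * f gam.
  apply: (@far_sum_le R n f b (fun k : 'I_n => (k < i)%N) j gam (fun k => x 0 j - x 0 k)) => // k ki bk.
  have := Hl k ki bk; move: D0; rewrite /D; clear -n; lra.
have far2 : `|\sum_(k < n | (j < k)%N) b 0 i * b 0 k * f (x 0 k - x 0 i)| <= n%:R * f gam.
  apply: (@far_sum_le R n f b (fun k : 'I_n => (j < k)%N) i gam (fun k => x 0 k - x 0 i)) => // k ki bk.
  have := Hr k ki bk; move: D0; rewrite /D; clear -n; lra.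
have far3 : `|\sum_(k < n | (k < i)%N) b 0 i * b 0 k * f (x 0 i - x 0 k)| <= n%:R * f gam.
  by apply: (@far_sum_le R n f b (fun k : 'I_n => (k < i)%N) i gam (fun k => x 0 i - x 0 k)).
have far4 : `|\sum_(k < n | (j < k)%N) b 0 j * b 0 k * f (x 0 k - x 0 j)| <= n%:R * f gam.
  by apply: (@far_sum_le R n f b (fun k : 'I_n => (j < k)%N) j gam (fun k => x 0 k - x 0 j)).
have core : (f D * (b 0 j * S - 1) + kap * (b 0 j * W - D)) +
   (f D * (b 0 i * S - 1) + kap * (b 0 i * (D * S - W) - D)) <=
   - Num.min (2 * f D) (- D * derive1 f D).
  have [S0|S0] := eqVneq S 0.
    rewrite /kap S0 eqxx !mul0r !mulr0.
    have : Num.min (2 * f D) (- D * derive1 f D) <= 2 * f D by rewrite ge_min lexx.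
    by move: kapD kap0 D0; clear -n; lra.
  have : Num.min (2 * f D) (- D * derive1 f D) <= - D * derive1 f D by rewrite ge_min lexx orbT.
  rewrite /kap (negbTE S0).
  have [bE SE'] : b 0 i = b 0 j /\ S = b 0 j.
    move: SE S0; have [->|->] := charge_pm bc bi; have [->|->] := charge_pm bc bj => SE S0.
    - by move: SE; clear -n; split; lra.
    - by exfalso; move/eqP: S0; apply; move: SE; clear -n; lra.
    - by exfalso; move/eqP: S0; apply; move: SE; clear -n; lra.
    - by move: SE; clear -n; split; lra.
  rewrite bE SE' charge_sq//.
  have -> : b 0 j * (D * b 0 j - W) = D * (b 0 j * b 0 j) - b 0 j * W by ring.
  by rewrite charge_sq//; clear -n; lra.
rewrite !velocityE// EL ER.
move: far1 far2 far3 far4 HL HR core; rewrite !ler_norml.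
set A1 := \sum_(k < n | _) _; set A2 := \sum_(k < n | _) _; set A3 := \sum_(k < n | _) _.
set A4 := \sum_(k < n | _) _; set A5 := \sum_(k < n | _) _; set A6 := \sum_(k < n | _) _.
set M := Num.min _ _; set Q1 := f D * _ + _; set Q2 := f D * _ + _.
move=> /andP[f1 f1'] /andP[f2 f2'] /andP[f3 f3'] /andP[f4 f4'] HL HR core.
have K : n%:R^-1 * (A5 + Q1 + A1 - A4 - (A3 - (A6 + Q2 + A2)) + M) <= 4 * f gam.
  by apply: (inv_n_le i); move: f1 f1' f2 f2' f3 f3' f4 f4' HL HR core; clear -n; lra.
have gb k : `|b 0 k * g (x 0 k)| <= `|g (x 0 k)|.
  by rewrite normrM -[leRHS]mul1r; apply: ler_wpM2r => //; exact: charge_norm.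
have := gb i; have := gb j; rewrite !ler_norml => /andP[g1 g2] /andP[g3 g4].
by move: K g1 g2 g3 g4; clear -n; lra.
Qed.

(** Grouping by the occupied positions turns conservation at points into conservation over any set
    of positions. *)
Lemma cluster_sum (x b b' : 'rV[R]_n) (Q : pred R) :
  (forall y, \sum_(i < n | x 0 i == y) b 0 i = \sum_(i < n | x 0 i == y) b' 0 i) ->
  \sum_(i < n | Q (x 0 i)) b 0 i = \sum_(i < n | Q (x 0 i)) b' 0 i.
Proof.
move=> H.
have E (c : 'rV[R]_n) : \sum_(i < n | Q (x 0 i)) c 0 i =
  \sum_(y <- undup (codom (fun i => x 0 i)) | Q y) \sum_(i < n | x 0 i == y) c 0 i.
  rewrite (exchange_big_dep (fun i => Q (x 0 i))) /=; last by move=> y i Qy /eqP->.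
  apply: eq_bigr => i Qi; rewrite big_mkcond /=.
  rewrite (bigD1_seq (x 0 i)) ?undup_uniq ?mem_undup ?codom_f//= Qi eqxx /=.
  by rewrite big1 ?addr0// => y yi; rewrite [x 0 i == y]eq_sym (negbTE yi) andbF.
by rewrite !E; apply: eq_bigr => y _; exact: H.
Qed.

(** Just before the jump the order is only weak, since the positions are those of the jump time,
    where colliding particles coincide. Conservation is used over the closed interval from [x 0 p]
    to [x 0 q], in which only [p] and [q] remain charged. *)
Lemma weak_jump_sgap c x b b' : 0 < c -> charges b ->
  (forall i j, (i < j)%N -> b 0 i * b 0 j != 0 -> x 0 i <= x 0 j) -> sgap c x b ->
  Zn (x, b') ->
  (forall Q : pred R, \sum_(i < n | Q (x 0 i)) b' 0 i = \sum_(i < n | Q (x 0 i)) b 0 i) ->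
  sgap c x b'.
Proof.
move=> c0 bc xb sg [/= bc' xb'] sumE p q pq bpq.
rewrite leNgt; apply/negP => lt.
have [h1 h2 h3] := nbrP _ _ _ pq.
have bp : b' 0 p != 0 by apply: contraNneq h2 => ->; rewrite mul0r.
have bq : b' 0 q != 0 by rewrite -bpq.
have xpq : x 0 p < x 0 q by exact: xb'.
pose P (k : 'I_n) := (b 0 k != 0) && (x 0 p <= x 0 k <= x 0 q).
have xle i j : b 0 i != 0 -> b 0 j != 0 -> (i <= j)%N -> x 0 i <= x 0 j.
  move=> bi bj; rewrite leq_eqVlt => /orP[/eqP/val_inj->//|ij].
  by apply: xb => //; rewrite mulf_neq0.
have K : \sum_(k | P k) b 0 k \in [:: -1; 0; 1].
  apply: block_sum_charge => //.
  - by move=> k /andP[].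
  - move=> i j k /andP[bi /andP[pi _]] /andP[bj /andP[_ jq]] /andP[ik kj] bk; rewrite /P bk /=.
    have := xle i k bi bk (ltnW ik); have := xle k j bk bj (ltnW kj); lra.
  - apply: (sgap_no_equal sg) => i j /andP[bi /andP[pi _]] /andP[bj /andP[_ jq]] ij; lra.
have E : \sum_(k | P k) b 0 k = 2 * b' 0 p.
  have -> : \sum_(k | P k) b 0 k = \sum_(k < n | x 0 p <= x 0 k <= x 0 q) b 0 k.
    rewrite big_mkcond [RHS]big_mkcond /=; apply: eq_bigr => k _; rewrite /P.
    by case: eqVneq => //= ->; case: ifP.
  rewrite -(sumE (fun y => x 0 p <= y <= x 0 q)) (bigD1 p) /=; last by rewrite lexx ltW.
  rewrite (bigD1 q) /=; last by rewrite lexx ltW//=; apply: contraTneq h1 => ->; rewrite ltnn.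
  rewrite big1 ?addr0 -?bpq; first by ring.
  move=> k /andP[/andP[/andP[pk kq] kp] kq']; apply/eqP/negPn/negP => bk.
  have [lt1|lt1|/val_inj kp'] := ltngtP k p; last by rewrite kp' eqxx in kp.
    have : x 0 k < x 0 p by apply: xb' => //; rewrite mulf_neq0.
    lra.
  have [lt2|lt2|/val_inj kq''] := ltngtP k q; last by rewrite kq'' eqxx in kq'.
    by move: bk; rewrite h3 ?lt1// eqxx.
  have : x 0 q < x 0 k by apply: xb' => //; rewrite mulf_neq0.
  lra.
move: K; rewrite E !inE; have [->|->] := charge_pm bc' bp; move=> /or3P[] /eqP; lra.
Qed.

Lemma sep_exists x : exists2 gam, 0 < gam & forall i j, x 0 i != x 0 j -> gam <= `|x 0 i - x 0 j|.
Proof.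
pose d (p : 'I_n * 'I_n) : R := if x 0 p.1 == x 0 p.2 then 1 else `|x 0 p.1 - x 0 p.2|.
exists (\big[Num.min/1]_(p : 'I_n * 'I_n) d p).
  elim/big_ind: _ => // [y z y0 z0|p _]; first by rewrite lt_min y0.
  by rewrite /d; case: eqVneq => // ne; rewrite normr_gt0 subr_eq0.
move=> i j ne.
have -> : `|x 0 i - x 0 j| = d (i, j) by rewrite /d /= (negbTE ne).
exact: (bigmin_le_cond 1 d (P := xpredT) (j := (i, j))).
Qed.

Lemma sgap_exists x b : Zn (x, b) -> exists2 c, 0 < c & sgap c x b.
Proof.
move=> [/= bc xb]; have [c c0 H] := sep_exists x; exists c => // i j /nbrP[ij bij _] _.
have xij := xb i j ij bij.
have := H j i; rewrite ger0_norm; last lra.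
by apply; apply: contraTneq xij => ->; rewrite ltxx.
Qed.

Lemma sgap_perturb c e x x' b : sgap c x b -> (forall i, `|x' 0 i - x 0 i| <= e) -> sgap (c - 2 * e) x' b.
Proof.
move=> sg H i j ij bij; have := sg i j ij bij; have := H i; have := H j.
rewrite !ler_norml; lra.
Qed.

Lemma sgap_le c c' x b : sgap c x b -> c' <= c -> sgap c' x b.
Proof. by move=> sg h i j ij bij; exact: le_trans h (sg i j ij bij). Qed.

End GapPersistence.

Section DeriveShift.
Context {R : realType}.
Implicit Types (h : R -> R) (c t v : R).

Lemma is_derive_subc h c t v : is_derive t 1 h v -> is_derive t 1 (fun s => h s - c) v.
Proof. by move=> D; have := is_deriveB D (is_derive_cst c t (1 : R)); rewrite subr0. Qed.

Lemma is_derive_csub h c t v : is_derive t 1 h v -> is_derive t 1 (fun s => c - h s) (- v).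
Proof. by move=> D; have := is_deriveB (is_derive_cst c t (1 : R)) D; rewrite sub0r. Qed.

End DeriveShift.

(** * Solutions as concatenations of smooth pieces *)

Section Solutions.
Context {R : realType} {n : nat}.
Implicit Types (i j k : 'I_n) (c d u v t s D C L kap gam rho e T tau : R) (f g : R -> R) (S : set R)
  (x b : R -> 'rV[R]_n) (xi : 'rV[R]_n).

(** A form of solution without one-sided limits: charges are constant on pieces, with right
    continuity at the times of [S0] contained in [gs_const], and a jump is compared with any earlier
    time of the preceding piece. The initial time is free, so that solutions can be restricted and
    concatenated. That a charge jumps at most once is implied, as a jump leads to charge 0. *)
Record gsol f g t0 T S0 x b : Prop := GSol {
  gs_fin : finite_set S0 ;
  gs_times : forall t, S0 t -> t0 < t <= T ;
  gs_Zn : forall t, t0 <= t <= T -> Zn (x t, b t) ;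
  gs_cts : forall i, cts t0 T (fun t => x t 0 i) ;
  gs_const : forall s s', t0 <= s -> s <= s' -> s' <= T -> (forall u, s < u <= s' -> ~ S0 u) -> b s = b s' ;
  gs_jump : forall s tau, t0 <= s -> s < tau -> S0 tau -> (forall u, s < u < tau -> ~ S0 u) ->
    (forall i, b tau 0 i = b s 0 i \/ b tau 0 i = 0) /\
    (forall y, \sum_(i < n | x tau 0 i == y) b tau 0 i = \sum_(i < n | x tau 0 i == y) b s 0 i) ;
  gs_ode : forall t i, t0 < t < T -> ~ S0 t ->
    is_derive t 1 (fun s => x s 0 i) (velocity f g (x t) (b t) i) }.

Section Basics.
Context (f g : R -> R) (t0 T : R) (S0 : set R) (x b : R -> 'rV[R]_n).
Context (G : gsol f g t0 T S0 x b).

Lemma gs_ind (P : R -> Prop) t : t0 <= t <= T -> P t0 ->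
  (forall s s', t0 <= s -> s < s' -> s' <= t -> (forall u, s < u < s' -> ~ S0 u) -> P s -> P s') -> P t.
Proof.
move=> tT P0 H; apply: (@finite_itv_ind R S0 t0 t P (gs_fin G)) => //; first lra.
move=> s s' h1 h2 h3 h4; apply: H => // u us Su; exact: h4 Su us.
Qed.

Lemma gs_constE s s' u : t0 <= s -> s' <= T -> (forall u, s < u < s' -> ~ S0 u) ->
  s <= u < s' -> b u = b s.
Proof.
move=> h1 h2 h3 us; apply/esym; apply: (gs_const G); [lra|lra|lra|].
by move=> v vs; apply: h3; lra.
Qed.

Lemma gs_jumpE s tau : t0 <= s -> s < tau -> tau <= T -> (forall u, s < u < tau -> ~ S0 u) ->
    (forall i, b tau 0 i = b s 0 i \/ b tau 0 i = 0) /\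
    (forall y, \sum_(i < n | x tau 0 i == y) b tau 0 i = \sum_(i < n | x tau 0 i == y) b s 0 i).
Proof.
move=> h1 h2 h3 h4; have [St|nSt] := pselect (S0 tau); first exact: (gs_jump G).
have -> : b tau = b s.
  apply/esym; apply: (gs_const G); [lra|lra|lra|move=> u us].
  have [->//|ut] := eqVneq u tau; apply: h4; lra.
by split=> // i; left.
Qed.

Lemma gs_charges t : t0 <= t <= T -> charges (b t).
Proof. by move=> /(gs_Zn G)[]. Qed.

Lemma gs_left_le s s' : t0 <= s -> s < s' -> s' <= T -> (forall u, s < u < s' -> ~ S0 u) ->
  forall i j, (i < j)%N -> b s 0 i * b s 0 j != 0 -> x s' 0 i <= x s' 0 j.
Proof.
move=> h1 h2 h3 h4 i j ij bij.
rewrite -subr_ge0; apply: (@cts_closed_ge R s s' (fun t => x t 0 j - x t 0 i)) => //.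
  by apply: cts_sub2; apply: cts_sub (gs_cts G _) _ _; lra.
move=> t ts; have [|/= _ xb] := gs_Zn G (t := t); first lra.
rewrite subr_ge0; apply: ltW; apply: xb => //.
by rewrite (@gs_constE s s' t).
Qed.

Lemma gs_left_sgap c s s' : t0 <= s -> s < s' -> s' <= T -> (forall u, s < u < s' -> ~ S0 u) ->
  (forall t, s <= t < s' -> sgap c (x t) (b s)) -> sgap c (x s') (b s).
Proof.
move=> h1 h2 h3 h4 H i j ij bij.
apply: (@cts_closed_ge R s s' (fun t => x t 0 j - x t 0 i)) => //.
  by apply: cts_sub2; apply: cts_sub (gs_cts G _) _ _; lra.
by move=> t ts; apply: H.
Qed.

Lemma gs_nonzero_mono s t i : t0 <= s -> s <= t -> t <= T -> b t 0 i = b s 0 i \/ b t 0 i = 0.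
Proof.
move=> h1 h2 h3.
apply: (@finite_itv_ind R S0 s t (fun t => b t 0 i = b s 0 i \/ b t 0 i = 0) (gs_fin G)) => //; first by left.
move=> u u' k1 k2 k3 k4 k5.
have [|||v vs|J _] := @gs_jumpE u u'; try lra.
  by move=> Sv; exact: k4 Sv vs.
have := J i; case: k5 => -> [->|->]; auto.
Qed.

Lemma gs_restrict t1 t2 : t0 <= t1 -> t2 <= T -> gsol f g t1 t2 (S0 `&` `]t1, t2]) x b.
Proof.
move=> h1 h2; split.
- exact: finite_setIl (gs_fin G).
- by move=> t [_]; rewrite /= in_itv.
- by move=> t tt; apply: (gs_Zn G); lra.
- by move=> i; apply: cts_sub (gs_cts G i) _ _.
- move=> s s' k1 k2 k3 k4; apply: (gs_const G); [lra|lra|lra|].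
  move=> u us Su; apply: (k4 u us); split=> //=; rewrite in_itv/=; lra.
- move=> s tau k1 k2 [St]; rewrite /= in_itv/= => tt k4; apply: (gs_jump G) => //; first lra.
  move=> u us Su; apply: (k4 u us); split=> //=; rewrite in_itv/=; lra.
- move=> t i tt nS; apply: (gs_ode G); first lra.
  move=> St; apply: nS; split=> //=; rewrite in_itv/=; lra.
Qed.

Lemma gs_pred tau : t0 < tau -> tau <= T -> exists s, [/\ t0 <= s, s < tau & forall u, s < u < tau -> ~ S0 u].
Proof.
move=> h1 h2.
suff [s [k1 k2 k3]] : exists s, [/\ t0 <= s, s < tau & forall u, S0 u -> ~ (s < u < tau)].
  by exists s; split=> // u us Su; exact: k3 Su us.
have /finite_seqP[l lE] := gs_fin G.
rewrite lE; elim: l {lE} => [|w l [s [k1 k2 k3]]].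
  by exists t0; split=> // u; rewrite /= in_nil.
have [ws|ws] := boolP (s < w < tau).
  exists w; split; [lra|lra|] => u /=; rewrite in_cons => /orP[/eqP->|ul]; first lra.
  by have := k3 u ul => h ?; apply: h; lra.
exists s; split=> // u /=; rewrite in_cons => /orP[/eqP->|ul]; first exact/negP.
exact: k3.
Qed.

Lemma gs_succ tau : t0 <= tau -> tau < T -> exists s, [/\ tau < s, s <= T & forall u, tau < u < s -> ~ S0 u].
Proof.
move=> h1 h2.
suff [s [k1 k2 k3]] : exists s, [/\ tau < s, s <= T & forall u, S0 u -> ~ (tau < u < s)].
  by exists s; split=> // u us Su; exact: k3 Su us.
have /finite_seqP[l lE] := gs_fin G.
rewrite lE; elim: l {lE} => [|w l [s [k1 k2 k3]]].
  by exists T; split=> // u; rewrite /= in_nil.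
have [ws|ws] := boolP (tau < w < s).
  exists w; split; [lra|lra|] => u /=; rewrite in_cons => /orP[/eqP->|ul]; first lra.
  by have := k3 u ul => h ?; apply: h; lra.
exists s; split=> // u /=; rewrite in_cons => /orP[/eqP->|ul]; first exact/negP.
exact: k3.
Qed.

End Basics.

(* The largest same-sign gap bound that decays slower than any minimal gap can
   shrink; the slack [L + 1 > L] makes the barrier strict. *)
Definition gap_rate (L c t0 t : R) : R := c * expR (- (L + 1) * (t - t0)).

Lemma is_derive_gap_rate L c t0 t :
  is_derive t 1 (gap_rate L c t0) (- (L + 1) * gap_rate L c t0 t).
Proof.
have D1 : is_derive t 1 (fun t => - (L + 1) * (t - t0)) (- (L + 1) * (1 - 0)).
  by apply: is_deriveZ; apply: is_deriveB.
have D2 := @is_derive1_comp R expR (fun t => - (L + 1) * (t - t0)) _ _ _ (is_derive_expR _) D1.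
have D3 := is_deriveZ c D2.
have E : c *: (expR (- (L + 1) * (t - t0)) * (- (L + 1) * (1 - 0))) = - (L + 1) * gap_rate L c t0 t.
  by rewrite /gap_rate /GRing.scale/=; ring.
by rewrite -E; exact: D3.
Qed.

Lemma gap_rate_gt0 L c t0 t : 0 < c -> 0 < gap_rate L c t0 t.
Proof. by move=> c0; rewrite mulr_gt0// expR_gt0. Qed.

Lemma gap_rate_decr L c t0 t t' : 0 <= L -> 0 < c -> t <= t' -> gap_rate L c t0 t' <= gap_rate L c t0 t.
Proof.
move=> L0 c0 tt; rewrite /gap_rate; apply: ler_wpM2l; first exact: ltW.
by rewrite ler_expR !mulNr lerN2; apply: ler_wpM2l; lra.
Qed.

Lemma gap_rate0 L c t0 : gap_rate L c t0 t0 = c.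
Proof. by rewrite /gap_rate subrr mulr0 expR0 mulr1. Qed.

(** The slack of the rate absorbs an additive error [e] below the final bound, so forces merely
    close to a Lipschitz function are covered. The barrier handles the continuous motion, and
    [weak_jump_sgap] passes each jump. *)
Lemma gs_sgap_rate f g t0 T S0 x b L c e : force f -> gsol f g t0 T S0 x b -> 0 <= L -> 0 < c ->
  (forall u v, `|g u - g v| <= L * `|u - v| + e) -> e < gap_rate L c t0 T ->
  sgap c (x t0) (b t0) ->
  forall t, t0 <= t <= T -> sgap (gap_rate L c t0 t) (x t) (b t).
Proof.
move=> F G L0 c0 gL eT sg0 t tT.
apply: (gs_ind G (P := fun t => sgap (gap_rate L c t0 t) (x t) (b t)) tT).
  by rewrite gap_rate0.
move=> s s' h1 h2 h3 h4 sgs.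
have s'T : s' <= T by lra.
pose Q (p : 'I_n * 'I_n) := nbr (b s) p.1 p.2 && (b s 0 p.1 == b s 0 p.2).
have bE u : s <= u < s' -> b u = b s by exact: (gs_constE G h1 s'T h4).
pose k (p : 'I_n * 'I_n) t := x t 0 p.2 - x t 0 p.1 - gap_rate L c t0 t.
pose dk (p : 'I_n * 'I_n) t := velocity f g (x t) (b t) p.2 - velocity f g (x t) (b t) p.1
   - (- (L + 1) * gap_rate L c t0 t).
have K := @barrier R _ Q k dk s s' 1 set0 (finite_set0 _) (ltW h2) ltr01.
have {}K : forall t p, s <= t <= s' -> Q p -> 0 <= k p t.
  apply: K.
  - move=> p _; apply: cts_sub2; first by apply: cts_sub2; apply: cts_sub (gs_cts G _) _ _; lra.
    by apply: derive_cts => u _; exact: is_derive_gap_rate.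
  - by move=> p /andP[pn /eqP pe]; rewrite subr_ge0; exact: sgs.
  - move=> u p us _ Qp kp kmin; have uT : t0 <= u <= T by lra.
    have Zu := gs_Zn G uT.
    have nS : ~ S0 u by apply: h4; lra.
    have bu : b u = b s by apply: bE; lra.
    split.
      apply: is_deriveB; last exact: is_derive_gap_rate.
      by apply: is_deriveB; apply: (gs_ode G) => //; lra.
    have /andP[pn /eqP pe] := Qp.
    have dpos := gap_rate_gt0 L t0 u c0.
    (* [gap_rate] is the same for all pairs, so the minimal [k p] belongs to the closest pair, and
       all equal neighbours are at least as far apart as this one. *)
    have sg : sgap (x u 0 p.2 - x u 0 p.1) (x u) (b u).
      rewrite bu => i j ij bij; have := kmin (i, j); rewrite /k /= /Q /= ij bij eqxx => /(_ isT); lra.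
    rewrite -bu in pn pe.
    have H := same_sign_speed g F Zu pn pe sg.
    have [p12 bp _] := nbrP _ _ _ pn.
    have bc := gs_charges G uT.
    have bp1 : b u 0 p.1 != 0 by apply: contraNneq bp => ->; rewrite mul0r.
    have d0 : 0 < x u 0 p.2 - x u 0 p.1 by rewrite subr_gt0; have [/= _] := Zu; apply.
    have gb : - (L * (x u 0 p.2 - x u 0 p.1) + e) <= b u 0 p.1 * (g (x u 0 p.2) - g (x u 0 p.1)).
      have := gL (x u 0 p.2) (x u 0 p.1); rewrite [X in L * X]ger0_norm; last lra.
      by rewrite ler_norml => /andP[g1 g2]; have [->|->] := charge_pm bc bp1; move: g1 g2; clear -n; lra.
    have er : e < gap_rate L c t0 u by apply: (lt_le_trans eT); apply: gap_rate_decr => //; lra.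
    have : L * (x u 0 p.2 - x u 0 p.1) <= L * gap_rate L c t0 u.
      by apply: ler_wpM2l => //; move: kp; rewrite /k; lra.
    rewrite /dk; lra.
have sgl : sgap (gap_rate L c t0 s') (x s') (b s).
  move=> i j ij bij; have := K s' (i, j); rewrite /k /= /Q /= ij bij eqxx => /(_ _ isT).
  by rewrite lexx ltW// => /(_ isT); rewrite subr_ge0.
have [J1 J2] := gs_jumpE G h1 h2 s'T h4.
apply: (weak_jump_sgap (gap_rate_gt0 _ _ _ c0) _ _ sgl).
- by apply: (gs_charges G); lra.
- exact: (gs_left_le G h1 h2 s'T h4).
- by apply: (gs_Zn G); lra.
- by move=> Q'; apply: cluster_sum.
Qed.

Lemma gs_sgap f g t0 T S0 x b L c e : force f -> gsol f g t0 T S0 x b -> 0 <= L -> 0 < c ->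
  (forall u v, `|g u - g v| <= L * `|u - v| + e) -> e < gap_rate L c t0 T ->
  sgap c (x t0) (b t0) ->
  forall t, t0 <= t <= T -> sgap (gap_rate L c t0 T) (x t) (b t).
Proof.
move=> F G L0 c0 gL eT sg0 t tT; apply: sgap_le (gs_sgap_rate F G L0 c0 gL eT sg0 tT) _.
by apply: gap_rate_decr => //; lra.
Qed.

(* A particle cannot leave the hull of its cluster faster than the speed of the
   extreme charge, which attraction inside the cluster only slows down. *)
Lemma gs_hull f g t1 t2 S0 x b xi c gam rho G0 C : force f -> gsol f g t1 t2 S0 x b -> t1 <= t2 ->
  0 < c -> 0 < gam ->
  (forall t, t1 <= t <= t2 -> sgap c (x t) (b t)) ->
  (forall i j, xi 0 i != xi 0 j -> 4 * gam <= `|xi 0 i - xi 0 j|) ->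
  (forall u i, `|u - xi 0 i| <= gam -> `|g u| <= G0) ->
  (forall i, `|x t1 0 i - xi 0 i| <= rho) ->
  f c + f gam + G0 < C -> 0 < C -> rho + C * (t2 - t1) < gam ->
  forall t i, t1 <= t <= t2 -> `|x t 0 i - xi 0 i| <= rho + C * (t - t1).
Proof.
move=> F G t12 c0 gam0 sg sep gb x1 CG C0 rC.
pose k (p : 'I_n * bool) t := rho + C * (t - t1) - (if p.2 then x t 0 p.1 - xi 0 p.1 else xi 0 p.1 - x t 0 p.1).
pose dk (p : 'I_n * bool) t := C - (if p.2 then velocity f g (x t) (b t) p.1 else - velocity f g (x t) (b t) p.1).
(* Within this band every particle is less than [gam] from its reference point, so distinct clusters
   stay [2 * gam] apart. *)
pose eta := gam - (rho + C * (t2 - t1)).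
have eta0 : 0 < eta by rewrite /eta; lra.
have K := @barrier R _ xpredT k dk t1 t2 eta S0 (gs_fin G) t12 eta0.
suff K2 : forall t p, t1 <= t <= t2 -> true -> 0 <= k p t.
  move=> t i tt; rewrite ler_norml.
  have := K2 t (i, true) tt isT; have := K2 t (i, false) tt isT; rewrite /k /=; lra.
apply: K.
- move=> [i p] _; apply: cts_sub2.
    by apply: cts_add; [exact: cts_cst|apply: cts_scale; apply: cts_sub2; [exact: cts_id|exact: cts_cst]].
  by rewrite /=; case: p; apply: cts_sub2; (exact: cts_cst || exact: gs_cts G _).
- move=> [i p] _; have := x1 i; rewrite ler_norml /k /=; case: p; lra.
move=> u [i p] tt nS _ kp kmin.
have uT : t1 <= u <= t2 by lra.
have Zu := gs_Zn G uT; have [/= bc xb] := Zu; have sgu := sg u uT.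
have Di := gs_ode G i tt nS.
have dev j : `|x u 0 j - xi 0 j| < gam.
  have := kmin (j, true) isT; have := kmin (j, false) isT; move: kp; rewrite /k /= ltr_norml.
  rewrite /eta; have : C * (u - t1) <= C * (t2 - t1) by rewrite ler_wpM2l; lra.
  lra.
have far j : xi 0 j != xi 0 i -> 2 * gam <= `|x u 0 j - x u 0 i|.
  move=> ne; have := sep j i ne; have := dev j; have := dev i.
  rewrite !ltr_norml !ler_normr; lra.
have gi : `|g (x u 0 i)| <= G0 by apply: gb (ltW (dev i)).
have G00 : 0 <= G0 := le_trans (normr_ge0 _) gi.
have fc0 : 0 <= f c by exact: force_ge0.
have fg0 : 0 <= f gam by exact: force_ge0.
have DC : is_derive u 1 (fun t => rho + C * (t - t1)) C.
  have E : 0 + C *: (1 - 0) = C :> R by rewrite /GRing.scale/=; ring.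
  by rewrite -[X in is_derive _ _ _ X]E; apply: is_deriveD; apply: is_deriveZ; apply: is_deriveB.
have [b0|bi] := eqVneq (b u 0 i) 0.
  have v0 : velocity f g (x u) (b u) i = 0.
    by rewrite /velocity b0 mul0r big1 ?mulr0 ?addr0// => k' _; rewrite !mul0r.
  have dx := Di; rewrite v0 in dx; rewrite /dk /k /= v0.
  split; last by case: p {kp kmin}; lra.
  case: p {kp kmin} => /=; apply: is_deriveB => //.
  - exact: is_derive_subc.
  - exact: is_derive_csub.
case: p kp kmin => kp kmin; rewrite /dk {1}/k /=; split.
- by apply: is_deriveB => //; exact: is_derive_subc.
- have : velocity f g (x u) (b u) i <= f c + f gam + `|g (x u 0 i)|.
    apply: (rightmost_speed g F Zu bi c0 sgu gam0) => j ij bj.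
    have xij : x u 0 i < x u 0 j by apply: xb => //; rewrite mulf_neq0.
    (* A charge of the same cluster further to the right would have a smaller [k], so minimality
       leaves only charges of other clusters on that side. *)
    have [e|ne] := eqVneq (xi 0 j) (xi 0 i).
      have := kmin (j, true) isT; rewrite /k /= e; move: xij; clear -n; lra.
    have := far j ne; rewrite ger0_norm; move: xij gam0; clear -n; lra.
  lra.
- by apply: is_deriveB => //; exact: is_derive_csub.
- have : - (f c + f gam + `|g (x u 0 i)|) <= velocity f g (x u) (b u) i.
    apply: (leftmost_speed g F Zu bi c0 sgu gam0) => j ij bj.
    have xij : x u 0 j < x u 0 i by apply: xb => //; rewrite mulf_neq0.
    have [e|ne] := eqVneq (xi 0 j) (xi 0 i).
      have := kmin (j, false) isT; rewrite /k /= e; move: xij; clear -n; lra.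
    have := far j ne; rewrite ler0_norm; move: xij gam0; clear -n; lra.
  lra.
Qed.

End Solutions.

(** * One-sided neighbourhoods, Lipschitz maps, norms *)

Section Filters.
Context {R : realType}.
Implicit Types (P : R -> Prop) (t : R).

Lemma near_leftP t P : (\forall u \near t^'-, P u) <-> exists2 s, s < t & forall u, s < u < t -> P u.
Proof.
split.
- move=> /nbhs_ballP[e /= e0 H]; exists (t - e); first lra.
  by move=> u ut; apply: H; rewrite /ball/= ?ltr_norml; lra.
- move=> [s st H]; near=> u; apply: H; apply/andP; split; near: u.
    exact: nbhs_left_gt.
  exact: nbhs_left_lt.
Unshelve. all: by end_near.
Qed.

Lemma near_rightP t P : (\forall u \near t^'+, P u) <-> exists2 s, t < s & forall u, t < u < s -> P u.
Proof.
split.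
- move=> /nbhs_ballP[e /= e0 H]; exists (t + e); first lra.
  by move=> u ut; apply: H; rewrite /ball/= ?ltr_norml; lra.
- move=> [s st H]; near=> u; apply: H; apply/andP; split; near: u.
    exact: nbhs_right_gt.
  exact: nbhs_right_lt.
Unshelve. all: by end_near.
Qed.

Lemma lipschitzP (g : R -> R) : lipschitz g <-> exists2 L, 0 <= L & forall u v, `|g u - g v| <= L * `|u - v|.
Proof.
split.
- move=> [M [_ H]].
  exists (`|M| + 1); first by rewrite addr_ge0.
  move=> u v; have := H (`|M| + 1) _ (u, v); apply => //.
  by rewrite (le_lt_trans (ler_norm _))// ltrDl.
- move=> [L L0 H]; exists L; split; first exact: ger0_real.
  move=> M LM [u v] _ /=; apply: (le_trans (H u v)); apply: ler_wpM2r => //; exact: ltW.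
Qed.

Lemma lipschitz_continuous (g : R -> R) L : 0 <= L -> (forall u v, `|g u - g v| <= L * `|u - v|) ->
  continuous g.
Proof.
move=> L0 H t; apply/cvgrPdist_lt => e e0.
have L1 : 0 < L + 1 by lra.
apply/nbhs_ballP; exists (e / (L + 1)); first by rewrite /= divr_gt0.
move=> s; rewrite /ball/= ltr_pdivlMr// => ts; apply: (le_lt_trans (H t s)).
have := normr_ge0 (t - s); lra.
Qed.

Lemma mx_norm_ltP (n : nat) (v : 'rV[R]_n) e : 0 < e -> (`|v| < e) <-> (forall i, `|v 0 i| < e).
Proof.
move=> e0; rewrite -[`|v|]/(mx_norm v) mx_normrE; split.
- move=> H i; apply: le_lt_trans H; exact: (@le_bigmax _ _ _ 0 (fun p : 'I_1 * 'I_n => `|v p.1 p.2|) (0, i)).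
- by move=> H; apply/bigmax_ltP; split=> // -[i j] _ /=; rewrite (ord1 i).
Qed.

Lemma mx_norm_leP (n : nat) (v : 'rV[R]_n) e : 0 <= e -> (`|v| <= e) <-> (forall i, `|v 0 i| <= e).
Proof.
move=> e0; rewrite -[`|v|]/(mx_norm v) mx_normrE; split.
- move=> H i; apply: le_trans H; exact: (@le_bigmax _ _ _ 0 (fun p : 'I_1 * 'I_n => `|v p.1 p.2|) (0, i)).
- by move=> H; apply/bigmax_leP; split=> // -[i j] _ /=; rewrite (ord1 i).
Qed.

Lemma charge_eq (a a' : R) : a \in [:: -1; 0; 1] -> a' \in [:: -1; 0; 1] -> `|a - a'| < 1 -> a = a'.
Proof.
rewrite !inE => /or3P[] /eqP-> /or3P[] /eqP->; rewrite ltr_norml; lra.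
Qed.

End Filters.

(** * Equivalence with the original notion of solution *)

Section Conversion.
Context {R : realType} {n : nat}.
Implicit Types (i j k : 'I_n) (c d u v t s D C L kap gam rho e T tau : R) (f g : R -> R) (S : set R)
  (x b : R -> 'rV[R]_n).

Lemma cts_mxP a T x : {within `[a, T], continuous x} <-> forall i, cts a T (fun t => x t 0 i).
Proof.
split.
- move/subspace_continuousP => H i t tT e e0.
  have /cvgrPdist_lt/(_ e e0) := H t tT.
  rewrite /within/= => /nbhs_ballP[d /= d0 Hd]; exists d => // s sT sd.
  have : `|x t - x s| < e by apply: Hd => //; rewrite /ball/= distrC.
  by move/(mx_norm_ltP _ e0)/(_ i); rewrite !mxE distrC.
- move=> H; apply/subspace_continuousP => t tT.
  apply/cvgrPdist_lt => e e0.
  have K i : exists d, 0 < d /\ forall s, a <= s <= T -> `|s - t| < d -> `|x s 0 i - x t 0 i| < e.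
    by have [d d0 Hd] := H i t tT e e0; exists d.
  have [d Hd] := choice K.
  pose m := \big[Num.min/1]_i d i.
  have m0 : 0 < m.
    by rewrite /m; elim/big_ind: _ => // [y z y0 z0|i _]; [rewrite lt_min y0|have [] := Hd i].
  rewrite /within/=; apply/nbhs_ballP; exists m => // s; rewrite /ball/= => st sT.
  apply/mx_norm_ltP => // i; rewrite !mxE distrC; have [_] := Hd i; apply=> //.
  by rewrite distrC (lt_le_trans st)// /m; exact: bigmin_le_cond.
Qed.

Section Sol.
Context (f g : R -> R) (T : R) (x0 b0 : 'rV[R]_n) (S0 : set R) (x b : R -> 'rV[R]_n).
Context (H : solution_with f g T x0 b0 S0 x b).

Let bch t i : 0 <= t <= T -> b t 0 i \in [:: -1; 0; 1].
Proof. by move=> /(sol_Zn H)[]. Qed.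

Let left_const t i : 0 < t <= T -> (~ jumps_at T (fun s => b s 0 i) t) ->
  exists2 e, 0 < e & forall s, 0 <= s -> t - e < s <= t -> b s 0 i = b t 0 i.
Proof.
move=> tT nj.
have tT' : `[0, T]%classic t by rewrite /= in_itv/=; lra.
have /contrapT cv : ~ ~ (b s 0 i @[s --> within `[0, T] (nbhs t)] --> b t 0 i).
  by move=> h; apply: nj.
have /cvgrPdist_lt/(_ 1 ltr01) := cv.
rewrite /within/= => /nbhs_ballP[e /= e0 He]; exists e => // s s0 st.
apply: charge_eq; [apply: bch; lra|apply: bch; lra|].
by rewrite distrC; apply: He; rewrite /ball/= ?in_itv/= ?ltr_norml; lra.
Qed.

(** Distinct charges differ by at least 1, so right continuity freezes a charge to the right of any
    time, and the absence of jumps off [S0] freezes it to the left. *)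
Lemma sol_const s s' u : 0 <= s -> s' <= T -> (forall u, s < u < s' -> ~ S0 u) -> s <= u < s' -> b u = b s.
Proof.
move=> h1 h2 h3 us.
apply: (@real_induction R s u (fun u => b u = b s)) => //; last lra.
- move=> t ts Pt.
  have K i : exists d, t < d /\ forall v, t < v < d -> v <= T -> b v 0 i = b t 0 i.
    have tT : 0 <= t < T by lra.
    have /cvgrPdist_lt/(_ 1 ltr01)/near_rightP[d td Hd] := @sol_right_cont _ _ _ _ _ _ _ _ _ _ H t i tT.
    exists d; split=> // v tv vT; apply: charge_eq; [apply: bch; lra|apply: bch; lra|].
    by rewrite distrC; apply: Hd.
  have [d Hd] := choice K.
  pose m := \big[Num.min/(T - t)]_i (d i - t).
  have m0 : 0 < m.
    rewrite /m; elim/big_ind: _ => // [|y z y0 z0|i _]; [lra|by rewrite lt_min y0|have [] := Hd i; lra].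
  exists m => // v tv; rewrite -(Pt t); last lra.
  have mT : m <= T - t by exact: bigmin_le_id.
  apply/rowP => i; have [_] := Hd i; apply; last lra.
  have : m <= d i - t by exact: bigmin_le_cond.
  lra.
- move=> t ts Pt.
  apply/rowP => i.
  have [|nj|e e0 He] := @left_const t i; first lra.
    by have [St _ _] := sol_jump H nj; apply: (h3 t) => //; lra.
  pose v := Num.max s (t - e / 2).
  have vE : s <= v /\ t - e / 2 <= v by rewrite /v !le_max !lexx orbT.
  have vt : v < t by rewrite /v gt_max; lra.
  rewrite -(Pt v); last lra.
  by apply/esym; apply: He; lra.
Qed.

Lemma sol_left_lim s tau i : 0 <= s -> s < tau -> tau <= T -> (forall u, s < u < tau -> ~ S0 u) ->
  left_lim (fun u => b u 0 i) tau = b s 0 i.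
Proof.
move=> h1 h2 h3 h4; apply: lim_near_cst; first exact: norm_hausdorff.
by apply/near_leftP; exists s => // u us; rewrite (sol_const h1 h3 h4)//; lra.
Qed.

Lemma sol_gsol : gsol f g 0 T S0 x b.
Proof.
split.
- exact: sol_finite H.
- by move=> t /(sol_times H); rewrite /= in_itv.
- exact: sol_Zn H.
- by move=> i; have := (cts_mxP 0 T x).1 (sol_cont H).
- move=> s s' h1 h2 h3 h4; have [->//|ne] := eqVneq s s'.
  have ss : s < s' by rewrite lt_neqAle ne.
  have h4' u : s < u < s' -> ~ S0 u by move=> us; apply: h4; lra.
  apply/rowP => i.
  have [|nj|e e0 He] := @left_const s' i; first lra.
    by have [St _ _] := sol_jump H nj; apply: (h4 s') => //; lra.
  pose v := Num.max s (s' - e / 2).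
  have vE : s <= v /\ s' - e / 2 <= v by rewrite /v !le_max !lexx orbT.
  have vt : v < s' by rewrite /v gt_max; lra.
  rewrite -(He v); [|lra|lra].
  by rewrite (sol_const h1 h3 h4')//; lra.
- move=> s tau h1 h2 St h4.
  have tT : 0 < tau <= T by have := sol_times H St; rewrite /= in_itv.
  have tT2 : tau <= T by lra.
  have LL i := @sol_left_lim s tau i h1 h2 tT2 h4.
  split.
    move=> i; have [jp|nj] := pselect (jumps_at T (fun s => b s 0 i) tau).
      by right; have [] := sol_jump H jp.
    left; have [e e0 He] := left_const tT nj.
    pose v := Num.max s (tau - e / 2).
    have vE : s <= v /\ tau - e / 2 <= v by rewrite /v !le_max !lexx orbT.
    have vt : v < tau by rewrite /v gt_max; lra.
    rewrite -(He v); [|lra|lra].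
    by rewrite (sol_const h1 tT2 h4)//; lra.
  move=> y; rewrite (sol_charge H _ tT); apply: eq_bigr => i _; exact: LL.
- move=> t i tT nS; have [D _] := sol_C1 H i tT nS.
  have := derivableP D; rewrite -derive1E (sol_ode H _ tT nS); exact.
Qed.

End Sol.

Lemma continuous_sum (r : seq 'I_n) (P : pred 'I_n) (F : 'I_n -> R -> R) t :
  (forall k, {for t, continuous (F k)}) ->
  {for t, continuous (fun s => \sum_(k <- r | P k) F k s)}.
Proof.
move=> H; elim: r => [|k r IH].
  rewrite (_ : (fun s => _) = fun=> 0); first exact: cst_continuous.
  by apply/funext => s; rewrite big_nil.
case Pk: (P k).
  rewrite (_ : (fun s => _) = fun s => F k s + \sum_(k <- r | P k) F k s); first exact: continuousD.
  by apply/funext => s; rewrite big_cons Pk.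
rewrite (_ : (fun s => _) = fun s => \sum_(k <- r | P k) F k s)//.
by apply/funext => s; rewrite big_cons Pk.
Qed.

Lemma force_continuous f u : force f -> u != 0 -> {for u, continuous f}.
Proof.
move=> F; have P v : 0 < v -> {for v, continuous f}.
  move=> v0; apply: differentiable_continuous; apply/derivable1_diffP.
  by have [] := force_drv F v0.
rewrite neq_lt => /orP[u0|/P//].
have -> : f = (fun v => - f (- v)) by apply/funext => v; rewrite force_N// opprK.
apply: continuousN; apply: (@continuous_comp _ _ _ (fun v : R => - v) f).
  exact: continuousN.
by apply: P; lra.
Qed.

Lemma velocity_continuous f g x (b : 'rV[R]_n) t i L : force f -> 0 <= L ->
  (forall u v, `|g u - g v| <= L * `|u - v|) ->
  Zn (x t, b) -> (forall j, {for t, continuous (fun s => x s 0 j)}) ->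
  {for t, continuous (fun s => velocity f g (x s) b i)}.
Proof.
move=> F L0 gL [/= bc xb] xc.
have gc : continuous g := lipschitz_continuous L0 gL.
apply: continuousD; last first.
  apply: continuousM; first exact: cst_continuous.
  by apply: (@continuous_comp _ _ _ (fun s => x s 0 i) g); [exact: xc|exact: gc].
apply: continuousM; first exact: cst_continuous.
have -> : (fun s => \sum_(k < n | k != i) b 0 i * b 0 k * f (x s 0 i - x s 0 k)) =
  (fun s => \sum_(k < n | (k != i) && (b 0 i * b 0 k != 0)) b 0 i * b 0 k * f (x s 0 i - x s 0 k)).
  apply/funext => s; rewrite big_mkcond [RHS]big_mkcond /=; apply: eq_bigr => k _.
  by case: ifP => //= _; case: eqVneq => // ->; rewrite mul0r.
have -> : (fun s => \sum_(k < n | (k != i) && (b 0 i * b 0 k != 0)) b 0 i * b 0 k * f (x s 0 i - x s 0 k)) =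
  (fun s => \sum_(k < n) (if (k != i) && (b 0 i * b 0 k != 0) then b 0 i * b 0 k * f (x s 0 i - x s 0 k) else 0)).
  by apply/funext => s; rewrite big_mkcond.
apply: continuous_sum => k.
have [/andP[ki bik]|_] := boolP ((k != i) && (b 0 i * b 0 k != 0)); last exact: cst_continuous.
apply: continuousM; first exact: cst_continuous.
apply: (@continuous_comp _ _ _ (fun s => x s 0 i - x s 0 k) f).
  by apply: continuousB; exact: xc.
apply: force_continuous => //; rewrite subr_eq0.
have [ik|ki'|/val_inj e] := ltngtP i k; last by rewrite e eqxx in ki.
  by have := xb i k ik bik; apply: contraTneq => ->; rewrite ltxx.
by have := xb k i ki'; rewrite mulrC => /(_ bik); apply: contraTneq => ->; rewrite ltxx.
Qed.

Lemma gs_jumps f g T S0 x b i t : gsol f g 0 T S0 x b -> jumps_at T (fun s => b s 0 i) t ->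
  [/\ 0 < t <= T, S0 t & exists p, [/\ 0 <= p < t, forall u, p < u < t -> ~ S0 u & b p 0 i <> b t 0 i]].
Proof.
move=> G [tT nc]; have {}tT : 0 <= t <= T by move: tT; rewrite /= in_itv.
have right : exists e, 0 < e /\ forall u, t <= u < t + e -> u <= T -> b u 0 i = b t 0 i.
  have [tlt|tge] := ltP t T; last first.
    exists 1; split=> // u ut uT; congr (b _ 0 i); lra.
  have [||s' [h1 h2 h3]] := gs_succ G (tau := t); [lra|lra|].
  exists (s' - t); split; first lra.
  by move=> u ut uT; rewrite (gs_constE G _ h2 h3)//; lra.
have [e [e0 He]] := right.
have cont q : q < t -> (forall u, 0 <= u -> q < u < t -> b u 0 i = b t 0 i) -> False.
  move=> qt Hq; apply: nc; apply: cvg_near_cst; rewrite /within/=.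
  apply/nbhs_ballP; exists (Num.min e (t - q)); first by rewrite /= lt_min e0; lra.
  move=> u; rewrite /ball/= lt_min ltr_norml ltr_norml in_itv/= => ut uT.
  by have [ult|uge] := ltP u t; [apply: Hq; lra|apply: He; lra].
have t0 : 0 < t.
  rewrite lt_neqAle; apply/andP; split; last lra.
  by apply/eqP => t0; apply: (cont (t - 1)); [lra|move=> u u0 ut; exfalso; lra].
have tT2 : t <= T by lra.
have [p [p0 pt ps]] := gs_pred G t0 tT2.
have ne : b p 0 i <> b t 0 i.
  move=> E; apply: (cont p pt) => u u0 ut.
  by rewrite (gs_constE G p0 tT2 ps) ?E//; lra.
split; first lra; last by exists p; split=> //; lra.
have [//|nS] := pselect (S0 t); exfalso; apply: ne.
suff -> : b p = b t by [].
apply: (gs_const G); [lra|lra|lra|].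
by move=> u ut; have [->//|ne] := eqVneq u t; apply: ps; lra.
Qed.

Lemma gs_left_lim f g T S0 x b s tau i : gsol f g 0 T S0 x b -> 0 <= s -> s < tau -> tau <= T ->
  (forall u, s < u < tau -> ~ S0 u) -> left_lim (fun u => b u 0 i) tau = b s 0 i.
Proof.
move=> G h1 h2 h3 h4; apply: lim_near_cst; first exact: norm_hausdorff.
by apply/near_leftP; exists s => // u us; rewrite (gs_constE G h1 h3 h4)//; lra.
Qed.

(** Continuous differentiability is regained from the equation: near a time outside [S0] the charges
    are frozen and the velocity is a continuous function of time. A charge that has jumped is zero
    from then on, hence cannot jump again. *)
Lemma gsol_sol f g T S0 x b L : force f -> 0 <= L -> (forall u v, `|g u - g v| <= L * `|u - v|) ->
  gsol f g 0 T S0 x b -> solution_with f g T (x 0) (b 0) S0 x b.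
Proof.
move=> F L0 gL G.
split=> //.
- exact: gs_fin G.
- by move=> t /(gs_times G); rewrite /= in_itv.
- exact: gs_Zn G.
- by apply/cts_mxP => i; exact: gs_cts G i.
- move=> t i tT nS; have D := gs_ode G i tT nS; split; first by have [] := D.
  have t0 : 0 < t by lra. have tT1 : t <= T by lra. have tT2 : t < T by lra. have t00 : 0 <= t by lra.
  have [p [p0 pt ps]] := gs_pred G t0 tT1.
  have [q [tq qT qs]] := gs_succ G t00 tT2.
  have pq u : p < u < q -> ~ S0 u.
    move=> upq; have [ut|ut|->//] := ltgtP u t; [apply: ps; lra|apply: qs; lra].
  have bE u : p <= u < q -> b u = b t.
    by move=> upq; rewrite !(gs_constE G p0 qT pq)//; lra.
  have Zt : Zn (x t, b t) by apply: (gs_Zn G); lra.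
  have cx j : {for t, continuous (fun s => x s 0 j)}.
    apply: differentiable_continuous; apply/derivable1_diffP.
    by have [] := gs_ode G j tT nS.
  have C := velocity_continuous (i := i) F L0 gL Zt cx.
  have E : {near t, (fun s => velocity f g (x s) (b t) i) =1 derive1 (fun s => x s 0 i)}.
    apply/nbhs_ballP; exists (Num.min (t - p) (q - t)); first by rewrite /= lt_min; lra.
    move=> u; rewrite /ball/= lt_min !ltr_norml => ut.
    rewrite derive1E; have uT : 0 < u < T by lra.
    have nSu : ~ S0 u by apply: pq; lra.
    by have [_ ->] := gs_ode G i uT nSu; rewrite bE//; lra.
  have Et : velocity f g (x t) (b t) i = derive1 (fun s => x s 0 i) t by exact: nbhs_singleton E.
  by rewrite /continuous_at /prop_for -Et; apply: cvg_trans C; exact: near_eq_cvg.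
- move=> t i tT; have t00 : 0 <= t by lra. have tT2 : t < T by lra.
  have [q [tq qT qs]] := gs_succ G t00 tT2.
  apply: cvg_near_cst; apply/near_rightP; exists q => // u uq.
  by rewrite (gs_constE G t00 qT qs)//; lra.
- have K i s t : jumps_at T (fun s => b s 0 i) s -> jumps_at T (fun s => b s 0 i) t -> s < t -> False.
    move=> /(gs_jumps G)[sT Ss [p [p0 ps pne]]] /(gs_jumps G)[tT St [q [q0 qs qne]]] st.
    have bs : b s 0 i = 0.
      have [||||J _] := gs_jumpE G (s := p) (tau := s); [lra|lra|lra|exact: ps|].
      by have [E|//] := J i; rewrite E in pne.
    pose u := Num.max q s.
    have uE : q <= u /\ s <= u by rewrite /u !le_max !lexx orbT.
    have ut : u < t by rewrite /u gt_max st; lra.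
    have bu : b u 0 i = 0.
      have [|||->|->//] := gs_nonzero_mono G (s := s) (t := u) i; [lra|lra|lra|exact: bs].
    have bq : b u = b q.
      apply: (gs_constE G (s' := t)); [lra|lra|exact: qs|lra].
    have bq0 : b q 0 i = 0 by rewrite -bq.
    have [||||J _] := gs_jumpE G (s := q) (tau := t); [lra|lra|lra|exact: qs|].
    by apply: qne; rewrite bq0; have [->|->] := J i; rewrite ?bq0.
  by move=> i s t js jt; have [st|st|//] := ltgtP s t; exfalso; [exact: K js jt st|exact: K jt js st].
- move=> i t jt; have [tT St [p [p0 ps pne]]] := gs_jumps G jt.
  have [||||J _] := gs_jumpE G (s := p) (tau := t); [lra|lra|lra|exact: ps|].
  have bt : b t 0 i = 0 by have [E|//] := J i; rewrite E in pne.
  split=> //; rewrite (gs_left_lim i G (s := p)); [|lra|lra|lra|exact: ps].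
  have pT : 0 <= p <= T by lra.
  have bp : b p 0 i != 0 by apply/eqP => bp; apply: pne; rewrite bp bt.
  by have [->|->] := charge_pm (gs_charges G pT) bp; rewrite ?normrN normr1.
- move=> t y tT; have t0 : 0 < t by lra. have tT1 : t <= T by lra.
  have [p [p0 pt ps]] := gs_pred G t0 tT1.
  have [J1 ->] := gs_jumpE G p0 pt tT1 ps.
  by apply: eq_bigr => i _; rewrite (gs_left_lim i G p0 pt tT1 ps).
- by move=> t i tT nS; rewrite derive1E; have [_ ->] := gs_ode G i tT nS.
Qed.

End Conversion.

(** * Distances before and after a collision *)

Section Powers.
Context {R : realType}.
Implicit Types (a c d e q r s t u v K tau : R) (D dD : R -> R).

Lemma powR_small q e : 0 < q -> 0 < e -> exists2 r, 0 < r & forall u, 0 <= u <= r -> u `^ q <= e.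
Proof.
move=> q0 e0; exists (e `^ q^-1); first by rewrite powR_gt0.
move=> u /andP[u0 ur]; apply: (@le_trans _ _ ((e `^ q^-1) `^ q)).
  by apply: ge0_ler_powR; rewrite ?nnegrE ?powR_ge0// ltW.
by rewrite -powRrM mulVf ?gt_eqF// powRr1// ltW.
Qed.

Lemma powR_root a v : -1 < a -> 0 <= v -> (v `^ (2 + a)) `^ (1 / (2 + a)) = v.
Proof. by move=> a1 v0; rewrite -powRrM mul1r divff ?powRr1//; lra. Qed.

Lemma is_derive_pow D dD a t : 0 < D t -> is_derive t 1 D (dD t) ->
  is_derive t 1 (fun t => D t `^ (2 + a)) ((2 + a) * D t `^ (1 + a) * dD t).
Proof.
move=> D0 HD.
have := @is_derive1_comp R (fun u => u `^ (2 + a)) D t _ _ (is_derive1_powR (2 + a) D0) HD.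
by have -> : 2 + a - 1 = 1 + a by ring.
Qed.

Lemma powR_le_one u q : 0 <= u <= 1 -> 0 <= q -> u `^ q <= 1.
Proof.
move=> /andP[u0 u1] q0; have <- : (1 : R) `^ q = 1 by rewrite powR1.
by apply: ge0_ler_powR; rewrite ?nnegrE.
Qed.

(** The power [2 + a] of [D] has derivative at least [- (2 + a) * K]; integration up to times [u]
    close to [tau], where [D u] is small, gives the bound. *)
Lemma decay_upper D dD a K s tau : -1 < a -> 0 <= K -> s < tau -> cts s tau D -> D tau = 0 ->
  (forall t, s < t < tau -> [/\ 0 < D t, D t < 1, is_derive t 1 D (dD t) & - K / D t `^ (1 + a) <= dD t]) ->
  forall t, s < t < tau -> D t <= ((2 + a) * K * (tau - t)) `^ (1 / (2 + a)).
Proof.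
move=> a1 K0 st cD D0 H t ts.
have [Dt0 Dt1 _ _] := H t ts.
rewrite -[leLHS](powR_root a1 (ltW Dt0)).
have aK : 0 <= (2 + a) * K by apply: mulr_ge0 => //; lra.
apply: ge0_ler_powR; rewrite ?nnegrE ?powR_ge0//.
- by apply: divr_ge0; lra.
- by apply: mulr_ge0 => //; lra.
apply/ler_addgt0Pr => e e0.
have e1 : 0 < Num.min e 1 by rewrite lt_min e0 ltr01.
have [|d d0 Hd] := cD tau _ (Num.min e 1) e1; first lra.
pose u := Num.max ((t + tau) / 2) (tau - d / 2).
have uE : (t + tau) / 2 <= u /\ tau - d / 2 <= u by rewrite /u !le_max !lexx orbT.
have ut : u < tau by rewrite /u gt_max; lra.
have su : s < u < tau by lra.
have [Du0 Du1 _ _] := H u su.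
have Due : D u < e.
  have : `|D u - D tau| < Num.min e 1 by apply: Hd; rewrite ?ltr_norml; lra.
  by rewrite D0 subr0 lt_min ger0_norm ?(ltW Du0)// => /andP[].
(* Since [D u < 1] and [2 + a > 1], the power is below [D u]. *)
have Hu : D u `^ (2 + a) <= e.
  apply: (@le_trans _ _ (D u)); last lra.
  rewrite -[leRHS](powRr1 (ltW Du0)).
  have -> : 2 + a = 1 + (1 + a) by ring.
  rewrite powRD; last by apply/implyP => _; rewrite gt_eqF.
  rewrite powRr1 ?(ltW Du0)// -[leRHS]mulr1; apply: ler_wpM2l; first exact: ltW.
  by apply: powR_le_one; move: a1 Du0 Du1; clear; lra.
have DD v : t <= v <= u -> is_derive v 1 (fun v => - D v `^ (2 + a)) (- ((2 + a) * D v `^ (1 + a) * dD v)).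
  move=> vt; have [] := H v _; [lra|move=> h1 h2 h3 h4].
  by apply: is_deriveN; exact: is_derive_pow.
have tu : t <= u by lra.
have := @MVT_le R t u (fun v => - D v `^ (2 + a)) (fun v => - ((2 + a) * D v `^ (1 + a) * dD v)) ((2 + a) * K) set0
  (finite_set0 _) tu (derive_cts DD).
move=> M; have {M} : - D u `^ (2 + a) - - D t `^ (2 + a) <= (2 + a) * K * (u - t).
  apply: M => v vt _; split; first by apply: DD; lra.
  have [] := H v _; [lra|move=> h1 h2 h3 h4].
  have P0 : 0 < D v `^ (1 + a) by exact: powR_gt0.
  rewrite ler_pdivrMr// in h4.
  have : (2 + a) * - K <= (2 + a) * (dD v * D v `^ (1 + a)) by apply: ler_wpM2l => //; lra.
  lra.
have : (2 + a) * K * (u - t) <= (2 + a) * K * (tau - t) by apply: ler_wpM2l => //; lra.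
lra.
Qed.

(** The power [2 + a] of [D] falls at least at speed [(2 + a) * K] and is still nonnegative at times
    [u] close to [tau], so it must be that large at [t]. *)
Lemma decay_lower D dD a K s tau : -1 < a -> 0 <= K -> s < tau ->
  (forall t, s < t < tau -> [/\ 0 < D t, is_derive t 1 D (dD t) & dD t <= - K / D t `^ (1 + a)]) ->
  forall t, s < t < tau -> ((2 + a) * K * (tau - t)) `^ (1 / (2 + a)) <= D t.
Proof.
move=> a1 K0 st H t ts.
have [Dt0 _ _] := H t ts.
rewrite -[leRHS](powR_root a1 (ltW Dt0)).
have aK : 0 <= (2 + a) * K by apply: mulr_ge0 => //; lra.
apply: ge0_ler_powR; rewrite ?nnegrE ?powR_ge0//.
- by apply: divr_ge0; lra.
- by apply: mulr_ge0 => //; lra.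
apply/ler_addgt0Pr => e e0.
(* Stopping this early costs at most [e]; the added 1 keeps the divisor positive when [K = 0]. *)
pose u := Num.max ((t + tau) / 2) (tau - e / ((2 + a) * K + 1)).
have aK1 : 0 < (2 + a) * K + 1 by lra.
have eK : 0 < e / ((2 + a) * K + 1) by rewrite divr_gt0.
have uE : (t + tau) / 2 <= u /\ tau - e / ((2 + a) * K + 1) <= u by rewrite /u !le_max !lexx orbT.
have ut : u < tau by rewrite /u gt_max; lra.
have DD v : t <= v <= u -> is_derive v 1 (fun v => D v `^ (2 + a)) ((2 + a) * D v `^ (1 + a) * dD v).
  by move=> vt; have [] := H v _; [lra|move=> h1 h3 h4]; exact: is_derive_pow.
have tu : t <= u by lra.
have := @MVT_le R t u (fun v => D v `^ (2 + a)) (fun v => (2 + a) * D v `^ (1 + a) * dD v) (- ((2 + a) * K)) set0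
  (finite_set0 _) tu (derive_cts DD).
move=> M; have {M} : D u `^ (2 + a) - D t `^ (2 + a) <= - ((2 + a) * K) * (u - t).
  apply: M => v vt _; split; first by apply: DD; lra.
  have [] := H v _; [lra|move=> h1 h3 h4].
  have P0 : 0 < D v `^ (1 + a) by exact: powR_gt0.
  rewrite ler_pdivlMr// in h4.
  have : (2 + a) * (dD v * D v `^ (1 + a)) <= (2 + a) * - K by apply: ler_wpM2l => //; lra.
  lra.
have := powR_ge0 (D u) (2 + a).
have : (2 + a) * K * (tau - u) <= (2 + a) * K * (e / ((2 + a) * K + 1)) by apply: ler_wpM2l => //; lra.
have : (2 + a) * K * (e / ((2 + a) * K + 1)) <= e.
  rewrite mulrA ler_pdivrMr//; lra.
lra.
Qed.

End Powers.

Lemma ord_ge1 {R : realType} {n : nat} (i : 'I_n) : 1 <= n%:R :> R.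
Proof. by rewrite ler1n; case: n i => [[]|]. Qed.

Record sys {R : realType} {n : nat} (f g : R -> R) (L T : R) (S0 : set R) (x b : R -> 'rV[R]_n) : Prop := Sys {
  sys_force : force f ;
  sys_ge0 : 0 <= L ;
  sys_lip : forall u v, `|g u - g v| <= L * `|u - v| ;
  sys_gt0 : 0 < T ;
  sys_sol : gsol f g 0 T S0 x b }.

Lemma sol_sgap {R : realType} {n : nat} {f g : R -> R} {L T : R} {S0 : set R}
  {x b : R -> 'rV[R]_n} (Sy : sys f g L T S0 x b)
    : exists2 c, 0 < c & forall t, 0 <= t <= T -> sgap c (x t) (b t).
Proof.
have [F L0 gL T0 G] := Sy.
have Z0 : Zn (x 0, b 0) by apply: (gs_Zn G); rewrite lexx ltW.
have [c c0 sg] := sgap_exists Z0.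
exists (gap_rate L c 0 T); first exact: gap_rate_gt0.
move=> t tT; apply: (gs_sgap (e := 0) F G L0 c0 _ _ sg tT).
  by move=> u v; rewrite addr0.
exact: gap_rate_gt0.
Qed.

Lemma sol_min_dist {R : realType} {n : nat} {f g : R -> R} {L T : R} {S0 : set R}
  {x b : R -> 'rV[R]_n} (Sy : sys f g L T S0 x b) : exists c, 0 < c /\ forall t, 0 <= t <= T ->
  (c%:E <= min_dist 1 x b t)%E /\ (c%:E <= min_dist (-1) x b t)%E.
Proof.
have [F L0 gL T0 G] := Sy.
have [c c0 sg] := sol_sgap Sy; exists c; split=> // t tT.
have K s : (c%:E <= min_dist s x b t)%E.
  apply/ereal_infP => _ [i [j [ij bi bj ->]]]; rewrite lee_fin.
  by apply: (sg t tT); [exact/nbrP|rewrite bi bj].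
by split.
Qed.

(** The constants may depend on [t0] and on the pair, so continuity settles it: half of the initial
    distance, [m], survives for a time [d]. With [c] the power [2 + a] of [m], the right side never
    exceeds [m], and [C] is chosen so that the claim ends after the time [d / 2]. *)
Lemma sol_neighbors_lower {R : realType} {n : nat} {f g : R -> R} {L T : R} {S0 : set R}
  {x b : R -> 'rV[R]_n} (Sy : sys f g L T S0 x b)
    (a t0 : R) (i j : 'I_n) : -1 < a -> 0 <= t0 <= T -> neighbors (b t0) i j ->
  exists C c, [/\ 0 < C, 0 < c &
    forall t, t0 <= t -> t <= t0 + c / C -> t <= T ->
      (c - C * (t - t0)) `^ (1 / (2 + a)) <= x t 0 j - x t 0 i].
Proof.
have [F L0 gL T0 G] := Sy.
move=> a1 tT [ij bij _].
have [/= _ xb] := gs_Zn G tT.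
have d0 := xb i j ij bij.
pose m := (x t0 0 j - x t0 0 i) / 2.
have m0 : 0 < m by rewrite /m; lra.
have cD : cts 0 T (fun t => x t 0 j - x t 0 i) by apply: cts_sub2; exact: gs_cts G _.
have [d dd Hd] := cD t0 tT m m0.
pose c := m `^ (2 + a); have c0 : 0 < c by exact: powR_gt0.
have C0 : 0 < 2 * c / d by rewrite divr_gt0//; lra.
exists (2 * c / d), c; split=> // t t0t tc tT'.
have cE : c / (2 * c / d) = d / 2 by field; rewrite !gt_eqF.
rewrite cE in tc.
have : m <= x t 0 j - x t 0 i.
  have : `|x t 0 j - x t 0 i - (x t0 0 j - x t0 0 i)| < m by apply: Hd; rewrite ?ltr_norml; lra.
  by rewrite ltr_norml /m; lra.
apply: le_trans; rewrite -[leRHS](powR_root a1 (ltW m0)) -/c.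
have h : 0 <= 2 * c / d * (t - t0) by apply: mulr_ge0; [exact: ltW|rewrite subr_ge0].
have h' : 2 * c / d * (t - t0) <= c.
  rewrite -[leRHS](_ : 2 * c / d * (d / 2) = c); last by field; rewrite gt_eqF.
  by apply: ler_wpM2l; [exact: ltW|move: tc; clear; lra].
have h3 : 0 <= 1 / (2 + a) by rewrite divr_ge0//; move: a1; clear; lra.
by apply: ge0_ler_powR; rewrite ?nnegrE //; move: h h' c0; clear; lra.
Qed.

Lemma sol_g_bound {R : realType} {n : nat} {f g : R -> R} {L T : R} {S0 : set R}
  {x b : R -> 'rV[R]_n} (Sy : sys f g L T S0 x b)
    : exists2 M, 0 < M & forall t i, 0 <= t <= T -> `|x t 0 i| <= M /\ `|g (x t 0 i)| <= M.
Proof.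
have [F L0 gL T0 G] := Sy.
have K i : exists M, 0 < M /\ forall t, 0 <= t <= T -> `|x t 0 i| <= M.
  by have [M M0 HM] := cts_bounded (ltW T0) (gs_cts G i); exists M.
have [M HM] := choice K.
pose B := \big[Num.max/1]_i M i.
have B1 : 1 <= B by exact: bigmax_ge_id.
exists (B + L * B + `|g 0|).
  have := normr_ge0 (g 0); have : 0 <= L * B by apply: mulr_ge0 => //; lra.
  lra.
move=> t i tT; have [_ Hi] := HM i.
have xB : `|x t 0 i| <= B by apply: (le_trans (Hi t tT)); exact: le_bigmax.
have LB : L * `|x t 0 i| <= L * B by exact: ler_wpM2l.
have := gL (x t 0 i) 0; rewrite subr0 => gx.
have := lerB_normD (g (x t 0 i)) (- g 0); rewrite normrN => h.
have LB0 : 0 <= L * B by apply: mulr_ge0 => //; lra.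
have := normr_ge0 (g 0); split; lra.
Qed.

Lemma left_window {R : realType} {n : nat} {f g : R -> R} {L T : R} {S0 : set R}
  {x b : R -> 'rV[R]_n} (Sy : sys f g L T S0 x b) (tau : R) : 0 < tau <= T -> exists p, [/\ 0 <= p < tau,
  forall u, p < u < tau -> ~ S0 u & forall u, p <= u < tau -> b u = b p].
Proof.
have [F L0 gL T0 G] := Sy.
move=> /andP[t0 tT]; have [p [p0 pt ps]] := gs_pred G t0 tT.
by exists p; split=> // [|u]; [rewrite p0|exact: (gs_constE G p0 tT ps)].
Qed.

Lemma left_close {R : realType} {n : nat} {f g : R -> R} {L T : R} {S0 : set R}
  {x b : R -> 'rV[R]_n} (Sy : sys f g L T S0 x b) (p tau rho : R) : 0 <= p < tau -> tau <= T -> 0 < rho ->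
  exists2 s, p <= s < tau & forall t k, s < t <= tau -> `|x t 0 k - x tau 0 k| < rho.
Proof.
have [F L0 gL T0 G] := Sy.
move=> /andP[p0 pt] tT rho0.
have near k : exists d, 0 < d /\ forall s, 0 <= s <= T -> `|s - tau| < d -> `|x s 0 k - x tau 0 k| < rho.
  by have [|d d0 Hd] := gs_cts G k (t := tau) _ rho0; [lra|exists d].
have [d Hd] := choice near.
pose d0 := \big[Num.min/(tau - p)]_k d k.
have d00 : 0 < d0.
  by rewrite /d0; elim/big_ind: _ => // [|u v u0 v0|k _]; [lra|rewrite lt_min u0|have [] := Hd k].
have d0p : d0 <= tau - p by exact: bigmin_le_id.
exists (tau - d0); first lra.
move=> t k tt; have [_] := Hd k; apply; first by move: tt p0 tT d0p; clear; lra.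
apply: (@lt_le_trans _ _ d0); last exact: bigmin_le_cond.
by rewrite ltr_norml; move: tt d00; clear; lra.
Qed.

(** For a distance below 1 the power [- (1 + a)] is at least 1 and absorbs the bounded terms into
    the constant. *)
Lemma opp_speed_pow {R : realType} {n : nat} {f g : R -> R} {L T : R} {S0 : set R}
  {x b : R -> 'rV[R]_n} (Sy : sys f g L T S0 x b) (a Cf M c t : R) (i j : 'I_n) : -1 < a ->
  (forall u : R, 0 < u < 1 -> f u <= Cf / u `^ (1 + a)) -> 0 <= t <= T ->
  nbr (b t) i j -> b t 0 i = - b t 0 j -> x t 0 j - x t 0 i < 1 -> 0 < c -> sgap c (x t) (b t) ->
  (forall k, `|g (x t 0 k)| <= M) ->
  - (2 * Cf + (4 * f c + 2 * M)) / (x t 0 j - x t 0 i) `^ (1 + a) <=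
  velocity f g (x t) (b t) j - velocity f g (x t) (b t) i.
Proof.
have [F L0 gL T0 G] := Sy.
move=> a1 fC tT nb bo D1 c0 sg gM; have Zt := gs_Zn G tT; have [/= _ xb] := Zt.
have [ij bij _] := nbrP _ _ _ nb.
have D0 : 0 < x t 0 j - x t 0 i by rewrite subr_gt0; exact: xb.
have := opp_sign_speed g F Zt nb bo c0 sg; apply: le_trans.
set D := x t 0 j - x t 0 i in D0 D1 *.
have gi := gM i; have gj := gM j.
rewrite mulNr lerN2.
have P0 : 0 < D `^ (1 + a) by exact: powR_gt0.
have P1 : D `^ (1 + a) <= 1 by apply: powR_le_one; move: D0 D1 a1; clear; lra.
have fD : f D <= Cf / D `^ (1 + a) by apply: fC; rewrite D0.
have n1 : n%:R^-1 * f D <= f D.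
  by apply: (inv_n_le i); rewrite ler_peMl ?force_ge0// ord_ge1.
have fc : 0 <= f c by exact: force_ge0.
have M0 : 0 <= M by exact: le_trans gi.
have : 4 * f c + 2 * M <= (4 * f c + 2 * M) / D `^ (1 + a).
  by rewrite ler_pdivlMr// ler_piMr//; move: fc M0; clear; lra.
rewrite mulrDl; move: gi gj n1 fD; clear; lra.
Qed.

(** Away from [tau] the power of [tau - t] is bounded below, so the crude bound [B] is enough up to
    the midpoint [s2]. *)
Lemma power_extend {R : realType} (D : R -> R) (C1 B q s tau : R) : 0 < q -> s < tau -> 0 <= C1 -> 0 <= B ->
  (forall t, s < t < tau -> D t <= C1 * (tau - t) `^ q) -> (forall t, 0 <= t <= tau -> D t <= B) ->
  D tau <= 0 -> exists C, 0 < C /\ forall t, 0 <= t <= tau -> D t <= C * (tau - t) `^ q.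
Proof.
move=> q0 st C10 B0 H1 H2 Dtau.
pose s2 := (s + tau) / 2.
have s2E : s < s2 < tau by rewrite /s2; lra.
have Q0 : 0 < (tau - s2) `^ q by apply: powR_gt0; lra.
exists (C1 + B / (tau - s2) `^ q + 1).
have C20 : 0 <= B / (tau - s2) `^ q by apply: divr_ge0 => //; exact: ltW.
split; first by move: C10 C20; clear; lra.
move=> t /andP[t0 tt].
have Pt0 : 0 <= (tau - t) `^ q by exact: powR_ge0.
have C1P : 0 <= C1 * (tau - t) `^ q by exact: mulr_ge0.
have C2P : 0 <= B / (tau - s2) `^ q * (tau - t) `^ q by exact: mulr_ge0.
rewrite !mulrDl mul1r.
have [ts|ts] := leP t s2.
  have h : B <= B / (tau - s2) `^ q * (tau - t) `^ q.
    rewrite mulrAC ler_pdivlMr//; apply: ler_wpM2l => //.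
    by apply: (ge0_ler_powR (ltW q0)); rewrite ?nnegrE; move: ts s2E; clear; lra.
  have := H2 t; rewrite t0 tt => /(_ isT); move: C1P Pt0 h; clear; lra.
have [ttau|ttau] := ltP t tau; last first.
  have -> : t = tau by move: tt ttau; clear; lra.
  by rewrite subrr !powR0 ?gt_eqF// !mulr0 !addr0.
have := H1 t; rewrite ttau andbT; have -> : s < t by move: s2E ts; clear; lra.
move=> /(_ isT); move: C2P Pt0; clear; lra.
Qed.

(** The gap of equal neighbours persists in the limit at [tau], so coinciding neighbours have
    opposite charges. *)
Lemma colliding_opposite {R : realType} {n : nat} {f g : R -> R} {L T : R} {S0 : set R}
  {x b : R -> 'rV[R]_n} (Sy : sys f g L T S0 x b) (p tau : R) (i j : 'I_n) : 0 <= p < tau -> tau <= T ->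
  (forall u, p < u < tau -> ~ S0 u) -> (forall u, p <= u < tau -> b u = b p) ->
  nbr (b p) i j -> x tau 0 i = x tau 0 j -> b p 0 i = - b p 0 j.
Proof.
have [F L0 gL T0 G] := Sy.
move=> /andP[p0 pt] tT ps bE nbp xij.
have pT : 0 <= p <= T by rewrite p0 /=; lra.
have bc := gs_charges G pT; have [_ bij _] := nbrP _ _ _ nbp.
have [c c0 sg] := sol_sgap Sy.
have ne : b p 0 i != b p 0 j.
  apply/eqP => e.
  have := @gs_left_sgap R n f g 0 T S0 x b G c p tau p0 pt tT ps.
  move=> /(_ _ i j nbp e); rewrite xij subrr => h.
  suff : c <= 0 by move: c0; clear; lra.
  by apply: h => t tp; rewrite -(bE t tp); apply: sg; move: tp p0 tT; clear; lra.
have bi : b p 0 i != 0 by apply: contraNneq bij => ->; rewrite mul0r.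
have bj : b p 0 j != 0 by apply: contraNneq bij => ->; rewrite mulr0.
by move: ne; have [->|->] := charge_pm bc bi; have [->|->] := charge_pm bc bj; rewrite ?eqxx ?opprK.
Qed.

Lemma sol_upper {R : realType} {n : nat} {f g : R -> R} {L T : R} {S0 : set R}
  {x b : R -> 'rV[R]_n} (Sy : sys f g L T S0 x b)
    (a tau : R) (i j : 'I_n) : -1 < a -> (exists C, 0 < C /\ forall u : R, 0 < u < 1 -> f u <= C / u `^ (1 + a)) ->
  collide_at S0 x b tau i j -> (i < j)%N -> neighbors_prior_to b tau i j ->
  exists C, 0 < C /\ forall t, 0 <= t <= tau ->
    x t 0 j - x t 0 i <= C * (tau - t) `^ (1 / (2 + a)).
Proof.
have [F L0 gL T0 G] := Sy.
move=> a1 [Cf [Cf0 fC]] [y [[Stau _] ic jc]] ij /near_leftP[s1 s1t nb].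
have tT := gs_times G Stau; have /andP[tau0 tauT] := tT.
have [p [p0t ps bE]] := left_window Sy tT; have /andP[p0 pt] := p0t.
move: ic jc; rewrite !finset.inE => /andP[/eqP xi _] /andP[/eqP xj _].
(* Being neighbours just before [tau] can be read off at [p], the charges being frozen from [p] up
   to [tau]. *)
have nbp : nbr (b p) i j.
  pose u := (Num.max p s1 + tau) / 2.
  have uE : p <= Num.max p s1 /\ s1 <= Num.max p s1 by rewrite !le_max !lexx orbT.
  have um : Num.max p s1 < tau by rewrite gt_max pt.
  have u1 : s1 < u < tau by rewrite /u; move: uE um; clear; lra.
  have u2 : p <= u < tau by rewrite /u; move: uE um; clear; lra.
  by apply/nbrP; rewrite -(bE u u2); exact: nb.
have [_ bij _] := nbrP _ _ _ nbp.
have [c c0 sg] := sol_sgap Sy.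
have bopp : b p 0 i = - b p 0 j by apply: (colliding_opposite Sy p0t tauT ps bE nbp); rewrite xi xj.
have [M M0 HM] := sol_g_bound Sy.
pose D t := x t 0 j - x t 0 i.
pose dD t := velocity f g (x t) (b t) j - velocity f g (x t) (b t) i.
have h2 : 0 < 1 / 2 :> R by rewrite divr_gt0.
(* With both particles within [1 / 2] of the collision point, their distance is below 1. *)
have [s /andP[ps' st] Hs] := left_close Sy p0t tauT h2.
have fc0 := force_ge0 F c0.
pose K := 2 * Cf + (4 * f c + 2 * M).
have K0 : 0 <= K by rewrite /K; move: fc0 M0 Cf0; clear; lra.
have tt' t : s < t < tau -> [/\ 0 <= t <= T, 0 < t < T & p < t < tau].
  by move: p0 tauT ps'; clear => *; split; lra.
have H t : s < t < tau -> [/\ 0 < D t, D t < 1, is_derive t 1 D (dD t) & - K / D t `^ (1 + a) <= dD t].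
  move=> ts; have [tT' tT2 tp] := tt' t ts.
  have bt : b t = b p by apply: bE; move: tp; clear; lra.
  have D0 : 0 < D t by rewrite subr_gt0; have [/= _] := gs_Zn G tT'; apply=> //; rewrite bt.
  have D1 : D t < 1.
    have hi := Hs t i; have hj := Hs t j.
    move: hi hj; rewrite !ltr_norml xi xj /D; case/andP: ts => -> /ltW -> /(_ isT) hi /(_ isT) hj.
    by move: hi hj; clear; lra.
  have nS := ps t tp.
  split=> //; first by apply: is_deriveB; exact: (gs_ode G).
  apply: (opp_speed_pow Sy (c := c)) => //; rewrite ?bt//; last by move=> k; have [] := HM t k tT'.
  by rewrite -bt; exact: sg.
have Dtau : D tau = 0 by rewrite /D xi xj subrr.
have cD : cts s tau D.
  have s0 : 0 <= s by exact: le_trans ps'.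
  by apply: cts_sub2; exact: cts_sub (gs_cts G _) s0 tauT.
have up := decay_upper a1 K0 st cD Dtau H.
have q0 : 0 < 1 / (2 + a) by rewrite divr_gt0//; move: a1; clear; lra.
have aK : 0 <= (2 + a) * K by apply: mulr_ge0 => //; move: a1; clear; lra.
apply: (@power_extend R D (((2 + a) * K) `^ (1 / (2 + a))) (2 * M) (1 / (2 + a)) s tau q0 st).
- exact: powR_ge0.
- by move: M0; clear; lra.
- move=> t ts; rewrite -powRM//; first exact: up.
  by move: ts; clear; lra.
- move=> t tt; have tT' : 0 <= t <= T by move: tt tauT; clear; lra.
  have [xi' _] := HM t i tT'; have [xj' _] := HM t j tT'.
  by move: xi' xj'; rewrite !ler_norml /D; clear; lra.
- by rewrite Dtau.
Qed.

(** * Lower bound prior to a collision *)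

Lemma is_derive_bigsum {R : realType} {n : nat} (P : pred 'I_n) (h dh : 'I_n -> R -> R) (t : R) :
  (forall k, is_derive t 1 (h k) (dh k t)) ->
  is_derive t 1 (fun s => \sum_(k < n | P k) h k s) (\sum_(k < n | P k) dh k t).
Proof.
move=> H; elim: (index_enum _) => [|k r IH].
  rewrite big_nil (_ : (fun s => _) = fun=> 0); first exact: is_derive_cst.
  by apply/funext => s; rewrite big_nil.
rewrite big_cons; case Pk: (P k).
  rewrite (_ : (fun s => _) = fun s => h k s + \sum_(k <- r | P k) h k s); first exact: is_deriveD.
  by apply/funext => s; rewrite big_cons Pk.
rewrite (_ : (fun s => _) = fun s => \sum_(k <- r | P k) h k s)//.
by apply/funext => s; rewrite big_cons Pk.
Qed.

Lemma antisym_sum {R : realType} {n : nat} (P : pred 'I_n) (h : 'I_n -> 'I_n -> R) : (forall k l, h l k = - h k l) ->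
  \sum_(k < n | P k) \sum_(l < n | P l) h k l = 0.
Proof.
move=> hN; set A := \sum_(k < n | _) _.
have : A = - A.
  rewrite {1}/A exchange_big /= /A -sumrN; apply: eq_bigr => k _.
  by rewrite -sumrN; apply: eq_bigr => l _; rewrite hN.
lra.
Qed.

(* The forces inside a group of particles cancel in the sum. *)
Lemma group_speed {R : realType} {n : nat} (f g : R -> R) (y c : 'rV[R]_n) (P : pred 'I_n) (gam M : R) : force f -> charges c -> 0 < gam -> 0 <= M ->
  (forall k, P k -> `|g (y 0 k)| <= M) ->
  (forall k l, P k -> ~~ P l -> c 0 l != 0 -> gam <= `|y 0 k - y 0 l|) ->
  `|\sum_(k < n | P k) velocity f g y c k| <= n%:R * (f gam + M).
Proof.
move=> F cc gam0 M0 gM far.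
have f00 : f 0 = 0 by have := force_N F 0; rewrite oppr0; lra.
have fg0 : 0 <= f gam by exact: force_ge0.
have far' k l : P k -> ~~ P l -> `|c 0 k * c 0 l * f (y 0 k - y 0 l)| <= f gam.
  move=> Pk Pl; have [->|cl] := eqVneq (c 0 l) 0; first by rewrite mulr0 mul0r normr0.
  have fE u : `|f u| = `|f `|u| |.
    by have [u0|u0] := leP 0 u; [rewrite (ger0_norm u0)|rewrite (ltr0_norm u0) force_N// normrN].
  have yk := far k l Pk Pl cl.
  rewrite !normrM fE.
  have fy : 0 <= f `|y 0 k - y 0 l| by apply: force_ge0 => //; lra.
  rewrite (ger0_norm fy); apply: (@le_trans _ _ (1 * f `|y 0 k - y 0 l|)).
    apply: ler_wpM2r => //; rewrite -[leRHS]mulr1; apply: ler_pM => //; exact: charge_norm.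
  by rewrite mul1r; apply: (force_nincr F).2.
have -> : \sum_(k < n | P k) velocity f g y c k =
   n%:R^-1 * (\sum_(k < n | P k) \sum_(l < n | P l) c 0 k * c 0 l * f (y 0 k - y 0 l))
 + n%:R^-1 * (\sum_(k < n | P k) \sum_(l < n | ~~ P l) c 0 k * c 0 l * f (y 0 k - y 0 l))
 + \sum_(k < n | P k) c 0 k * g (y 0 k).
  rewrite -mulrDr -big_split /= mulr_sumr -big_split /=; apply: eq_bigr => k Pk.
  rewrite /velocity; congr (_ * _ + _).
  rewrite -(bigID P predT) /=.
  (* The diagonal term completes the inner sum because [f 0 = 0]. *)
  by rewrite [RHS](bigD1 k)//= subrr f00 mulr0 add0r.
rewrite antisym_sum ?mulr0 ?add0r; last first.
  move=> k l; have -> : f (y 0 l - y 0 k) = - f (y 0 k - y 0 l) by rewrite -(force_N F) opprB.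
  ring.
rewrite mulrDr; apply: (le_trans (ler_normD _ _)); apply: lerD; last first.
  apply: sum_norm_le => // k Pk; rewrite normrM -[leRHS]mul1r; apply: ler_pM => //; last exact: gM.
  exact: charge_norm.
have nf : 0 <= n%:R * f gam by exact: mulr_ge0.
have S : `|\sum_(k < n | P k) \sum_(l < n | ~~ P l) c 0 k * c 0 l * f (y 0 k - y 0 l)| <= n%:R * (n%:R * f gam).
  by apply: sum_norm_le => // k Pk; apply: sum_norm_le => // l Pl; exact: far'.
case: (pickP 'I_n) => [i _|no].
  rewrite normrM ger0_norm ?inv_n_ge0//; exact: (inv_n_le i).
by rewrite big1 ?mulr0 ?normr0// => k _; have := no k.
Qed.

(** [force_half] bounds [2 * f D] below by the value of [- u * f' u] at [u = 2 * D]; this is the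
    origin of the power of 2 in the constant and of the condition on [2 * D]. *)
Lemma pow_min_lower {R : realType} (f : R -> R) (a' c' eps0 D : R) : force f -> -1 < a' -> 0 < c' ->
  (forall u : R, 0 < u < eps0 -> c' / u `^ (1 + a') <= `|u * derive1 f u|) ->
  0 < D -> 2 * D < eps0 ->
  (c' / 2 `^ (1 + a')) / D `^ (1 + a') <= Num.min (2 * f D) (- D * derive1 f D).
Proof.
move=> F a1 c'0 fc' D0 De; rewrite le_min; apply/andP; split.
  have D20 : 0 < 2 * D by lra.
  have := fc' (2 * D); rewrite D20 De => /(_ isT).
  rewrite normrM (gtr0_norm D20) (ler0_norm (force_drv_le0 F D20)) powRM ?ler0n ?(ltW D0)//.
  have fh := force_half F D0.
  have -> : c' / 2 `^ (1 + a') / D `^ (1 + a') = c' / (2 `^ (1 + a') * D `^ (1 + a')).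
    by rewrite invfM mulrA.
  by move=> h; apply: (le_trans h); move: fh; lra.
have D1 : D < eps0 by lra.
have := fc' D; rewrite D0 D1 => /(_ isT).
rewrite normrM (gtr0_norm D0) (ler0_norm (force_drv_le0 F D0)).
have -> : D * - derive1 f D = - D * derive1 f D by ring.
apply: le_trans; apply: ler_wpM2r; first by rewrite invr_ge0 powR_ge0.
rewrite ler_pdivrMr ?powR_gt0//; apply: ler_peMr; first exact: ltW.
apply: (@le_trans _ _ (2 `^ 0)); first by rewrite powRr0.
by apply: ler_powR; lra.
Qed.

Lemma cluster_extremes {n : nat} (P : pred 'I_n) : (2 <= #|[set k | P k]%SET|)%N ->
  exists i j, [/\ P i, P j, (i < j)%N & forall k, P k -> (i <= k <= j)%N].
Proof.
move=> card2.
have [i0 Pi0] : exists i0, P i0.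
  have : (0 < #|[set k | P k]%SET|)%N by rewrite (leq_trans _ card2).
  by move/card_gt0P => [i0]; rewrite finset.inE; exists i0.
have [i Pi Hi'] := arg_minnP (fun k : 'I_n => val k) Pi0.
have [j Pj Hj'] := arg_maxnP (fun k : 'I_n => val k) Pi0.
have Hi k : P k -> (i <= k)%N by exact: Hi'.
have Hj k : P k -> (k <= j)%N by exact: Hj'.
exists i, j; split=> // [|k Pk]; last by rewrite Hi// Hj.
rewrite ltn_neqAle Hi// andbT; apply/eqP => /val_inj e.
suff : (#|[set k | P k]%SET| <= 1)%N by rewrite leqNgt card2.
rewrite -(cards1 i); apply: subset_leq_card; apply/fintype.subsetP => k; rewrite !finset.inE => Pk.
have := Hi k Pk; have := Hj k Pk; rewrite -e => h1 h2.
by apply/eqP/val_inj/eqP; rewrite eqn_leq h1 h2.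
Qed.

(* The centre of mass of a cluster has bounded speed, so it stays within
   [O(tau - t)] of the collision point, and the extreme particles are at
   distance at least [1 / n] times the diameter from it. *)
Lemma extremes_from_diameter {R : realType} {n : nat} (y : 'I_n -> R) (P : pred 'I_n) (i j : 'I_n) (y0 e : R) : P i -> P j ->
  (forall k, P k -> y i <= y k <= y j) -> 0 <= e ->
  `|\sum_(k < n | P k) (y0 - y k)| <= e ->
  (y j - y i - e) <= n%:R * Num.max 0 (y j - y0) /\ (y j - y i - e) <= n%:R * Num.max 0 (y0 - y i).
Proof.
move=> Pi Pj H e0; rewrite ler_norml => /andP[m1 m2].
pose N : R := #|[set k | P k]%SET|%:R.
have sumc (v : R) : \sum_(k < n | P k) v = N * v.
  rewrite sumr_const mulr_natl; congr (_ *+ _); apply: eq_card => k.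
  by rewrite !finset.inE.
have N0 : 0 <= N by exact: ler0n.
have Nn : N <= n%:R by rewrite ler_nat -[leqRHS](card_ord n) max_card.
have Nmax v : N * v <= n%:R * Num.max 0 v.
  apply: (@le_trans _ _ (N * Num.max 0 v)); first by rewrite ler_wpM2l// le_max lexx orbT.
  by rewrite ler_wpM2r// le_max lexx.
split.
  apply: le_trans (Nmax _).
  (* All summands are nonnegative, and the one for [i] is the full diameter. *)
  have : y j - y i <= \sum_(k < n | P k) (y j - y k).
    rewrite (bigD1 i)//= lerDl; apply: sumr_ge0 => k /andP[Pk _]; rewrite subr_ge0.
    by have /andP[] := H k Pk.
  have -> : \sum_(k < n | P k) (y j - y k) = N * (y j - y0) + \sum_(k < n | P k) (y0 - y k).
    by rewrite -sumc -big_split /=; apply: eq_bigr => k _; ring.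
  lra.
apply: le_trans (Nmax _).
have : y j - y i <= \sum_(k < n | P k) (y k - y i).
  rewrite (bigD1 j)//= lerDl; apply: sumr_ge0 => k /andP[Pk _]; rewrite subr_ge0.
  by have /andP[] := H k Pk.
have -> : \sum_(k < n | P k) (y k - y i) = N * (y0 - y i) - \sum_(k < n | P k) (y0 - y k).
  by rewrite -sumc -sumrB /=; apply: eq_bigr => k _; ring.
lra.
Qed.

(** Since [q < 1], the drift of the centre of mass, linear in the time to collision, is negligible
    against the diameter, which is at least of the order of the power [q]. *)
Lemma lower_final {R : realType} (C1 K4 q : R) : 0 < C1 -> 0 < K4 -> 0 < q < 1 ->
  exists2 r, 0 < r & forall v, 0 < v <= r -> K4 * v <= C1 / 2 * v `^ q.
Proof.
move=> C10 K40 /andP[q0 q1].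
have q1' : 0 < 1 - q by lra.
have K2 : 0 < 2 * K4 by lra.
have [r r0 Hr] := powR_small q1' (divr_gt0 C10 K2).
exists r => // v /andP[v0 vr].
have E : v = v `^ (1 - q) * v `^ q.
  rewrite -powRD; first by rewrite subrK powRr1// ltW.
  by apply/implyP => _; rewrite gt_eqF.
rewrite {1}E mulrA; apply: ler_wpM2r; first exact: powR_ge0.
have := Hr v; rewrite vr ltW// ler_pdivlMr// => /(_ isT); lra.
Qed.

(** [shrink_speed] gives the rate [2 * K] divided by the power of the distance; half of it is spent
    on the bounded terms, hence the factor 2 in the denominator of [K]. *)
Lemma collapse_speed {R : realType} {n : nat} {f g : R -> R} {L T : R} {S0 : set R}
  {x b : R -> 'rV[R]_n} (Sy : sys f g L T S0 x b) (a' c' eps0 c gam M K t : R) (i j : 'I_n) :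
  -1 < a' -> 0 < c' ->
  (forall u : R, 0 < u < eps0 -> c' / u `^ (1 + a') <= `|u * derive1 f u|) ->
  0 <= t <= T -> (i < j)%N -> b t 0 i != 0 -> b t 0 j != 0 -> 0 < c -> sgap c (x t) (b t) -> 0 < gam ->
  (forall k : 'I_n, (k < i)%N -> b t 0 k != 0 -> gam <= x t 0 i - x t 0 k) ->
  (forall k : 'I_n, (j < k)%N -> b t 0 k != 0 -> gam <= x t 0 k - x t 0 j) ->
  (forall k, `|g (x t 0 k)| <= M) ->
  K = c' / 2 `^ (1 + a') / (2 * n%:R) ->
  x t 0 j - x t 0 i < c -> 2 * (x t 0 j - x t 0 i) < eps0 ->
  (4 * f gam + 2 * M) * (x t 0 j - x t 0 i) `^ (1 + a') <= K ->
  velocity f g (x t) (b t) j - velocity f g (x t) (b t) i <= - K / (x t 0 j - x t 0 i) `^ (1 + a').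
Proof.
have [F L0 gL T0 G] := Sy.
move=> a1 c'0 fc' tT ij bi bj c0 sg gam0 Hl Hr gM KE Dc De DK.
have Zt := gs_Zn G tT; have [/= _ xb] := Zt.
have D0 : 0 < x t 0 j - x t 0 i by rewrite subr_gt0; apply: xb => //; rewrite mulf_neq0.
have SP := shrink_speed g F Zt ij bi bj c0 sg Dc gam0 Hl Hr.
have n0 : 0 < n%:R :> R by exact: lt_le_trans (ord_ge1 i).
apply: (le_trans SP) => {SP Hl Hr}.
set D := x t 0 j - x t 0 i in D0 Dc De DK *.
have wle := pow_min_lower F a1 c'0 fc' D0 De.
have P0 : 0 < D `^ (1 + a') by exact: powR_gt0.
rewrite -ler_pdivlMr// in DK.
have : n%:R^-1 * (c' / 2 `^ (1 + a') / D `^ (1 + a')) <= n%:R^-1 * Num.min (2 * f D) (- D * derive1 f D).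
  by apply: ler_wpM2l => //; exact: inv_n_ge0.
have -> : n%:R^-1 * (c' / 2 `^ (1 + a') / D `^ (1 + a')) = 2 * (K / D `^ (1 + a')).
  by rewrite KE; field; rewrite ?gt_eqF ?powR_gt0.
have := gM i; have := gM j; rewrite mulNr; move: DK; clear; lra.
Qed.

Lemma sol_lower {R : realType} {n : nat} {f g : R -> R} {L T : R} {S0 : set R}
  {x b : R -> 'rV[R]_n} (Sy : sys f g L T S0 x b) (tau y a' c' eps0 : R) : -1 < a' -> 0 < c' -> 0 < eps0 ->
  (forall u : R, 0 < u < eps0 -> c' / u `^ (1 + a') <= `|u * derive1 f u|) ->
  collision_point S0 x b tau y ->
  exists (c : R) (i j : 'I_n), [/\ 0 < c, (i < j)%N,
    x tau 0 i = y /\ x tau 0 j = y,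
    left_lim (fun s : R => b s 0 i) tau != 0 /\
    left_lim (fun s : R => b s 0 j) tau != 0 &
    \forall t \near tau^'-,
      c * (tau - t) `^ (1 / (2 + a')) < x t 0 j - y /\
      x t 0 i - y < - (c * (tau - t) `^ (1 / (2 + a')))].
Proof.
have [F L0 gL T0 G] := Sy.
move=> a1 c'0 eps00 fc' [Stau card2].
have tT := gs_times G Stau; have /andP[tau0 tauT] := tT.
have [p [p0t ps bE]] := left_window Sy tT; have /andP[p0 pt] := p0t.
have LL i := gs_left_lim i G p0 pt tauT ps.
pose P k := (x tau 0 k == y) && (b p 0 k != 0).
have [i [j [Pi Pj ij Pij]]] : exists i j, [/\ P i, P j, (i < j)%N & forall k, P k -> (i <= k <= j)%N].
  apply: cluster_extremes; rewrite (_ : [set k | P k]%SET = colliding x b tau y)//.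
  by apply/setP => k; rewrite !finset.inE LL.
have [/eqP xi bi] := andP Pi. have [/eqP xj bj] := andP Pj.
have [c c0 sg] := sol_sgap Sy.
have [gam1 gam10 sep] := sep_exists (x tau).
have [M M0 HM] := sol_g_bound Sy.
pose gam := gam1 / 4. have gam0 : 0 < gam by rewrite /gam divr_gt0.
have n0 : 0 < n%:R :> R by exact: lt_le_trans (ord_ge1 i).
pose q := 1 / (2 + a').
have q01 : 0 < q < 1.
  by rewrite /q divr_gt0 ?ltr_pdivrMr //; move: a1; clear; lra.
pose K := c' / 2 `^ (1 + a') / (2 * n%:R).
have K0 : 0 < K.
  by rewrite /K; apply: divr_gt0; [rewrite divr_gt0// powR_gt0|rewrite mulr_gt0].
pose K1 := 4 * f gam + 2 * M.
have K10 : 0 < K1 by rewrite /K1; have := force_ge0 F gam0; move: M0; clear; lra.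
have a10 : 0 < 1 + a' by move: a1; clear; lra.
have [r r0 Hr] := powR_small a10 (divr_gt0 K0 K10).
(* Both extremes stay within [rho] of [y], so the diameter is below [2 * rho]. The four bounds keep
   other clusters away, make the block alternating, put twice the diameter below [eps0], and let the
   power law absorb the bounded terms. *)
have [rho [rho0 [rho1 rho2 rho3 rho4]]] : exists rho, 0 < rho /\
  [/\ rho <= gam, rho <= c / 4, rho <= eps0 / 8 & rho <= r / 4].
  exists (Num.min (Num.min gam (c / 4)) (Num.min (eps0 / 8) (r / 4))).
  rewrite !lt_min gam0 !divr_gt0//; split=> //.
  by split; rewrite !ge_min lexx ?orbT.
have [s /andP[ps' st] Hs] := left_close Sy p0t tauT rho0.
pose D t := x t 0 j - x t 0 i.
pose dD t := velocity f g (x t) (b t) j - velocity f g (x t) (b t) i.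
have tt' t : s < t < tau -> [/\ 0 <= t <= T, 0 < t < T & p < t < tau].
  by move: p0 tauT ps'; clear => *; split; lra.
have near t (k : 'I_n) : s < t < tau -> `|x t 0 k - x tau 0 k| < rho.
  by move=> /andP[h1 h2]; apply: Hs; rewrite h1 ltW.
have far t (k l : 'I_n) : s < t < tau -> x tau 0 k != x tau 0 l -> gam <= `|x t 0 k - x t 0 l|.
  move=> ts ne; have := sep k l ne; have := near t k ts; have := near t l ts.
  by rewrite !ltr_norml !ler_normr /gam; move: rho1; rewrite /gam; clear; lra.
have outl (k : 'I_n) : (k < i)%N -> b p 0 k != 0 -> x tau 0 k != x tau 0 i.
  move=> ki bk; rewrite xi; apply/negP => xk.
  by have := Pij k; rewrite /P xk bk => /(_ isT)/andP[]; rewrite leqNgt ki.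
have outr (k : 'I_n) : (j < k)%N -> b p 0 k != 0 -> x tau 0 k != x tau 0 j.
  move=> jk bk; rewrite xj; apply/negP => xk.
  by have := Pij k; rewrite /P xk bk => /(_ isT)/andP[_]; rewrite leqNgt jk.
have H t : s < t < tau -> [/\ 0 < D t, is_derive t 1 D (dD t) & dD t <= - K / D t `^ (1 + a')].
  move=> ts; have [tT' tT2 tp] := tt' t ts.
  have bt : b t = b p by apply: bE; move: tp; clear; lra.
  have [/= _ xb] := gs_Zn G tT'.
  have D0 : 0 < D t by rewrite subr_gt0; apply: xb => //; rewrite bt mulf_neq0.
  have D2 : D t < 2 * rho.
    by have := near t i ts; have := near t j ts; rewrite xi xj !ltr_norml /D; clear; lra.
  have nS := ps t tp.
  split=> //; first by apply: is_deriveB; exact: (gs_ode G).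
  apply: (collapse_speed Sy (c' := c') (eps0 := eps0) (c := c) (gam := gam) (M := M)) => //; rewrite ?bt//.
  - by rewrite -bt; exact: sg.
  - move=> k ki bk.
    have xki : x t 0 k < x t 0 i by apply: xb => //; rewrite bt mulf_neq0.
    by have := far t k i ts (outl k ki bk); rewrite ltr0_norm ?subr_lt0// opprB.
  - move=> k jk bk.
    have xjk : x t 0 j < x t 0 k by apply: xb => //; rewrite bt mulf_neq0.
    by have := far t k j ts (outr k jk bk); rewrite gtr0_norm ?subr_gt0.
  - by move=> k; have [] := HM t k tT'.
  - by rewrite -/(D t); move: D2 rho2 c0; clear; lra.
  - by rewrite -/(D t); move: D2 rho3 eps00; clear; lra.
  - rewrite -/(D t) -/K1 mulrC -ler_pdivlMr//; apply: Hr.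
    by move: D0 D2 rho4 r0; clear; lra.
have low := decay_lower a1 (ltW K0) st H.
pose C1 := ((2 + a') * K) `^ q.
have aK : 0 < (2 + a') * K by rewrite mulr_gt0//; move: a1; clear; lra.
have C10 : 0 < C1 by rewrite powR_gt0.
pose K4 := n%:R * (f gam + M).
have K40 : 0 < K4 by rewrite mulr_gt0//; have := force_ge0 F gam0; move: M0; clear; lra.
have cM t : s < t < tau -> `|\sum_(k < n | P k) x tau 0 k - \sum_(k < n | P k) x t 0 k| <= K4 * (tau - t).
  move=> ts; have [tT' tT2 tp] := tt' t ts.
  apply: (@MVT_norm R t tau (fun t => \sum_(k < n | P k) x t 0 k)
     (fun t => \sum_(k < n | P k) velocity f g (x t) (b t) k) K4 set0 (finite_set0 _)).
  - by move: ts; clear; lra.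
  - by apply: cts_sum => k _; apply: cts_sub (gs_cts G k) _ _; move: tT2 tauT; clear; lra.
  move=> u ut _; have us : s < u < tau by move: ts ut; clear; lra.
  have [uT uT2 up] := tt' u us.
  have nS := ps u up.
  have bu : b u = b p by apply: bE; move: up; clear; lra.
  split.
    by apply: (@is_derive_bigsum R n P (fun k t => x t 0 k) (fun k t => velocity f g (x t) (b t) k)) => k;
      exact: (gs_ode G).
  apply: (group_speed F (gs_charges G uT) gam0 (ltW M0)); first by move=> k _; have [] := HM u k uT.
  move=> k l Pk Pl; rewrite bu => bl; apply: far => //.
  have [/eqP xk _] := andP Pk; rewrite xk.
  by move: Pl; rewrite /P bl andbT eq_sym.
have [r1 r10 Hr1] := lower_final C10 K40 q01.
(* Of [C1] times the power, half is lost to the drift and a factor [n] to the passage from the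
   diameter to an extreme particle; one more factor 2 makes the inequality strict. *)
exists (C1 / (4 * n%:R)), i, j; split=> //.
- by rewrite divr_gt0// mulr_gt0.
- by rewrite !LL.
apply/near_leftP; exists (Num.max s (tau - r1)).
  by rewrite gt_max st /=; move: r10; clear; lra.
move=> t; rewrite gt_max => /andP[/andP[ts tr1] tt].
have ts' : s < t < tau by rewrite ts.
have [tT' tT2 tp] := tt' t ts'.
rewrite -/q; set Z := (tau - t) `^ q.
have tv : 0 < tau - t <= r1 by move: tt tr1; clear; lra.
have Z0 : 0 < Z by apply: powR_gt0; move: tv; clear; lra.
have lowt := low t ts'.
rewrite -/q powRM in lowt; [|exact: ltW|by move: tv; clear; lra].
rewrite -/C1 -/Z in lowt.
have small := Hr1 _ tv; rewrite -/Z in small.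
have xle k : P k -> x t 0 i <= x t 0 k <= x t 0 j.
  move=> Pk; have [/= _ xb] := gs_Zn G tT'.
  have bt : b t = b p by apply: bE; move: tp; clear; lra.
  have [_ bk] := andP Pk; have /andP[ik kj] := Pij k Pk.
  apply/andP; split.
    move: ik; rewrite leq_eqVlt => /orP[/eqP/val_inj->//|ik].
    by apply/ltW/xb => //; rewrite bt mulf_neq0.
  move: kj; rewrite leq_eqVlt => /orP[/eqP/val_inj->//|kj].
  by apply/ltW/xb => //; rewrite bt mulf_neq0.
have e0 : 0 <= K4 * (tau - t) by apply: mulr_ge0; [exact: ltW|move: tv; clear; lra].
have cMt : `|\sum_(k < n | P k) (y - x t 0 k)| <= K4 * (tau - t).
  rewrite sumrB; apply: le_trans (cM t ts'); rewrite le_eqVlt; apply/orP; left; apply/eqP.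
  by congr (`|_ - _|); apply: eq_bigr => k /andP[/eqP].
have [right left] := extremes_from_diameter Pi Pj xle e0 cMt.
rewrite -/(D t) in right left.
have key (v : R) : D t - K4 * (tau - t) <= n%:R * Num.max 0 v -> C1 / (4 * n%:R) * Z < v.
  have C1Z : 0 < C1 * Z by exact: mulr_gt0.
  have -> : C1 / (4 * n%:R) * Z = (C1 * Z / 4) / n%:R by field; rewrite gt_eqF.
  rewrite ltr_pdivrMr//; have [v0|v0] := leP v 0; first by rewrite mulr0; move: lowt small C1Z; clear; lra.
  move: lowt small C1Z; clear; lra.
split; first exact: key.
have := key (y - x t 0 i) left; clear; lra.
Qed.

(** * Stability between and through collisions *)

(** A charge alone at its position is the whole net charge there, so conservation forbids it to
    vanish. *)
Lemma no_collision_jump {R : realType} {n : nat} (x b b' : 'rV[R]_n) :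
  (forall i, b' 0 i = b 0 i \/ b' 0 i = 0) ->
  (forall y, \sum_(i < n | x 0 i == y) b' 0 i = \sum_(i < n | x 0 i == y) b 0 i) ->
  (forall i k, i != k -> b 0 i != 0 -> b 0 k != 0 -> x 0 i != x 0 k) -> b' = b.
Proof.
move=> J1 J2 D; apply/rowP => i.
have [bi|bi] := eqVneq (b 0 i) 0; first by have [->//|->] := J1 i.
have := J2 (x 0 i); rewrite (bigD1 i)//= [RHS](bigD1 i)//=.
have Z k : x 0 k == x 0 i -> k != i -> b 0 k = 0.
  move=> xk ki; apply/eqP/negPn/negP => bk.
  by have := D k i ki bk bi; rewrite xk.
rewrite big1; last by move=> k /andP[xk ki]; have [->|//] := J1 k; exact: Z.
by rewrite big1 ?addr0// => k /andP[xk ki]; exact: Z.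
Qed.

Lemma velocity_relabel {R : realType} {n : nat} (f g : R -> R) (p : 'S_n) (x b : 'rV[R]_n) i :
  velocity f g (relabel p x) (relabel p b) i = velocity f g x b (p i).
Proof.
rewrite /velocity !mxE; congr (_ * _ + _).
rewrite [RHS](reindex_inj (@perm_inj _ p)) /=; apply: eq_big => k; first by rewrite (inj_eq perm_inj).
by rewrite !mxE.
Qed.

Lemma force_lip_far {R : realType} (f : R -> R) (m u v : R) : force f -> 0 < m -> 2 * m <= `|v| -> `|u - v| <= m ->
  `|f u - f v| <= - derive1 f m * `|u - v|.
Proof.
move=> F m0; have P (u' v' : R) : 0 <= v' -> 2 * m <= v' -> `|u' - v'| <= m ->
  `|f u' - f v'| <= - derive1 f m * `|u' - v'|.
  move=> v0 mv; rewrite ler_norml => /andP[h1 h2]; apply: force_lip => //; lra.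
have [v0|v0] := leP 0 v; first by rewrite (ger0_norm v0); exact: P.
rewrite (ltr0_norm v0) => mv uv.
have -> : f u - f v = - (f (- u) - f (- v)) by rewrite !(force_N F); ring.
have -> : u - v = - (- u - - v) by ring.
rewrite !normrN; apply: P => //; first lra.
have -> : - u - - v = - (u - v) by ring.
by rewrite normrN.
Qed.

(** Every mutual distance of charges changes by at most [2 * z] and stays above [m], where the slope
    of [f] is at most its slope at [m] in absolute value. *)
Lemma velocity_diff {R : realType} {n : nat} (f g g' : R -> R) (x x' b : 'rV[R]_n) (m L z d : R) i :
  force f -> charges b -> 0 < m -> 0 <= L -> (forall u v, `|g u - g v| <= L * `|u - v|) ->
  (forall u, `|g' u - g u| <= d) ->
  (forall i k, i != k -> b 0 i != 0 -> b 0 k != 0 -> 2 * m <= `|x 0 i - x 0 k|) ->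
  (forall i, `|x' 0 i - x 0 i| <= z) -> 2 * z <= m ->
  `|velocity f g' x' b i - velocity f g x b i| <= (2 * (- derive1 f m) + L) * z + d.
Proof.
move=> F bc m0 L0 gL gd sep xz zm.
have f'0 : 0 <= - derive1 f m by rewrite oppr_ge0; exact: force_drv_le0.
have z0 : 0 <= z by exact: le_trans (xz i).
have -> : velocity f g' x' b i - velocity f g x b i =
  n%:R^-1 * (\sum_(k < n | k != i) b 0 i * b 0 k * (f (x' 0 i - x' 0 k) - f (x 0 i - x 0 k)))
  + b 0 i * (g' (x' 0 i) - g (x 0 i)).
  rewrite /velocity [X in _ = _ * X + _](_ : _ = \sum_(k < n | k != i) b 0 i * b 0 k * f (x' 0 i - x' 0 k) - \sum_(k < n | k != i) b 0 i * b 0 k * f (x 0 i - x 0 k)).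
    ring.
  by rewrite -sumrB; apply: eq_bigr => k _; ring.
have S : `|\sum_(k < n | k != i) b 0 i * b 0 k * (f (x' 0 i - x' 0 k) - f (x 0 i - x 0 k))| <= n%:R * (2 * (- derive1 f m) * z).
  apply: sum_norm_le; first by apply: mulr_ge0 => //; lra.
  move=> k ki; have [->|bi] := eqVneq (b 0 i) 0.
    by rewrite !mul0r normr0; apply: mulr_ge0 => //; lra.
  have [->|bk] := eqVneq (b 0 k) 0.
    by rewrite mulr0 mul0r normr0; apply: mulr_ge0 => //; lra.
  rewrite !normrM; have -> : `|b 0 i| = 1.
    by have [->|->] := charge_pm bc bi; rewrite ?normrN normr1.
  have -> : `|b 0 k| = 1.
    by have [->|->] := charge_pm bc bk; rewrite ?normrN normr1.
  rewrite !mul1r.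
  have d2 : `|x' 0 i - x' 0 k - (x 0 i - x 0 k)| <= 2 * z.
    have := xz i; have := xz k; rewrite !ler_norml; lra.
  have ik : i != k by rewrite eq_sym.
  apply: (le_trans (force_lip_far F m0 (sep i k ik bi bk) _)); first exact: le_trans zm.
  have -> : 2 * - derive1 f m * z = - derive1 f m * (2 * z) by ring.
  exact: ler_wpM2l.
apply: (le_trans (ler_normD _ _)).
have h1 : `|n%:R^-1 * \sum_(k < n | k != i) b 0 i * b 0 k * (f (x' 0 i - x' 0 k) - f (x 0 i - x 0 k))| <= 2 * (- derive1 f m) * z.
  rewrite normrM ger0_norm ?inv_n_ge0//; exact: (inv_n_le i).
have h2 : `|b 0 i * (g' (x' 0 i) - g (x 0 i))| <= L * z + d.
  rewrite normrM; apply: (@le_trans _ _ (1 * (L * z + d))); last by rewrite mul1r.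
  apply: ler_pM => //; first exact: charge_norm.
  have -> : g' (x' 0 i) - g (x 0 i) = (g' (x' 0 i) - g (x' 0 i)) + (g (x' 0 i) - g (x 0 i)) by ring.
  apply: (le_trans (ler_normD _ _)).
  have : L * `|x' 0 i - x 0 i| <= L * z by exact: ler_wpM2l.
  have := gd (x' 0 i); have := gL (x' 0 i) (x 0 i); clear; lra.
move: h1 h2; clear; lra.
Qed.

(* Charges that stay apart see a Lipschitz force, so Gronwall applies. *)
Lemma compare_trajectory {R : realType} {n : nat} (f g g' : R -> R) (x X b : R -> 'rV[R]_n) (B : 'rV[R]_n)
    (S S' : set R) (m L d rho t0 t1 : R) :
  force f -> charges B -> 0 < m -> 0 <= L -> (forall u v, `|g u - g v| <= L * `|u - v|) ->
  (forall u, `|g' u - g u| <= d) -> gsol f g' t0 t1 S' x b -> finite_set S ->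
  (forall i, cts t0 t1 (fun t => X t 0 i)) ->
  (forall t i, t0 < t < t1 -> ~ S t -> is_derive t 1 (fun s => X s 0 i) (velocity f g (X t) B i)) ->
  (forall t i k, t0 <= t <= t1 -> i != k -> B 0 i != 0 -> B 0 k != 0 -> 4 * m <= `|X t 0 i - X t 0 k|) ->
  t0 <= t1 -> 0 < rho -> d <= rho ->
  gap_rate (- (2 * (- derive1 f m) + L) - 3) rho t0 t1 <= m / 4 ->
  (forall i, `|x t0 0 i - X t0 0 i| <= rho) -> b t0 = B ->
  forall t, t0 <= t <= t1 ->
    (forall i, `|x t 0 i - X t 0 i| <= gap_rate (- (2 * (- derive1 f m) + L) - 3) rho t0 t) /\ b t = B.
Proof.
move=> F Bc m0 L0 gL gd G FS Xc Xd Xsep t01 rho0 drho; set Lam := 2 * (- derive1 f m) + L.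
(* This is a growing exponential of rate [Lam + 2]: the Gronwall rate [Lam], one unit for the
   perturbation [d <= rho], and one for the width of the barrier band. *)
pose th := gap_rate (- Lam - 3) rho t0; rewrite -/th => thm x0 b0 t tt.
have Lam0 : 0 <= Lam.
  have : 0 <= - derive1 f m by rewrite oppr_ge0; exact: force_drv_le0.
  by rewrite /Lam; move: L0; clear; lra.
have thD (u : R) : is_derive u 1 th ((Lam + 2) * th u).
  have := is_derive_gap_rate (- Lam - 3) rho t0 u.
  by have -> : - (- Lam - 3 + 1) = Lam + 2 by ring.
have thmono (u v : R) : u <= v -> th u <= th v.
  move=> uv; rewrite /th /gap_rate; apply: ler_wpM2l; first exact: ltW.
  rewrite ler_expR; have -> : - (- Lam - 3 + 1) = Lam + 2 by ring.
  by apply: ler_wpM2l; [move: Lam0; clear; lra|move: uv; clear; lra].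
have th0 : th t0 = rho by exact: gap_rate0.
have thr (u : R) : t0 <= u -> rho <= th u by move=> tu; rewrite -th0; exact: thmono.
apply: (gs_ind G (P := fun t => (forall i, `|x t 0 i - X t 0 i| <= th t) /\ b t = B) tt).
  by split=> // i; rewrite th0.
move=> s s' h1 h2 h3 h4 [xs bs].
have s't1 : s' <= t1 by move: h3 tt; clear; lra.
have bE (u : R) : s <= u < s' -> b u = B by move=> us; rewrite (gs_constE G h1 s't1 h4 us).
pose eta := Num.min (m / 4) (rho / (Lam + 1)).
have Lam1 : 0 < Lam + 1 by move: Lam0; clear; lra.
have eta0 : 0 < eta by rewrite /eta lt_min !divr_gt0.
have etaE : eta <= m / 4 /\ Lam * eta < rho.
  rewrite /eta !ge_min lexx; split=> //.
  have : Lam * Num.min (m / 4) (rho / (Lam + 1)) <= Lam * (rho / (Lam + 1)).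
    by apply: ler_wpM2l => //; rewrite ge_min lexx orbT.
  move/le_lt_trans; apply; rewrite mulrA ltr_pdivrMr//; move: rho0; clear; lra.
have [eta1 eta2] := etaE.
pose k (p : 'I_n * bool) t := th t - (if p.2 then x t 0 p.1 - X t 0 p.1 else X t 0 p.1 - x t 0 p.1).
pose dk (p : 'I_n * bool) t := (Lam + 2) * th t -
  (if p.2 then velocity f g' (x t) (b t) p.1 - velocity f g (X t) B p.1
   else velocity f g (X t) B p.1 - velocity f g' (x t) (b t) p.1).
have K : forall t p, s <= t <= s' -> true -> 0 <= k p t.
  apply: (@barrier R _ xpredT k dk s s' eta S FS (ltW h2) eta0).
  - move=> [i p] _; apply: cts_sub2; first exact: derive_cts (fun t _ => thD t).
    have c1 := cts_sub (gs_cts G i) h1 s't1; have c2 := cts_sub (Xc i) h1 s't1.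
    by case: p; exact: cts_sub2.
  - by move=> [i p] _; have := xs i; rewrite ler_norml /k /=; case: p; clear; lra.
  move=> u [i p] us nS _ kp kmin.
  have ut : t0 < u < t1 by move: us h1 s't1; clear; lra.
  have ut' : t0 <= u <= t1 by move: ut; clear; lra.
  have bu : b u = B by apply: bE; move: us; clear; lra.
  have nS' : ~ S' u by exact: h4.
  have D1 := gs_ode G i ut nS'; have D2 := Xd u i ut nS.
  pose z := th u - k (i, p) u.
  have dev j : `|x u 0 j - X u 0 j| <= z.
    by have := kmin (j, true) isT; have := kmin (j, false) isT; rewrite /z {2 4}/k /= ler_norml; clear; lra.
  have thu : th u <= m / 4 by apply: le_trans thm; apply: thmono; move: ut; clear; lra.
  have zm : 2 * z <= 2 * m / 2 by rewrite /z; move: kp thu eta1; clear; lra.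
  have zm' : 2 * z <= m by move: zm; clear; lra.
  have sep2 i' k' : i' != k' -> B 0 i' != 0 -> B 0 k' != 0 -> 2 * m <= `|X u 0 i' - X u 0 k'|.
    by move=> ne bi' bk'; have := Xsep u i' k' ut' ne bi' bk'; move: m0; clear; lra.
  have := velocity_diff i F Bc m0 L0 gL gd sep2 dev zm'.
  rewrite -/Lam => V; rewrite bu in D1; rewrite /dk /= bu.
  split.
    by case: p {kp kmin z dev zm zm' V}; apply: is_deriveB => //; apply: is_deriveB.
  have ru := thr u (ltW (proj1 (andP ut))).
  have Lz : Lam * z <= Lam * th u + Lam * eta.
    by rewrite -mulrDr; apply: ler_wpM2l => //; rewrite /z; move: kp; clear; lra.
  have pos : 0 < (Lam + 2) * th u - (Lam * z + d).
    by move: Lz eta2 ru drho rho0; clear; lra.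
  move: V; rewrite ler_norml => /andP[V1 V2].
  by case: (p); move: V1 V2 pos; clear; lra.
have xs' i : `|x s' 0 i - X s' 0 i| <= th s'.
  have ss : s <= s' <= s' by rewrite lexx ltW.
  by have := K s' (i, true) ss isT; have := K s' (i, false) ss isT; rewrite /k /= ler_norml; clear; lra.
split=> //.
have [J1 J2] := gs_jumpE G h1 h2 s't1 h4; rewrite bs in J1 J2.
(* The charges are still apart at [s'], so none can jump there. *)
apply: no_collision_jump J1 J2 _ => i k' ne bi bk.
have s'tt : t0 <= s' <= t1 by move: h1 h2 s't1; clear; lra.
have d1 := Xsep s' i k' s'tt ne bi bk; have d2 := xs' i; have d3 := xs' k'.
have d4 := thmono s' t1 s't1; apply/eqP => e; rewrite e in d2.
by move: thm m0 d1 d2 d3 d4; rewrite !ler_norml ler_normr; clear; lra.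
Qed.

(** * Clusters: net charge, permutation of survivors, collapse *)

Definition lone {R : realType} {n : nat} (xi b : 'rV[R]_n) :=
  forall i k, i != k -> xi 0 i = xi 0 k -> b 0 i = 0 \/ b 0 k = 0.

(** At most one term at [y] is nonzero, so cross terms vanish. The number of charges in a cluster
    thereby becomes a function of its net charge. *)
Lemma lone_sq {R : realType} {n : nat} (xi b : 'rV[R]_n) y : lone xi b ->
  \sum_(i < n | xi 0 i == y) b 0 i * b 0 i = (\sum_(i < n | xi 0 i == y) b 0 i) ^+ 2.
Proof.
move=> l1; rewrite expr2 big_distrl /=; apply: eq_bigr => i /eqP xiy.
rewrite (bigD1 i) /=; last exact/eqP.
rewrite mulrDr mulr_sumr big1 ?addr0// => k /andP[/eqP xky ki].
have ik : i != k by rewrite eq_sym.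
by have [->|->] := l1 i k ik (etrans xiy (esym xky)); rewrite ?mulr0 ?mul0r.
Qed.

(** Interpolation of the indicator of [w] by a quadratic polynomial on the three possible charges,
    so that counting particles of charge [w] reduces to sums of charges and of their squares. *)
Lemma charge_indicator {R : realType} (v w : R) : v \in [:: -1; 0; 1] -> w \in [:: -1; 0; 1] ->
  ((v == w)%:R : R) = 1 - w * w + (w * v) / 2 + (3 * (w * w) / 2 - 1) * (v * v).
Proof.
rewrite !inE; case: (eqVneq v w) => [->|vw]; first by move=> _ /or3P[] /eqP->; rewrite /=; field.
move=> /or3P[] /eqP vE /or3P[] /eqP wE; move: vw; rewrite vE wE ?eqxx//= => _; by field.
Qed.

(** Both configurations contain every pair of a position and a charge equally often: by
    [charge_indicator] and [lone_sq] the multiplicity is a function of the size and the net charge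
    of the cluster. A permutation between equal multisets then maps each cluster to itself. *)
Lemma cluster_perm {R : realType} {n : nat} (xi b b' : 'rV[R]_n) : charges b -> charges b' ->
  lone xi b -> lone xi b' ->
  (forall y, \sum_(i < n | xi 0 i == y) b 0 i = \sum_(i < n | xi 0 i == y) b' 0 i) ->
  exists q : 'S_n, forall i, xi 0 (q i) = xi 0 i /\ b' 0 i = b 0 (q i).
Proof.
move=> bc bc' l1 l1' sumE.
pose t1 : n.-tuple (R * R) := [tuple (xi 0 i, b 0 i) | i < n].
pose t2 : n.-tuple (R * R) := [tuple (xi 0 i, b' 0 i) | i < n].
suff /tuple_permP[q qE] : perm_eq t2 t1.
  exists q => i.
  have : tnth t2 i = tnth [tuple tnth t1 (q i) | i < n] i by congr tnth; apply: val_inj.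
  by rewrite !tnth_mktuple => -[-> ->].
have cnt (c : 'rV[R]_n) : charges c -> lone xi c -> forall y w, w \in [:: -1; 0; 1] ->
  ((count_mem (y, w) [tuple (xi 0 i, c 0 i) | i < n])%:R : R) =
  (\sum_(i < n | xi 0 i == y) (1 - w * w)) + w / 2 * (\sum_(i < n | xi 0 i == y) c 0 i)
  + (3 * (w * w) / 2 - 1) * (\sum_(i < n | xi 0 i == y) c 0 i) ^+ 2.
  move=> cc lc y w wc; rewrite -lone_sq// !mulr_sumr -!big_split /=.
  rewrite -sum1_count big_map /= big_enum_cond /= natr_sum.
  rewrite (eq_bigl (fun i => (xi 0 i == y) && (c 0 i == w))); last by move=> i; rewrite xpair_eqE.
  rewrite big_mkcondr /=; apply: eq_bigr => i _.
  rewrite -[LHS](_ : ((c 0 i == w)%:R : R) = _); last by case: eqP.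
  by rewrite charge_indicator//; field.
apply/allP => -[y w] _ /=; apply/eqP.
have [wc|wc] := boolP (w \in [:: -1; 0; 1]).
  have : ((count_mem (y, w) t2)%:R : R) = (count_mem (y, w) t1)%:R by rewrite !cnt// sumE.
  by move/eqP; rewrite eqr_nat => /eqP.
have Z (c : 'rV[R]_n) : charges c -> count_mem (y, w) [tuple (xi 0 i, c 0 i) | i < n] = 0%N.
  move=> cc; apply/eqP; rewrite -leqn0 leqNgt -has_count; apply/hasPn => -[y' w'] /mapP[i _ [_ ->]] /=.
  by rewrite xpair_eqE negb_and; apply/orP; right; apply: contraNneq wc => <-; exact: cc.
by rewrite !Z.
Qed.

(** As clusters are more than [2 * eta] apart, the cluster at [y] consists of the particles with
    position within [eta] of [y], and [cluster_sum] applies to this set of positions at every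
    jump. *)
Lemma cluster_charge {R : realType} {n : nat} (f g : R -> R) (t1 t2 : R) (S : set R) (x b : R -> 'rV[R]_n)
    (xi : 'rV[R]_n) (eta : R) : gsol f g t1 t2 S x b ->
  (forall t i, t1 <= t <= t2 -> `|x t 0 i - xi 0 i| <= eta) ->
  (forall i j, xi 0 i != xi 0 j -> 2 * eta < `|xi 0 i - xi 0 j|) ->
  forall t y, t1 <= t <= t2 ->
    \sum_(i < n | xi 0 i == y) b t 0 i = \sum_(i < n | xi 0 i == y) b t1 0 i.
Proof.
move=> G near sep t y tt.
case: (pickP (fun i => xi 0 i == y)) => [i0 /eqP i0y|noi]; last by rewrite !big_pred0.
apply: (gs_ind G (P := fun t => \sum_(i < n | xi 0 i == y) b t 0 i = \sum_(i < n | xi 0 i == y) b t1 0 i) tt) => //.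
move=> s s' h1 h2 h3 h4 <-.
have s't2 : s' <= t2 by move: h3 tt; clear; lra.
have s'tt : t1 <= s' <= t2 by move: h1 h2 s't2; clear; lra.
have [_ J2] := gs_jumpE G h1 h2 s't2 h4.
have E i : (xi 0 i == y) = (`|x s' 0 i - y| <= eta).
  apply/idP/idP => [/eqP <-|]; first exact: near.
  apply: contraTT => ne; rewrite -i0y in ne *.
  have := sep i i0 ne; have := near s' i s'tt; rewrite -ltNge.
  by rewrite !ler_norml !ltr_normr; clear; lra.
under eq_bigl do rewrite E; under [RHS]eq_bigl do rewrite E.
exact: (cluster_sum (fun u => `|u - y| <= eta) J2).
Qed.

(** The barrier function of a pair is minimal for the widest pair inside a cluster. Its partners are
    the extreme charges of their cluster, so [shrink_speed] makes it close faster than [Om]. After a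
    time longer than [2 * eta / Om] a surviving pair would have negative distance. *)
Lemma cluster_collapse {R : realType} {n : nat} (f g : R -> R) (t1 t2 : R) (S : set R) (x b : R -> 'rV[R]_n)
    (xi : 'rV[R]_n) (c gam eta G0 Om : R) : force f -> gsol f g t1 t2 S x b -> t1 <= t2 ->
  0 < c -> 0 < gam -> eta <= gam -> 2 * eta < c -> 0 < Om ->
  (forall t, t1 <= t <= t2 -> sgap c (x t) (b t)) ->
  (forall i j, xi 0 i != xi 0 j -> 4 * gam <= `|xi 0 i - xi 0 j|) ->
  (forall t i, t1 <= t <= t2 -> `|x t 0 i - xi 0 i| <= eta) ->
  (forall t i, t1 <= t <= t2 -> `|g (x t 0 i)| <= G0) ->
  (forall D, 0 < D <= 2 * eta -> Om + 4 * f gam + 2 * G0 < n%:R^-1 * Num.min (2 * f D) (- D * derive1 f D)) ->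
  2 * eta < Om * (t2 - t1) ->
  lone xi (b t2).
Proof.
move=> F G t12 c0 gam0 eg ec Om0 sg sep near gG wD short.
have key t : t1 <= t <= t2 -> forall i j : 'I_n, (i < j)%N -> b t 0 i != 0 -> b t 0 j != 0 ->
    xi 0 i = xi 0 j -> x t 0 j - x t 0 i <= 2 * eta - Om * (t - t1).
  move=> tt; apply: (gs_ind G (P := fun t => forall i j : 'I_n, (i < j)%N -> b t 0 i != 0 -> b t 0 j != 0 ->
    xi 0 i = xi 0 j -> x t 0 j - x t 0 i <= 2 * eta - Om * (t - t1)) tt).
    move=> i j ij bi bj e; have h : t1 <= t1 <= t2 by rewrite lexx.
    have := near t1 i h; have := near t1 j h; rewrite e subrr mulr0 subr0 !ler_norml; clear; lra.
  move=> s s' h1 h2 h3 h4 Ps.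
  have s't2 : s' <= t2 by move: h3 tt; clear; lra.
  have bE u : s <= u < s' -> b u = b s by exact: (gs_constE G h1 s't2 h4).
  pose Q (p : 'I_n * 'I_n) := [&& (p.1 < p.2)%N, b s 0 p.1 != 0, b s 0 p.2 != 0 & xi 0 p.1 == xi 0 p.2].
  pose k (p : 'I_n * 'I_n) u := 2 * eta - Om * (u - t1) - (x u 0 p.2 - x u 0 p.1).
  pose dk (p : 'I_n * 'I_n) u := - Om - (velocity f g (x u) (b u) p.2 - velocity f g (x u) (b u) p.1).
  have K : forall u p, s <= u <= s' -> Q p -> 0 <= k p u.
    apply: (@barrier R _ Q k dk s s' 1 set0 (finite_set0 _) (ltW h2) ltr01).
    - move=> p _; apply: cts_sub2.
        apply: cts_sub2; first exact: cts_cst.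
        by apply: cts_scale; apply: cts_sub2; [exact: cts_id|exact: cts_cst].
      by apply: cts_sub2; apply: cts_sub (gs_cts G _) h1 s't2.
    - by move=> [i j] /and4P[ij bi bj /eqP e]; have := Ps i j ij bi bj e; rewrite /k /=; clear; lra.
    move=> u [i j] us _ Qij _ kmin; have /and4P[/= ij bi bj /eqP e] := Qij.
    have ut : t1 < u < t2 by move: us h1 s't2; clear; lra.
    have ut' : t1 <= u <= t2 by move: ut; clear; lra.
    have bu : b u = b s by apply: bE; move: us; clear; lra.
    have nS : ~ S u by exact: h4.
    have Zu := gs_Zn G ut'; have [/= _ xb] := Zu.
    split.
      apply: is_deriveB; last by apply: is_deriveB; exact: (gs_ode G).
      have := is_derive_csub (2 * eta) (is_deriveZ Om (is_derive_subc t1 (is_derive_id u (1 : R)))).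
      by rewrite /GRing.scale /= mulr1.
    have D0 : 0 < x u 0 j - x u 0 i.
      by rewrite subr_gt0; apply: xb => //; rewrite bu mulf_neq0.
    have D2 : x u 0 j - x u 0 i <= 2 * eta.
      by have := near u i ut'; have := near u j ut'; rewrite e !ler_norml; clear; lra.
    have Dc : x u 0 j - x u 0 i < c by move: D2 ec; clear; lra.
    have fara l m : xi 0 l != xi 0 m -> gam <= `|x u 0 l - x u 0 m|.
      move=> ne; have := sep l m ne; have := near u l ut'; have := near u m ut'.
      by rewrite !ler_norml !ler_normr; move: eg; clear; lra.
    have := shrink_speed g F Zu ij _ _ c0 (sg u ut') Dc gam0; rewrite bu bi bj -bu => /(_ isT isT) SP.
    have h5 := wD _ (introT andP (conj D0 D2)).
    have gi := gG u i ut'; have gj := gG u j ut'.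
    rewrite /dk /=; suff : velocity f g (x u) (b u) j - velocity f g (x u) (b u) i < - Om by clear; lra.
    apply: (le_lt_trans (SP _ _)).
    - move=> l li bl; have xli : x u 0 l < x u 0 i by apply: xb => //; rewrite mulf_neq0// bu.
      (* Otherwise [l] and [j] would form a wider pair in the same cluster. *)
      have [el|ne] := eqVneq (xi 0 l) (xi 0 i).
        have Ql : Q (l, j) by rewrite /Q /= (ltn_trans li ij) -bu bl bu bj el e eqxx.
        by have := kmin (l, j) Ql; rewrite /k /=; move: xli; clear; lra.
      by have := fara l i ne; rewrite ltr0_norm ?subr_lt0// opprB.
    - move=> l jl bl; have xjl : x u 0 j < x u 0 l by apply: xb => //; rewrite mulf_neq0// bu.
      have [el|ne] := eqVneq (xi 0 l) (xi 0 j).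
        have Ql : Q (i, l) by rewrite /Q /= (ltn_trans ij jl) -bu bl bu bi el e eqxx.
        by have := kmin (i, l) Ql; rewrite /k /=; move: xjl; clear; lra.
      by have := fara l j ne; rewrite gtr0_norm ?subr_gt0.
    by move: h5 gi gj; clear; lra.
  move=> i j ij bi bj e.
  have [J1 _] := gs_jumpE G h1 h2 s't2 h4.
  have bsi l : b s' 0 l != 0 -> b s 0 l != 0 by have [->|->] := J1 l; rewrite ?eqxx.
  have Qij : Q (i, j) by rewrite /Q /= ij !bsi// e eqxx.
  have := K s' (i, j) _ Qij; rewrite lexx ltW// => /(_ isT); rewrite /k /=; clear; lra.
have t2t : t1 <= t2 <= t2 by rewrite t12 lexx.
have [/= _ xb] := gs_Zn G t2t.
have main (i j : 'I_n) : (i < j)%N -> xi 0 i = xi 0 j -> b t2 0 i = 0 \/ b t2 0 j = 0.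
  move=> ij e; have [->|bi] := eqVneq (b t2 0 i) 0; first by left.
  have [->|bj] := eqVneq (b t2 0 j) 0; first by right.
  have := key t2 t2t i j ij bi bj e.
  have : x t2 0 i < x t2 0 j by apply: xb => //; rewrite mulf_neq0.
  by move: short; clear; lra.
move=> i j ne e; have [ij|ij|/val_inj ij] := ltngtP i j; last by rewrite ij eqxx in ne.
  exact: main.
by have [->|->] := main j i ij (esym e); [right|left].
Qed.

(** * Perturbed solutions *)

Record pert {R : realType} {n : nat} (f g : R -> R) (T : R) (x b : R -> 'rV[R]_n) (d : R)
    (S' : set R) (g' : R -> R) (x' b' : R -> 'rV[R]_n) : Prop := Pert {
  pert_sol : gsol f g' 0 T S' x' b' ;
  pert_force : forall u, `|g' u - g u| <= d ;
  pert_init : forall i, `|x' 0 0 i - x 0 0 i| <= d ;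
  pert_charge : b' 0 = b 0 }.

(** The permutation acts on the reference solution, which is one and the same for all perturbations;
    it is inverted at the end, where the perturbed solution is to be relabelled. *)
Definition near_by {R : realType} {n : nat} (e : R) (q : 'S_n) (x x' : 'rV[R]_n) :=
  forall i, `|x' 0 i - x 0 (q i)| <= e.

Lemma pert_refl {R : realType} {n : nat} {f g : R -> R} {L T : R} {S0 : set R} {x b : R -> 'rV[R]_n}
  (Sy : sys f g L T S0 x b) (d : R) : 0 <= d -> pert f g T x b d S0 g x b.
Proof.
by have [_ _ _ _ G] := Sy; move=> d0; split=> // i; rewrite subrr normr0.
Qed.

(** Half of the initial gap survives a change of [c / 4] in each position, and the distance of [g']
    from [g] enters as the additive error [2 * d]; hence one gap for all small perturbations. *)
Lemma pert_sgap {R : realType} {n : nat} {f g : R -> R} {L T : R} {S0 : set R} {x b : R -> 'rV[R]_n}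
  (Sy : sys f g L T S0 x b) : exists c d0, [/\ 0 < c, 0 < d0 &
  forall d S' g' x' b', d <= d0 -> pert f g T x b d S' g' x' b' ->
    forall t, 0 <= t <= T -> sgap c (x' t) (b' t)].
Proof.
have [F L0 gL T0 G] := Sy.
have Z0 : Zn (x 0, b 0) by apply: (gs_Zn G); rewrite lexx ltW.
have [c c0 sg] := sgap_exists Z0.
have c20 : 0 < c / 2 by lra.
have gr := gap_rate_gt0 L 0 T c20.
exists (gap_rate L (c / 2) 0 T), (Num.min (c / 4) (gap_rate L (c / 2) 0 T / 4)); split=> //.
  by rewrite lt_min !divr_gt0.
move=> d S' g' x' b'; rewrite le_min => /andP[d1 d2] [G' gd xd bd].
apply: (gs_sgap (e := 2 * d) F G' L0 c20).
- move=> u v; have -> : g' u - g' v = (g' u - g u) - (g' v - g v) + (g u - g v) by ring.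
  apply: (le_trans (ler_normD _ _)).
  have := ler_normB (g' u - g u) (g' v - g v); have := gd u; have := gd v; have := gL u v; clear; lra.
- by move: d2 gr; clear; lra.
- rewrite bd; apply: sgap_le (sgap_perturb sg xd) _; move: d1 c0; clear; lra.
Qed.

Definition spaced {R : realType} {n : nat} (e : R) (B x : 'rV[R]_n) :=
  forall i j : 'I_n, (i < j)%N -> B 0 i * B 0 j != 0 -> e <= x 0 j - x 0 i.

(** Each of the finitely many distances attains a positive minimum on the compact time interval. *)
Lemma pairs_spaced {R : realType} {n : nat} (B : 'rV[R]_n) (t0 t : R) (x : R -> 'rV[R]_n) : t0 <= t ->
  (forall i, cts t0 t (fun s => x s 0 i)) ->
  (forall s (i j : 'I_n), t0 <= s <= t -> (i < j)%N -> B 0 i * B 0 j != 0 -> x s 0 i < x s 0 j) ->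
  exists2 e, 0 < e & forall s, t0 <= s <= t -> spaced e B (x s).
Proof.
move=> t0t xc ord.
have K (p : 'I_n * 'I_n) : exists m, 0 < m /\ forall s, t0 <= s <= t -> (p.1 < p.2)%N ->
    B 0 p.1 * B 0 p.2 != 0 -> m <= x s 0 p.2 - x s 0 p.1.
  have [ij|ij] := ltnP p.1 p.2; last by exists 1.
  have [bij|bij] := eqVneq (B 0 p.1 * B 0 p.2) 0; first by exists 1.
  have cD : cts t0 t (fun u => x u 0 p.2 - x u 0 p.1) by exact: cts_sub2.
  have [v vt Hv] := EVT_min t0t ((ctsP _ _ _).2 cD).
  rewrite in_itv/= in vt; exists (x v 0 p.2 - x v 0 p.1); split; first by rewrite subr_gt0 ord.
  by move=> u ut _ _; apply: Hv; rewrite in_itv.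
have [m Hm] := choice K.
exists (\big[Num.min/1]_p m p).
  by elim/big_ind: _ => // [y z y0 z0|p _]; [rewrite lt_min y0|have [] := Hm p].
move=> s st i j ij bij; have [_ H] := Hm (i, j); apply: le_trans (H s st ij bij).
exact: bigmin_le_cond.
Qed.

Lemma ref_sep {R : realType} {n : nat} {f g : R -> R} {L T : R} {S0 : set R} {x b : R -> 'rV[R]_n}
  (Sy : sys f g L T S0 x b) (t0 t1 : R) : 0 <= t0 -> t0 <= t1 -> t1 <= T ->
  (forall u, t0 <= u <= t1 -> b u = b t0) ->
  exists2 m, 0 < m & forall u i k, t0 <= u <= t1 -> i != k -> b t0 0 i != 0 -> b t0 0 k != 0 ->
    4 * m <= `|x u 0 i - x u 0 k|.
Proof.
have [F L0 gL T0 G] := Sy; move=> h0 h1 h2 bE.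
have [e e0 sp] : exists2 e, 0 < e & forall u, t0 <= u <= t1 -> spaced e (b t0) (x u).
  apply: pairs_spaced => // [i|u i j ut ij bij]; first exact: cts_sub (gs_cts G i) h0 h2.
  have uT : 0 <= u <= T by move: ut h0 h2; clear; lra.
  by have [/= _ xb] := gs_Zn G uT; apply: xb => //; rewrite bE.
exists (e / 4); first by rewrite divr_gt0.
move=> u i k ut ne bi bk; have -> : 4 * (e / 4) = e by field.
have [ik|ik|/val_inj ik] := ltngtP i k; last by rewrite ik eqxx in ne.
  by rewrite distrC ler_normr sp// mulf_neq0.
by rewrite ler_normr sp// mulf_neq0.
Qed.

(** The reference relabelled by [q] need not respect the order of the indices, hence need not be a
    solution; [compare_trajectory] therefore treats it as a curve with prescribed derivative. *)
Lemma frozen_stability {R : realType} {n : nat} {f g : R -> R} {L T : R} {S0 : set R} {x b : R -> 'rV[R]_n}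
  (Sy : sys f g L T S0 x b) (t0 t1 e : R) : 0 <= t0 -> t0 <= t1 -> t1 <= T ->
  (forall u, t0 <= u <= t1 -> b u = b t0) -> 0 < e ->
  exists2 rho, 0 < rho & forall d S' g' x' b' s q, d <= rho -> pert f g T x b d S' g' x' b' ->
    t0 <= s <= t1 -> near_by rho q (x s) (x' s) -> b' s = relabel q (b s) ->
    forall u, s <= u <= t1 -> near_by e q (x u) (x' u) /\ b' u = relabel q (b u).
Proof.
have [F L0 gL T0 G] := Sy; move=> h0 h1 h2 bE e0.
have [m m0 sep] := ref_sep Sy h0 h1 h2 bE.
set K := - (2 * (- derive1 f m) + L) - 3.
have f'0 : 0 <= - derive1 f m by rewrite oppr_ge0; exact: force_drv_le0.
have K1 : 0 <= - (K + 1) by rewrite /K; move: f'0 L0; clear; lra.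
pose E := expR (- (K + 1) * (t1 - t0)).
have E0 : 0 < E by exact: expR_gt0.
have En : E != 0 by rewrite gt_eqF.
(* The Gronwall factor over the whole interval is divided out in advance. *)
pose rho := Num.min (m / 4) e / E.
have mn : 0 < Num.min (m / 4) e by rewrite lt_min e0 divr_gt0.
have rho0 : 0 < rho by exact: divr_gt0.
have grow s u : t0 <= s -> s <= u -> u <= t1 -> gap_rate K rho s u <= Num.min (m / 4) e.
  move=> ts su ut; rewrite /gap_rate -[leRHS](divfK En) -/rho.
  apply: ler_wpM2l; first exact: ltW.
  by rewrite ler_expR; apply: ler_wpM2l => //; move: ts su ut; clear; lra.
exists rho => // d S' g' x' b' s q dr [G' gd xd bd] /andP[s0 s1] near bs.
have s00 : 0 <= s by exact: le_trans s0.
have bst : b s = b t0 by apply: bE; rewrite s0.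
have Bc : charges (relabel q (b s)).
  by move=> i; rewrite mxE; apply: (gs_charges G); rewrite s00 (le_trans s1).
have main := @compare_trajectory R n f g g' x' (fun t => relabel q (x t)) b' (relabel q (b s))
  S0 (S' `&` `]s, t1]) m L d rho s t1 F Bc m0 L0 gL gd (gs_restrict G' s00 h2) (gs_fin G).
have {}main : forall t : R, s <= t <= t1 ->
   (forall i : 'I_n, `|x' t 0 i - relabel q (x t) 0 i| <= gap_rate K rho s t) /\ b' t = relabel q (b s).
  apply: main => //.
  - move=> i; apply: cts_ext (cts_sub (gs_cts G (q i)) s00 h2) => t _; by rewrite mxE.
  - move=> t i ts nS; rewrite (_ : (fun s => _) = fun s => x s 0 (q i)); last by apply/funext => v; rewrite mxE.
    have <- : relabel q (b t) = relabel q (b s).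
      by rewrite bst bE//; move: ts s0; clear; lra.
    by rewrite velocity_relabel; apply: (gs_ode G) => //; move: ts s00 h2; clear; lra.
  - move=> t i k ts ne; rewrite !mxE bst => bi bk; apply: sep => //; last by rewrite (inj_eq perm_inj).
    by move: ts s0; clear; lra.
  - by apply: (le_trans (grow s t1 s0 s1 (lexx _))); rewrite ge_min lexx.
  - by move=> i; rewrite mxE; exact: near.
move=> u us; have [H1 H2] := main u us; split.
  move=> i; have := H1 i; rewrite mxE => h; apply: (le_trans h).
  have /andP[su ut] := us.
  by apply: (le_trans (grow s u s0 su ut)); rewrite ge_min lexx orbT.
by rewrite H2 bst bE//; move: us s0; clear; lra.
Qed.

(** Collects constants for the hull estimate that serve all small perturbations at once: the bound
    [G0] on [g'] near the positions at [tau] combines the bound on [g] along the solution, its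
    Lipschitz constant and the distance of the forces. *)
Lemma hull_uniform {R : realType} {n : nat} {f g : R -> R} {L T : R} {S0 : set R} {x b : R -> 'rV[R]_n}
  (Sy : sys f g L T S0 x b) (tau : R) : 0 < tau <= T -> exists c gam G0 d0, [/\ 0 < c, 0 < gam, 0 < d0,
   forall i j, x tau 0 i != x tau 0 j -> 4 * gam <= `|x tau 0 i - x tau 0 j| &
   forall d S' g' x' b', d <= d0 -> pert f g T x b d S' g' x' b' ->
    (forall t, 0 <= t <= T -> sgap c (x' t) (b' t)) /\
    (forall u i, `|u - x tau 0 i| <= gam -> `|g' u| <= G0)].
Proof.
have [F L0 gL T0 G] := Sy; move=> tT.
have [c [d1 [c0 d10 Hc]]] := pert_sgap Sy.
have [gam1 gam10 sep] := sep_exists (x tau).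
have [M M0 HM] := sol_g_bound Sy.
exists c, (gam1 / 4), (M + L * (gam1 / 4) + 1), (Num.min d1 1).
split=> //; [by rewrite divr_gt0|by rewrite lt_min d10 ltr01|by move=> i j ne; have := sep i j ne; clear; lra|].
move=> d S' g' x' b'; rewrite le_min => /andP[dd1 dd2] P; split; first exact: (Hc d S' g' x' b').
move=> u i ui; have tT' : 0 <= tau <= T by move: tT; clear; lra.
have [_ gi] := HM tau i tT'.
have -> : g' u = (g' u - g u) + (g u - g (x tau 0 i)) + g (x tau 0 i) by ring.
apply: (le_trans (ler_normD _ _)); have := ler_normD (g' u - g u) (g u - g (x tau 0 i)).
have := pert_force P u; have := gL u (x tau 0 i).
have : L * `|u - x tau 0 i| <= L * (gam1 / 4) by exact: ler_wpM2l.
by move: gi dd2; clear; lra.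
Qed.

(** The divergence of [u * f' u] gives the second entry directly and the first one through
    [force_half], evaluated at [2 * D]. *)
Lemma singular_pairs {R : realType} (f : R -> R) (B : R) : force f ->
  (u * derive1 f u @[u --> 0^'+] --> -oo) ->
  exists2 r, 0 < r & forall D, 0 < D <= r -> B < Num.min (2 * f D) (- D * derive1 f D).
Proof.
move=> F sing.
have [r r0 Hr] : exists2 r, 0 < r & forall u, 0 < u < r -> B < - (u * derive1 f u).
  have /cvgrNyPlt/(_ (- B))/near_rightP[r r0 Hr] := sing.
  by exists r => // u ur; rewrite ltrNr; exact: Hr.
exists (r / 4); first by rewrite divr_gt0.
move=> D Dr; rewrite lt_min; apply/andP; split.
  have D0 : 0 < D by move: Dr; clear; lra.
  have := force_half F D0; have := Hr (2 * D).
  have -> : 0 < 2 * D < r by move: Dr r0; clear; lra.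
  by move=> /(_ isT); clear; lra.
have := Hr D; have -> : 0 < D < r by move: Dr r0; clear; lra.
by move=> /(_ isT); clear; lra.
Qed.

Lemma relabel_lone {R : realType} {n : nat} (q : 'S_n) (z w : 'rV[R]_n) : lone z w -> lone (relabel q z) (relabel q w).
Proof. by move=> l i k ne; rewrite !mxE => e; apply: l => //; rewrite (inj_eq perm_inj). Qed.

Lemma relabel_sum {R : realType} {n : nat} (q : 'S_n) (z w : 'rV[R]_n) y :
  \sum_(i < n | relabel q z 0 i == y) relabel q w 0 i = \sum_(i < n | z 0 i == y) w 0 i.
Proof.
rewrite [RHS](reindex_inj (@perm_inj _ q)) /=.
by apply: eq_big => [i|i _]; rewrite mxE.
Qed.

Lemma Zn_lone {R : realType} {n : nat} (z w : 'rV[R]_n) : Zn (z, w) -> lone z w.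
Proof.
move=> [/= _ xb] i k ne e.
have [->|bi] := eqVneq (w 0 i) 0; first by left.
have [->|bk] := eqVneq (w 0 k) 0; first by right.
have [ik|ik|/val_inj ik] := ltngtP i k; last by rewrite ik eqxx in ne.
  by have := xb _ _ ik; rewrite mulf_neq0// e ltxx => /(_ isT).
by have := xb _ _ ik; rewrite mulf_neq0// e ltxx => /(_ isT).
Qed.

Lemma collision_window {R : realType} {n : nat} {f g : R -> R} {L T : R} {S0 : set R} {x b : R -> 'rV[R]_n}
  (Sy : sys f g L T S0 x b) (tau tb : R) : 0 <= tau -> (tau < T -> tau < tb) ->
  exists2 w, 0 < w & tau < T -> [/\ tau + w <= tb, tau + w <= T & forall u, tau <= u < tau + w -> b u = b tau].
Proof.
have [F L0 gL T0 G] := Sy; move=> t0 tbH.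
(* For [tau = T] there is no later time, and 1 is a placeholder. *)
have [tT|tT] := ltP tau T; last by exists 1.
have [s [ts sT Hs]] := gs_succ G t0 tT.
exists (Num.min (tb - tau) (s - tau)); first by rewrite lt_min !subr_gt0 tbH.
have h1 : Num.min (tb - tau) (s - tau) <= tb - tau by rewrite ge_min lexx.
have h2 : Num.min (tb - tau) (s - tau) <= s - tau by rewrite ge_min lexx orbT.
move=> _; split; [by move: h1; clear; lra|by move: h2 sT; clear; lra|].
move=> u ut; apply: (gs_constE G t0 sT Hs); move: ut h2; clear; lra.
Qed.

(* The window [t1, t2] is so long that every opposite pair of a collapsing
   cluster annihilates in it, whatever the small perturbation; the net charges
   of the clusters then determine the survivors up to a permutation. *)
Lemma collision_stability {R : realType} {n : nat} {f g : R -> R} {L T : R} {S0 : set R} {x b : R -> 'rV[R]_n}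
  (Sy : sys f g L T S0 x b) (tau eps ta tb : R) :
  (u * derive1 f u @[u --> 0^'+] --> -oo) ->
  0 < tau <= T -> 0 < eps -> 0 <= ta < tau -> (tau < T -> tau < tb) ->
  exists t1 t2 rho, [/\ ta < t1 < tau, tau <= t2 <= T,
    tau < T -> tau < t2 < tb /\ (forall u, tau <= u <= t2 -> b u = b tau), 0 < rho &
    forall d S' g' x' b' q, d <= rho -> pert f g T x b d S' g' x' b' ->
      near_by rho q (x t1) (x' t1) -> b' t1 = relabel q (b t1) ->
      (forall u, t1 <= u <= t2 -> near_by eps q (x u) (x' u)) /\
      (tau < T -> exists q', (forall u, t1 <= u <= t2 -> near_by eps q' (x u) (x' u)) /\
         b' t2 = relabel q' (b t2))].
Proof.
have [F L0 gL T0 G] := Sy; move=> sing tauT eps0 tat tbH.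
have [c [gam [G0' [d0 [c0 gam0 d00 sep Hpert]]]]] := hull_uniform Sy tauT.
pose G0 := `|G0'|; have G00 : 0 <= G0 by exact: normr_ge0.
have {}Hpert d S' g' x' b' : d <= d0 -> pert f g T x b d S' g' x' b' ->
    (forall t, 0 <= t <= T -> sgap c (x' t) (b' t)) /\
    (forall u i, `|u - x tau 0 i| <= gam -> `|g' u| <= G0).
  move=> dd P; have [h1 h2] := Hpert d S' g' x' b' dd P; split=> // u i ui.
  by apply: (le_trans (h2 u i ui)); exact: ler_norm.
have fc0 : 0 <= f c by exact: force_ge0.
have fg0 : 0 <= f gam by exact: force_ge0.
pose C1 := f c + f gam + G0 + 1.
have C10 : 0 < C1 by rewrite /C1; move: fc0 fg0 G00; clear; lra.
(* The window has length at most [3 * l] with [l = eta / Om]. Speed [C1] then moves a cluster by at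
   most [3 * eta / 8], while over the full window a distance closing at speed [Om] loses [3 * eta],
   more than the possible width [2 * eta]. *)
pose Om := 8 * C1; have Om0 : 0 < Om by rewrite /Om; move: C10; clear; lra.
have [r r0 Hr] := singular_pairs (n%:R * (Om + 4 * f gam + 2 * G0)) F sing.
have [w w0 Hw] := collision_window Sy (ltW (andP tauT).1) tbH.
(* The bounds serve, in order: the separation of clusters, the alternation inside them, the accuracy
   [eps], the speed [Om] through [singular_pairs], and a window that ends before [tau + w]. *)
pose eta := Num.min (Num.min (gam / 2) (c / 4)) (Num.min (Num.min (eps / 2) (r / 2)) (w * Om / 4)).
have eta0 : 0 < eta by rewrite /eta !lt_min !divr_gt0 //= mulr_gt0.
have e1 : eta <= gam / 2 by rewrite /eta !ge_min lexx.
have e2 : eta <= c / 4 by rewrite /eta !ge_min lexx ?orbT.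
have e3 : eta <= eps / 2 by rewrite /eta !ge_min lexx ?orbT.
have e4 : eta <= r / 2 by rewrite /eta !ge_min lexx ?orbT.
have e5 : eta <= w * Om / 4 by rewrite /eta !ge_min lexx ?orbT.
pose l := eta / Om; have l0 : 0 < l by exact: divr_gt0.
have lOm : l * Om = eta by rewrite /l divfK // gt_eqF.
have lw : 4 * l <= w by rewrite -(ler_pM2r Om0); move: e5 lOm; clear; lra.
have [p [pt pS pb]] := left_window Sy tauT.
have eta8 : 0 < eta / 8 by exact: divr_gt0.
have [s st Hs] := left_close Sy pt (andP tauT).2 eta8.
pose v := Num.max (Num.max ta p) (Num.max (tau - l) s).
have vt : v < tau.
  by rewrite /v !gt_max; move: tat pt l0 st; clear; move=> /andP[_ ->] /andP[_ ->] l0 /andP[_ ->]; rewrite !andbT /=; lra.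
have v1 : ta <= v by rewrite /v !le_max lexx.
have v2 : p <= v by rewrite /v !le_max lexx ?orbT.
have v3 : tau - l <= v by rewrite /v !le_max lexx ?orbT.
have v4 : s <= v by rewrite /v !le_max lexx ?orbT.
pose t1 := (v + tau) / 2.
have vt1 : v < t1 by rewrite /t1; move: vt; clear; lra.
have t1t : t1 < tau by rewrite /t1; move: vt; clear; lra.
(* If [tau = T] the window is cut at [T], possibly too early for a collapse; only the closeness of
   positions is then claimed. *)
pose t2 := if tau < T then t1 + 3 * l else T.
have t1ta : ta < t1 by exact: le_lt_trans vt1.
have t10 : 0 <= t1 by move: t1ta tat; clear; lra.
have t2l : t2 - t1 <= 3 * l.
  rewrite /t2; case: ltP => [_|Tt]; first by clear; lra.
  by move: v3 vt1 Tt tauT l0; clear; lra.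
have t2c : tau < T -> t2 - t1 = 3 * l by move=> tT; rewrite /t2 tT; clear; lra.
have tt2 : tau <= t2.
  rewrite /t2; case: ltP => _; last by have /andP[] := tauT.
  by move: v3 vt1 l0; clear; lra.
have t2T : t2 <= T.
  rewrite /t2; case: ltP => [tT|//]; have [_ h _] := Hw tT; by move: h lw l0 t1t; clear; lra.
have t2w : tau < T -> t2 < tau + w.
  move=> tT; have := t2c tT; move: lw l0 t1t; clear; lra.
have t12 : t1 <= t2 by move: t1t tt2; clear; lra.
exists t1, t2, (Num.min (eta / 8) d0); split.
- by rewrite t1ta t1t.
- by rewrite tt2 t2T.
- move=> tT; have [h1 h2 h3] := Hw tT; have h4 := t2w tT; split.
    by move: (t2c tT) v3 vt1 l0 h1 h4; clear; lra.
  by move=> u ut; apply: h3; move: ut h4; clear; lra.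
- by rewrite lt_min eta8.
move=> d S' g' x' b' q; rewrite le_min => /andP[dr dd] P.
have [sg' gb'] := Hpert d S' g' x' b' dd P.
have [sg gb] := Hpert 0 S0 g x b (ltW d00) (pert_refl Sy (lexx 0)).
move=> near1 bt1.
(* The particles of [x'] gather around the collision positions of their partners. *)
pose xi := relabel q (x tau).
have xiE i : xi 0 i = x tau 0 (q i) by rewrite mxE.
have xsep i j : xi 0 i != xi 0 j -> 4 * gam <= `|xi 0 i - xi 0 j| by rewrite !xiE; exact: sep.
have short : C1 * (t2 - t1) <= 3 * eta / 8.
  apply: (@le_trans _ _ (C1 * (3 * l))); first by apply: ler_wpM2l => //; exact: ltW.
  by move: lOm; rewrite /Om => <-; clear; lra.
have hull (y : R -> 'rV[R]_n) (c' : R -> 'rV[R]_n) h S (zi : 'rV[R]_n) : gsol f h 0 T S y c' ->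
    (forall t, 0 <= t <= T -> sgap c (y t) (c' t)) ->
    (forall i j, zi 0 i != zi 0 j -> 4 * gam <= `|zi 0 i - zi 0 j|) ->
    (forall u i, `|u - zi 0 i| <= gam -> `|h u| <= G0) ->
    (forall i, `|y t1 0 i - zi 0 i| <= eta / 4) ->
    forall t i, t1 <= t <= t2 -> `|y t 0 i - zi 0 i| <= eta.
  move=> Gy sgy sepz gh y1 t i tt.
  have H := gs_hull F (gs_restrict Gy t10 t2T) t12 c0 gam0 _ sepz gh y1 _ C10.
  have := H _ _ _ t i tt => H'; apply: (le_trans (H' _ _ _)).
  - by move=> u ut; apply: sgy; move: ut t10 t2T; clear; lra.
  - by rewrite /C1; clear; lra.
  - by move: short e1 eta0 gam0; clear; lra.
  have : C1 * (t - t1) <= C1 * (t2 - t1) by apply: ler_wpM2l; [exact: ltW|move: tt; clear; lra].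
  by move: short eta0; clear; lra.
have x1 i : `|x t1 0 i - x tau 0 i| <= eta / 8.
  by apply/ltW/Hs; move: v4 vt1 t1t; clear; lra.
have nx t i : t1 <= t <= t2 -> `|x t 0 i - x tau 0 i| <= eta.
  apply: (hull x b g S0 (x tau)) => // j; apply: (le_trans (x1 j)); by move: eta0; clear; lra.
have x'1 i : `|x' t1 0 i - xi 0 i| <= eta / 4.
  have := near1 i; rewrite le_min => /andP[h _].
  have -> : x' t1 0 i - xi 0 i = (x' t1 0 i - x t1 0 (q i)) + (x t1 0 (q i) - x tau 0 (q i)).
    by rewrite xiE; ring.
  apply: (le_trans (ler_normD _ _)); have := x1 (q i); move: h; clear; lra.
have gbx u i : `|u - xi 0 i| <= gam -> `|g' u| <= G0 by rewrite xiE; exact: gb'.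
have G' := pert_sol P.
have nx' t i : t1 <= t <= t2 -> `|x' t 0 i - xi 0 i| <= eta.
  exact: (hull x' b' g' S' xi).
have close (q' : 'S_n) u : (forall i, x tau 0 (q' i) = xi 0 i) -> t1 <= u <= t2 -> near_by eps q' (x u) (x' u).
  move=> q'E ut i; have := nx' u i ut; have := nx u (q' i) ut; rewrite q'E.
  have -> : x' u 0 i - x u 0 (q' i) = (x' u 0 i - xi 0 i) - (x u 0 (q' i) - xi 0 i) by ring.
  have := ler_normB (x' u 0 i - xi 0 i) (x u 0 (q' i) - xi 0 i).
  by move: e3; clear; lra.
split; first by move=> u; apply: close => i; rewrite xiE.
move=> tT.
have lone2 : lone xi (b' t2).
  have [i0 _|no] := pickP (@predT 'I_n); last by move=> i; have := no i.
  have n0 : 0 < n%:R :> R by have := @ord_ge1 R n i0; clear; lra.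
  apply: (cluster_collapse F (gs_restrict G' t10 t2T) t12 c0 gam0 _ _ Om0 _ xsep nx').
  - by move: e1 gam0; clear; lra.
  - by move: e2 c0; clear; lra.
  - by move=> t tt; apply: sg'; move: tt t10 t2T; clear; lra.
  - move=> t i tt; apply: (gbx _ i); apply: (le_trans (nx' t i tt)); by move: e1 gam0; clear; lra.
  - move=> D /andP[D0 De].
    have Dr : D <= r by move: De e4; clear; lra.
    have := Hr D; rewrite D0 Dr => /(_ isT).
    by rewrite ltr_pdivlMl.
  - by rewrite (t2c tT); move: lOm eta0; clear; lra.
have bT t : t1 <= t <= t2 -> 0 <= t <= T by move: t10 t2T; clear; lra.
have b2 : b t2 = b tau by have [_ _ h] := Hw tT; apply: h; rewrite tt2 t2w.
have tau2 : 0 <= tau <= T by move: tauT; clear; lra.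
have lone1 : lone xi (relabel q (b tau)) by apply/relabel_lone/Zn_lone/(gs_Zn G).
have [q1 q1E] : exists q1 : 'S_n, forall i, xi 0 (q1 i) = xi 0 i /\ b' t2 0 i = relabel q (b tau) 0 (q1 i).
  apply: cluster_perm => //.
  - by move=> i; rewrite mxE; exact: (gs_charges G tau2).
  - by apply: (gs_charges G'); apply: bT; rewrite t12 lexx.
  move=> y; have h : t1 <= t2 <= t2 by rewrite t12 lexx.
  rewrite (cluster_charge (gs_restrict G' t10 t2T) nx' _ y h).
    rewrite bt1 !relabel_sum.
    have [|_ ->//] := gs_jumpE G t10 t1t (andP tauT).2.
    by move=> u ut; apply: pS; move: ut v2 vt1; clear; lra.
  by move=> i j ne; have := xsep i j ne; move: e1 gam0; clear; lra.
(* [q1] permutes particles inside clusters, so composing with it keeps the positions close while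
   correcting the charges. *)
exists (q1 * q)%g; split.
  by move=> u; apply: close => i; rewrite permM -xiE; have [] := q1E i.
by apply/rowP => i; rewrite mxE permM b2; have [_ ->] := q1E i; rewrite mxE.
Qed.

(** [S0] may contain times without collision; there [no_collision_jump] keeps the charges. *)
Lemma charges_const {R : realType} {n : nat} {f g : R -> R} {L T : R} {S0 : set R} {x b : R -> 'rV[R]_n}
  (Sy : sys f g L T S0 x b) (s t : R) : 0 <= s -> s <= t -> t <= T ->
  (forall u, s < u <= t -> ~ collision_times S0 x b u) -> b t = b s.
Proof.
have [F L0 gL T0 G] := Sy; move=> s0 st tT nc.
have Gs := gs_restrict G s0 tT.
have tt : s <= t <= t by rewrite st lexx.
apply: (gs_ind Gs (P := fun t => b t = b s) tt) => // s1 s2 h1 h2 h3 h4 <-.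
have free u : s1 < u < s2 -> ~ S0 u.
  by move=> us Su; apply: (h4 u us); split=> //=; rewrite in_itv /=; move: us h1 h3; clear; lra.
have s10 : 0 <= s1 by exact: le_trans h1.
have s2T : s2 <= T by exact: le_trans tT.
have [S2|nS2] := pselect (S0 s2); last first.
  apply/esym; apply: (gs_const G s10 (ltW h2) s2T) => u us Su.
  by have [e|ne] := eqVneq u s2; [rewrite e in Su|apply: (free u) => //; move: us ne; clear; lra].
have [J1 J2] := gs_jumpE G s10 h2 s2T free.
apply: (no_collision_jump J1 J2) => i k ik bi bk.
apply/eqP => e; apply: (nc s2); first by move: h1 h2 h3; clear; lra.
have bl j := gs_left_lim j G s10 h2 s2T free.
exists (x s2 0 k); split=> //; rewrite (cardsD1 i) (cardsD1 k) !inE /=.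
by rewrite [k == i]eq_sym ik !bl bi bk e eqxx.
Qed.

(** * Induction over the collision times *)

Record breaks {R : realType} {n : nat} (T : R) (b : R -> 'rV[R]_n) (tau : nat -> R) (K : nat) : Prop := Breaks {
  br_0 : tau 0%N = 0 ;
  br_lt : forall k, (k < K)%N -> tau k < tau k.+1 ;
  br_last : tau K <= tau K.+1 ;
  br_T : tau K.+1 = T ;
  br_const : forall k u, (k <= K)%N -> tau k <= u < tau k.+1 -> b u = b (tau k) }.

(** The default [T] of [nth] supplies the time after the last collision. Since [T] may itself be a
    collision time, the last interval can be degenerate, which is why [br_last] is not strict. *)
Lemma collision_seq {R : realType} {n : nat} {f g : R -> R} {L T : R} {S0 : set R} {x b : R -> 'rV[R]_n}
  (Sy : sys f g L T S0 x b) : exists s : seq R, [/\ sorted <%R s, collision_times S0 x b = [set` s] &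
  breaks T b (fun k => nth T (0 :: s) k) (size s)].
Proof.
have [F L0 gL T0 G] := Sy.
have CS : collision_times S0 x b `<=` S0 by move=> u [y []].
have /finite_seqP[l lE] := sub_finite_set CS (gs_fin G).
pose s := sort <=%R (undup l).
have sE : collision_times S0 x b = [set` s].
  by rewrite lE; apply/seteqP; split=> u /=; rewrite mem_sort mem_undup.
have ss : sorted <%R s by rewrite sort_lt_sorted undup_uniq.
have sT u : u \in s -> 0 < u <= T.
  by move=> us; apply: (gs_times G); apply: CS; rewrite sE.
exists s; split=> //.
have s0 : sorted <%R (0 :: s) by rewrite /= path_min_sorted//; apply/allP => u /sT /andP[].
have lt k k' : (k < k')%N -> (k' <= size s)%N -> nth T (0 :: s) k < nth T (0 :: s) k'.
  move=> kk k's; apply: (sorted_ltn_nth lt_trans T s0) => //; rewrite -topredE /=.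
    by rewrite ltnS (leq_trans (ltnW kk)).
have nT : nth T (0 :: s) (size s).+1 = T by rewrite nth_default.
have leT k : (0 < k)%N -> 0 < nth T (0 :: s) k <= T.
  case: k => // k _ /=; have [ks|ks] := ltnP k (size s); first by apply: sT; exact: mem_nth.
  by rewrite nth_default// T0 lexx.
split=> //.
- by move=> k ks; apply: lt.
- by rewrite nT; case: (s) leT => [|z s'] leT; [rewrite /= ltW|have /andP[] := leT (size (z :: s')) isT].
move=> k u ks /andP[ku uk].
have k0 : 0 <= nth T (0 :: s) k by case: k {ks ku uk} => [|k]; [rewrite /= lexx|have /andP[/ltW] := leT k.+1 isT].
apply: (charges_const Sy k0 ku).
  by have /andP[_ h] := leT k.+1 isT; rewrite ltW// (lt_le_trans uk).
move=> v vt; rewrite sE /= => vs.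
have v0 : v \in 0 :: s by rewrite in_cons vs orbT.
pose j := index v (0 :: s).
have js : (j < (size s).+1)%N by rewrite -[(size s).+1]/(size (0 :: s)) index_mem.
have jE : nth T (0 :: s) j = v by rewrite nth_index.
have vk : v < nth T (0 :: s) k.+1 by move: vt uk; clear; lra.
have [jk|jk] := leqP j k.
  have : v <= nth T (0 :: s) k.
    by move: jk; rewrite leq_eqVlt => /orP[/eqP <-|jk]; [rewrite jE|rewrite -jE ltW// lt].
  by move: vt; clear; lra.
have : nth T (0 :: s) k.+1 <= v.
  by move: jk; rewrite leq_eqVlt => /orP[/eqP ->|jk]; [rewrite jE|rewrite -jE ltW// lt].
by move: vk; clear; lra.
Qed.

(** Up to [t2], shortly after the collision time, only positions are compared, because the perturbed
    collision may occur slightly earlier or later; at [t2] the charges match again. The bound [tb]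
    makes [t2] as early as desired. *)
Definition tracked_after {R : realType} {n : nat} (f g : R -> R) (T : R) (x b : R -> 'rV[R]_n) (tau : nat -> R) (k : nat) :=
  forall e tb, 0 < e -> tau k < tb <= tau k.+1 -> exists t2 delta, [/\ tau k <= t2 < tb, 0 < delta &
    forall d S' g' x' b', d <= delta -> pert f g T x b d S' g' x' b' -> exists q,
      (forall u, tau k <= u <= t2 -> near_by e q (x u) (x' u)) /\ b' t2 = relabel q (b t2)].

Definition tracked_inside {R : realType} {n : nat} (f g : R -> R) (T : R) (x b : R -> 'rV[R]_n) (tau : nat -> R) (k : nat) :=
  forall e t0 t1, 0 < e -> tau k < t0 -> t0 <= t1 -> t1 < tau k.+1 -> exists2 delta, 0 < delta &
    forall d S' g' x' b', d <= delta -> pert f g T x b d S' g' x' b' -> exists q,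
      (forall u, tau k <= u <= t1 -> near_by e q (x u) (x' u)) /\
      (forall u, t0 <= u <= t1 -> b' u = relabel q (b u)).

Lemma near_by_le {R : realType} {n : nat} (e e' : R) (q : 'S_n) (x x' : 'rV[R]_n) :
  near_by e q x x' -> e <= e' -> near_by e' q x x'.
Proof. by move=> h ee i; exact: le_trans (h i) ee. Qed.

Lemma br_step {R : realType} {n : nat} (T : R) (b : R -> 'rV[R]_n) (tau : nat -> R) (K k : nat) :
  breaks T b tau K -> (k <= K)%N -> 0 <= tau k /\ tau k.+1 <= T.
Proof.
move=> B kK; have [b0 blt bl bT _] := B.
have step k' : (k' <= K)%N -> tau k' <= tau k'.+1.
  by rewrite leq_eqVlt => /orP[/eqP ->//|h]; apply/ltW/blt.
split.
  elim: k kK => [|k IH] kK; first by rewrite b0.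
  by apply: (le_trans (IH (ltnW kK))); exact/step/ltnW.
rewrite -bT; have {kK} : exists m, (k + m)%N = K by exists (K - k)%N; lia.
move=> [m]; elim: m k => [|m IH] k; first by rewrite addn0 => ->.
move=> kmK; apply: (@le_trans _ _ (tau k.+2)); first by apply: step; lia.
by apply: IH; lia.
Qed.

Lemma tracked_after_inside {R : realType} {n : nat} {f g : R -> R} {L T : R} {S0 : set R} {x b : R -> 'rV[R]_n}
  (Sy : sys f g L T S0 x b) (tau : nat -> R) (K k : nat) : breaks T b tau K -> (k <= K)%N ->
  tracked_after f g T x b tau k -> tracked_inside f g T x b tau k.
Proof.
move=> B kK St e t0 t1 e0 kt0 t01 t1k.
have [k0 kT] := br_step B kK.
have kt1 : tau k <= t1 by move: kt0 t01; clear; lra.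
have bE u : tau k <= u <= t1 -> b u = b (tau k).
  by move=> ut; apply: (br_const B kK); move: ut t1k; clear; lra.
have [rho rho0 A] := frozen_stability Sy k0 kt1 (ltW (lt_le_trans t1k kT)) bE e0.
have e10 : 0 < Num.min e rho by rewrite lt_min e0.
have [|t2 [delta [t2k delta0 H]]] := St (Num.min e rho) t0 e10; first by move: kt0 t01 t1k; clear; lra.
have e1e : Num.min e rho <= e by rewrite ge_min lexx.
have e1r : Num.min e rho <= rho by rewrite ge_min lexx orbT.
exists (Num.min delta rho); first by rewrite lt_min delta0.
move=> d S' g' x' b'; rewrite le_min => /andP[dd dr] P.
have [q [Hq bq]] := H d S' g' x' b' dd P.
exists q; have A' := A d S' g' x' b' t2 q dr P.
have {}A' : forall u : R, t2 <= u <= t1 -> near_by e q (x u) (x' u) /\ b' u = relabel q (b u).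
  apply: A' => //; first by move: t2k t01; clear; lra.
  by apply: near_by_le (Hq t2 _) e1r; move: t2k; clear; lra.
split.
  move=> u ut; have [ut2|ut2] := leP u t2.
    by apply: near_by_le (Hq u _) e1e; move: ut ut2; clear; lra.
  by have [|] := A' u; first by move: ut ut2; clear; lra.
by move=> u ut; have [|] := A' u; first by move: ut t2k; clear; lra.
Qed.

Lemma tracked_inside_after {R : realType} {n : nat} {f g : R -> R} {L T : R} {S0 : set R} {x b : R -> 'rV[R]_n}
  (Sy : sys f g L T S0 x b) (tau : nat -> R) (K k : nat) :
  (u * derive1 f u @[u --> 0^'+] --> -oo) -> breaks T b tau K -> (k < K)%N -> tau k.+1 < T ->
  tracked_inside f g T x b tau k -> tracked_after f g T x b tau k.+1.
Proof.
move=> sing B kK kT Re e tb e0 ktb.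
have [k0 _] := br_step B (ltnW kK); have kk := br_lt B kK.
have h1 : 0 < tau k.+1 <= T by move: k0 kk kT; clear; lra.
have h2 : 0 <= tau k < tau k.+1 by rewrite k0.
have h3 : tau k.+1 < T -> tau k.+1 < tb by move: ktb; clear; lra.
have [t1 [t2 [rho [t1k t2k t2b rho0 H]]]] := collision_stability Sy sing h1 e0 h2 h3.
have /andP[l1 l2] := t1k.
have [delta delta0 H1] := Re rho t1 t1 rho0 l1 (lexx _) l2.
have [t2b' _] := t2b kT.
exists t2, (Num.min delta rho); split; [by move: t2b'; clear; lra|by rewrite lt_min delta0|].
move=> d S' g' x' b'; rewrite le_min => /andP[dd dr] P.
have [q [Hq bq]] := H1 d S' g' x' b' dd P.
have [|//|_ /(_ kT) [q' [Hq' bq']]] := H d S' g' x' b' q dr P _ (bq t1 _); last 2 first.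
- by rewrite lexx.
- by exists q'; split=> // u ut; apply: Hq'; move: ut l2; clear; lra.
by apply: Hq; rewrite lexx ltW.
Qed.

(** The two tracking statements alternate: frozen charges carry the comparison through an open
    interval, [collision_stability] across its end. At time 0 the identity permutation starts the
    induction. *)
Lemma tracked {R : realType} {n : nat} {f g : R -> R} {L T : R} {S0 : set R} {x b : R -> 'rV[R]_n}
  (Sy : sys f g L T S0 x b) (tau : nat -> R) (K k : nat) :
  (u * derive1 f u @[u --> 0^'+] --> -oo) -> breaks T b tau K -> (k <= K)%N -> tau k < tau k.+1 ->
  tracked_inside f g T x b tau k.
Proof.
move=> sing B; elim: k => [|k IH] kK kk.
  apply: (tracked_after_inside Sy B kK) => e tb e0 tbk; exists 0, e; rewrite (br_0 B) in tbk *.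
  split=> //; first by move: tbk; clear; lra.
  move=> d S' g' x' b' de [G' gd xd bd]; exists 1%g; split.
    move=> u ut; have -> : u = 0 by move: ut; clear; lra.
    by move=> i; rewrite perm1; exact: le_trans (xd i) de.
  by rewrite bd; apply/rowP => i; rewrite mxE perm1.
have [_ kT] := br_step B kK.
apply: (tracked_after_inside Sy B kK); apply: (tracked_inside_after Sy sing B kK); first exact: lt_le_trans kT.
by apply: IH; [exact: ltnW|exact: (br_lt B)].
Qed.

(** The right end of the interval is reached by [collision_stability] at [tau k.+1], whose first
    conclusion keeps the permutation. *)
Lemma stability {R : realType} {n : nat} {f g : R -> R} {L T : R} {S0 : set R} {x b : R -> 'rV[R]_n}
  (Sy : sys f g L T S0 x b) (tau : nat -> R) (K k : nat) (e t0 t1 : R) :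
  (u * derive1 f u @[u --> 0^'+] --> -oo) -> breaks T b tau K -> (k <= K)%N -> 0 < e -> tau k < t0 -> t1 < tau k.+1 ->
  exists2 delta, 0 < delta & forall d S' g' x' b', d <= delta -> pert f g T x b d S' g' x' b' -> exists q,
    (forall u, tau k <= u <= tau k.+1 -> near_by e q (x u) (x' u)) /\
    (forall u, t0 <= u <= t1 -> b' u = relabel q (b u)).
Proof.
have [F L0 gL T0 G] := Sy.
move=> sing B; wlog kk : k t0 t1 / tau k < tau k.+1.
  (* A degenerate interval is the point [T], which is the right end of the preceding interval. *)
  move=> W kK e0 kt0 t1k; have [kk|kk] := ltP (tau k) (tau k.+1); first exact: W.
  have kE : k = K.
    by apply/eqP; rewrite eqn_leq kK leqNgt; apply/negP => /(br_lt B); rewrite ltNge kk.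
  have kT : tau k = T.
    have := br_last B; have := br_T B; rewrite -kE => kT1 h; move: kT1 h kk; clear; lra.
  have [k0|k0] := eqVneq k 0%N.
    by move: T0; rewrite -kT k0 (br_0 B) ltxx.
  have {k0} [k' kS] : exists k', k = k'.+1 by exists k.-1; rewrite prednK// lt0n.
  have k'K : (k' < K)%N by rewrite -kS kE.
  have k'k := br_lt B k'K.
  pose m := (tau k' + tau k'.+1) / 2.
  have [||delta delta0 H] := W k' m m k'k (ltnW k'K) e0; rewrite ?/m; try by move: k'k; clear; lra.
  exists delta => // d S' g' x' b' dd P; have [q [Hq _]] := H d S' g' x' b' dd P; exists q; split.
    move=> u ut; apply: Hq; rewrite -kS; move: ut kk k'k; rewrite -kS; clear; lra.
  by move=> u ut; exfalso; move: ut kt0 t1k kk; clear; lra.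
move=> kK e0; wlog t01 : t0 t1 / t0 <= t1.
  (* When no time lies between [t0] and [t1], the midpoint takes the place of both. *)
  move=> W kt0 t1k; have [t01|t10] := leP t0 t1; first exact: W.
  pose m := (tau k + tau k.+1) / 2.
  have [||delta delta0 H] := W m m (lexx _); rewrite ?/m; try by move: kk; clear; lra.
  exists delta => // d S' g' x' b' dd P; have [q [Hq _]] := H d S' g' x' b' dd P; exists q; split=> //.
  by move=> u ut; exfalso; move: ut t10; clear; lra.
move=> kt0 t1k.
have [k0 kT] := br_step B kK.
have h1 : 0 < tau k.+1 <= T by move: k0 kk kT; clear; lra.
have h2 : 0 <= t1 < tau k.+1 by move: k0 kt0 t01 t1k; clear; lra.
have h3 : tau k.+1 < T -> tau k.+1 < T by [].
have [s1 [s2 [rho [s1k s2k _ rho0 H]]]] := collision_stability Sy sing h1 e0 h2 h3.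
have /andP[l1 l2] := s1k.
have Re := tracked Sy sing B kK kk.
have e10 : 0 < Num.min e rho by rewrite lt_min e0.
have e1e : Num.min e rho <= e by rewrite ge_min lexx.
have e1r : Num.min e rho <= rho by rewrite ge_min lexx orbT.
have t0s : t0 <= s1 by move: t01 l1; clear; lra.
have [delta delta0 H1] := Re (Num.min e rho) t0 s1 e10 kt0 t0s l2.
exists (Num.min delta rho); first by rewrite lt_min delta0.
move=> d S' g' x' b'; rewrite le_min => /andP[dd dr] P.
have [q [Hq bq]] := H1 d S' g' x' b' dd P.
have [||Hs _] := H d S' g' x' b' q dr P.
- by apply: near_by_le (Hq s1 _) e1r; move: kt0 t0s; clear; lra.
- by apply: bq; rewrite lexx t0s.
exists q; split.
  move=> u ut; have [us|us] := leP u s1.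
    by apply: near_by_le (Hq u _) e1e; move: ut us; clear; lra.
  by apply: Hs; move: ut us s2k; clear; lra.
by move=> u ut; apply: bq; move: ut l1; clear; lra.
Qed.

(** If every [q] failed at some attainable level [m q], then at the largest of these levels some
    [q'] succeeds, hence by monotonicity also at [m q'], a contradiction. *)
Lemma diagonal_choice (I : finType) (P : nat -> I -> Prop) (i0 : I) :
  (forall m m' q, (m <= m')%N -> P m' q -> P m q) ->
  exists q, forall m, (exists q', P m q') -> P m q.
Proof.
move=> mono; apply: contrapT => no.
have K q : exists m, (exists q', P m q') /\ ~ P m q.
  apply: contrapT => h; apply: no; exists q => m ex.
  by apply: contrapT => np; apply: h; exists m.
have [m Hm] := choice K.
have [i _ iE] : {i : I | true & \max_(q : I) m q = m i}.
  by apply: eq_bigmax_cond; apply/card_gt0P; exists i0.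
have [[q' Pq'] _] := Hm i; have [_ nP] := Hm q'; apply: nP.
by apply: mono Pq'; rewrite -iE; exact: leq_bigmax.
Qed.

Lemma uniform_mx_cvg {R : realType} {n : nat} (A : set R) (h : R -> R -> 'rV[R]_n) (x : R -> 'rV[R]_n) :
  (forall e, 0 < e -> \forall sigma \near (0 : R)^', forall u i, A u -> `|h sigma u 0 i - x u 0 i| < e) ->
  {uniform A, h @ 0^' --> x}.
Proof.
move=> H P /uniform_nbhs[E [entE sub]].
rewrite -entourage_ballE in entE; case: entE => e /= e0 He.
have Ne := H e e0; rewrite /nbhs /=; apply: filterS Ne => sigma Hs.
apply: sub => u Au; apply: He => /=; split=> // i j.
by rewrite ord1 /ball /= distrC; exact: Hs.
Qed.

(** One [e] bounds both the distance of positions and the margin at the two ends for the charges, so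
    that the relation is monotone in a single accuracy, as [diagonal_choice] requires. *)
Definition matches {R : realType} {n : nat} (x b x' b' : R -> 'rV[R]_n) (t t' e : R) (q : 'S_n) :=
  (forall u, t <= u <= t' -> near_by e q (x u) (x' u)) /\
  (forall u, t + e <= u <= t' - e -> b' u = relabel q (b u)).

Lemma matches_le {R : realType} {n : nat} (x b x' b' : R -> 'rV[R]_n) (t t' e e' : R) (q : 'S_n) :
  e <= e' -> matches x b x' b' t t' e q -> matches x b x' b' t t' e' q.
Proof.
move=> ee [H1 H2]; split; first by move=> u ut; exact: near_by_le (H1 u ut) ee.
by move=> u ut; apply: H2; move: ut ee; clear; lra.
Qed.

Lemma matches_charge {R : realType} {n : nat} (x b x' b' : R -> 'rV[R]_n) (t t' e u : R) (q : 'S_n) :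
  matches x b x' b' t t' e q -> e < u - t -> e < t' - u -> b' u = relabel q (b u).
Proof. by move=> [_ H] h1 h2; apply: H; move: h1 h2; clear; lra. Qed.

Lemma matches_best {R : realType} {n : nat} (x b x' b' : R -> 'rV[R]_n) (t t' : R) :
  exists q : 'S_n, forall m : nat, (exists q', matches x b x' b' t t' (m.+1%:R)^-1 q') ->
    matches x b x' b' t t' (m.+1%:R)^-1 q.
Proof.
apply: (diagonal_choice (P := fun m => matches x b x' b' t t' (m.+1%:R)^-1) 1%g) => m m' q mm.
by apply: matches_le; rewrite lef_pV2 ?posrE ?ltr0n// ler_nat.
Qed.

Lemma stable_matches {R : realType} {n : nat} {f g : R -> R} {L T : R} {S0 : set R} {x b : R -> 'rV[R]_n}
  (Sy : sys f g L T S0 x b) (tau : nat -> R) (K k : nat) (e : R) :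
  (u * derive1 f u @[u --> 0^'+] --> -oo) -> breaks T b tau K -> (k <= K)%N -> 0 < e ->
  exists2 delta, 0 < delta & forall d S' g' x' b', d <= delta -> pert f g T x b d S' g' x' b' ->
    exists q, matches x b x' b' (tau k) (tau k.+1) e q.
Proof.
move=> sing B kK e0; apply: (stability Sy sing B kK e0); by move: e0; clear; lra.
Qed.

Lemma br_mono {R : realType} {n : nat} (T : R) (b : R -> 'rV[R]_n) (tau : nat -> R) (K : nat) j :
  breaks T b tau K -> (j <= K)%N -> tau j <= tau K.
Proof.
move=> B jK; have {jK} : exists m, (j + m)%N = K by exists (K - j)%N; lia.
move=> [m]; elim: m j => [|m IH] j; first by rewrite addn0 => ->.
move=> jmK; apply: (@le_trans _ _ (tau j.+1)); first by apply/ltW/(br_lt B); lia.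
by apply: IH; lia.
Qed.

Lemma relabelK {R : realType} {n : nat} (q : 'S_n) (v : 'rV[R]_n) : relabel q^-1%g (relabel q v) = v.
Proof. by apply/rowP => i; rewrite !mxE permKV. Qed.

Lemma inv_nat_small {R : realType} (e : R) : 0 < e -> exists m : nat, (m.+1%:R)^-1 < e.
Proof.
move=> e0; have V0 : 0 <= e^-1 by rewrite invr_ge0 ltW.
have hm := archi_boundP V0; set m := Num.bound _ in hm.
exists m; rewrite invf_plt ?posrE ?ltr0n//; apply: (lt_trans hm); by rewrite ltr_nat.
Qed.

Lemma sup_norm_bound {R : realType} (h : R -> R -> R) : sup_norm (h sigma) @[sigma --> (0 : R)^'] --> 0%E ->
  forall d, 0 < d -> \forall sigma \near (0 : R)^', forall u, `|h sigma u| <= d.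
Proof.
move=> H d d0.
have : \forall sigma \near (0 : R)^', (sup_norm (h sigma) < d%:E)%E.
  have dE : (0%E < d%:E :> \bar R)%E by rewrite lte_fin.
  exact: (H [set y | (y < d%:E)%E] (open_ereal_lt' dE)).
apply: filterS => sigma sd u.
rewrite -lee_fin; apply: le_trans (ltW sd); by apply: ereal_sup_ubound; exists u.
Qed.

Lemma mx_cvg_bound {R : realType} {n : nat} (h : R -> 'rV[R]_n) (v : 'rV[R]_n) : h sigma @[sigma --> (0 : R)^'] --> v ->
  forall d, 0 < d -> \forall sigma \near (0 : R)^', forall i, `|h sigma 0 i - v 0 i| <= d.
Proof.
move=> /cvgrPdist_le H d d0; apply: filterS (H d d0) => sigma /(mx_norm_leP _ (ltW d0)) K i.
by have := K i; rewrite !mxE distrC.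
Qed.

Lemma sol_stability {R : realType} {n : nat} {f g : R -> R} {L T : R} {S0 : set R} {x b : R -> 'rV[R]_n}
  (Sy : sys f g L T S0 x b) (tau : nat -> R) (K k : nat) (gs : R -> R -> R) (x0s : R -> 'rV[R]_n)
  (xs bs : R -> R -> 'rV[R]_n) :
  (u * derive1 f u @[u --> 0^'+] --> -oo) -> breaks T b tau K -> (k <= K)%N ->
  sup_norm (fun u => gs sigma u - g u) @[sigma --> 0^'] --> 0%E ->
  x0s sigma @[sigma --> 0^'] --> x 0 ->
  (forall sigma, sigma != 0 -> is_solution f (gs sigma) T (x0s sigma) (b 0) (xs sigma) (bs sigma)) ->
  exists p : R -> 'S_n,
    {uniform `[tau k, tau k.+1], (fun sigma t => relabel (p sigma) (xs sigma t)) @ 0^' --> x} /\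
    forall t0 t1 : R, tau k < t0 -> t0 <= t1 -> t1 < tau k.+1 ->
      \forall sigma \near 0^', forall t, t0 <= t <= t1 -> relabel (p sigma) (bs sigma t) = b t.
Proof.
move=> sing B kK gsg x0c sols.
pose P sigma m (q : 'S_n) := matches x b (xs sigma) (bs sigma) (tau k) (tau k.+1) (m.+1%:R)^-1 q.
(* One permutation per [sigma], the best for all accuracies at once. *)
have [q Hq] := choice (fun sigma => matches_best x b (xs sigma) (bs sigma) (tau k) (tau k.+1)).
have near m : \forall sigma \near 0^', P sigma m (q sigma).
  have m0 : 0 < (m.+1%:R)^-1 :> R by rewrite invr_gt0 ltr0n.
  have [delta delta0 H] := stable_matches Sy sing B kK m0.
  have N0 : \forall sigma \near (0 : R)^', sigma != 0 by exact: nbhs_dnbhs_neq.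
  have N1 := sup_norm_bound gsg delta0.
  have N2 := mx_cvg_bound x0c delta0.
  near=> sigma; apply: Hq.
  have [|S' SW] := sols sigma; first by near: sigma.
  apply: (H delta S' (gs sigma)); first exact: lexx.
  have [xs0 bs0] := sol_init SW; split=> //.
  - exact: sol_gsol SW.
  - by near: sigma.
  - by rewrite xs0; near: sigma.
exists (fun sigma => (q sigma)^-1%g); split.
  apply: uniform_mx_cvg => e e0; have [m me] := inv_nat_small e0.
  apply: filterS (near m) => sigma [H1 _] u i; rewrite /= in_itv /= => ut.
  apply: le_lt_trans me; have := H1 u ut ((q sigma)^-1%g i); by rewrite mxE permKV.
move=> t0 t1 h0 h01 h1.
have e0 : 0 < Num.min (t0 - tau k) (tau k.+1 - t1) by rewrite lt_min !subr_gt0 h0.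
have [m] := inv_nat_small e0; rewrite lt_min => /andP[me1 me2].
apply: filterS (near m) => sigma H t /andP[tt1 tt2].
rewrite (matches_charge H) ?relabelK//.
  by apply: (lt_le_trans me1); rewrite lerD2r.
by apply: (lt_le_trans me2); rewrite lerD2l lerN2.
Unshelve. all: by end_near.
Qed.

(** * Uniqueness *)

Lemma relabel_final {R : realType} {n : nat} {f g : R -> R} {T : R} {S0 S' : set R} {x b x' b' : R -> 'rV[R]_n}
  (q : 'S_n) (s : R) : gsol f g 0 T S0 x b -> gsol f g 0 T S' x' b' -> 0 <= s < T ->
  (forall u, s < u < T -> b' u = relabel q (b u)) -> x' T = relabel q (x T) ->
  exists q' : 'S_n, x' T = relabel q' (x T) /\ b' T = relabel q' (b T).
Proof.
move=> G G' /andP[s0 sT] bE xE.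
have T0 : 0 < T by exact: le_lt_trans sT.
have [p [p0 pT pS]] := gs_pred G T0 (lexx _).
have [p' [p'0 p'T p'S]] := gs_pred G' T0 (lexx _).
pose v := (Num.max s (Num.max p p') + T) / 2.
have mT : Num.max s (Num.max p p') < T by rewrite !gt_max sT pT p'T.
have m1 : s <= Num.max s (Num.max p p') by rewrite !le_max lexx.
have m2 : p <= Num.max s (Num.max p p') by rewrite !le_max lexx !orbT.
have m3 : p' <= Num.max s (Num.max p p') by rewrite !le_max lexx !orbT.
have vT : v < T by rewrite /v; move: mT; clear; lra.
have sv : s < v by rewrite /v; move: m1 mT; clear; lra.
have pv : p < v by rewrite /v; move: m2 mT; clear; lra.
have p'v : p' < v by rewrite /v; move: m3 mT; clear; lra.
have v0 : 0 <= v by exact: le_trans s0 (ltW sv).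
have TT : 0 <= T <= T by rewrite lexx ltW.
have [|_ J] := gs_jumpE G v0 vT (lexx T); first by move=> u ut; apply: pS; move: ut pv; clear; lra.
have [|_ J'] := gs_jumpE G' v0 vT (lexx T); first by move=> u ut; apply: p'S; move: ut p'v; clear; lra.
(* The net charges at [T] agree in every cluster although different particles may have survived;
   [q1] exchanges only particles at the same position. *)
have [q1 Hq1] : exists q1 : 'S_n, forall i, x' T 0 (q1 i) = x' T 0 i /\ b' T 0 i = relabel q (b T) 0 (q1 i).
  apply: cluster_perm.
  - by move=> i; rewrite mxE; exact: (gs_charges G TT).
  - exact: (gs_charges G' TT).
  - by rewrite xE; apply/relabel_lone/Zn_lone/(gs_Zn G).
  - exact/Zn_lone/(gs_Zn G').
  move=> y; rewrite J' bE ?sv// xE !relabel_sum; exact: J.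
exists (q1 * q)%g; split; apply/rowP => i; rewrite mxE permM; have [h1 h2] := Hq1 i.
  by rewrite -h1 xE mxE.
by rewrite h2 mxE.
Qed.

(** The second solution is a perturbation of size 0, so on each interval one permutation achieves
    every accuracy [1 / m.+1], which means equality. *)
Lemma unique_mod_relabeling {R : realType} {n : nat} {f g : R -> R} {L T : R} {S0 S' : set R} {x b x' b' : R -> 'rV[R]_n}
  (Sy : sys f g L T S0 x b) : (u * derive1 f u @[u --> 0^'+] --> -oo) ->
  gsol f g 0 T S' x' b' -> x' 0 = x 0 -> b' 0 = b 0 ->
  eq_mod_relabeling T (collision_times S0 x b) x b x' b'.
Proof.
move=> sing G' x0 b0; have [F L0 gL T0 G] := Sy.
have P0 : pert f g T x b 0 S' g x' b'.
  by split=> // [u|i]; rewrite ?x0 subrr normr0.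
have [s [ss sE B]] := collision_seq Sy.
set tau := (fun k => nth T (0 :: s) k) in B; set K := size s in B.
have open k : (k <= K)%N -> exists q : 'S_n, (forall u, tau k <= u <= tau k.+1 -> x' u = relabel q (x u)) /\
    (forall u, tau k < u < tau k.+1 -> b' u = relabel q (b u)).
  move=> kK.
  have [q Hq'] := matches_best x b x' b' (tau k) (tau k.+1).
  have Hq m : matches x b x' b' (tau k) (tau k.+1) (m.+1%:R)^-1 q.
    apply: Hq'; have m0 : 0 < (m.+1%:R)^-1 :> R by rewrite invr_gt0 ltr0n.
    have [delta delta0 H] := stable_matches Sy sing B kK m0.
    exact: H (ltW delta0) P0.
  exists q; split.
    move=> u ut; apply/rowP => i; rewrite mxE; apply/eqP; rewrite -subr_eq0 -normr_le0 leNgt; apply/negP => d0.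
    have [m md] := inv_nat_small d0; have [H1 _] := Hq m.
    by have := H1 u ut i; rewrite leNgt md.
  move=> u /andP[u1 u2]; have e0 : 0 < Num.min (u - tau k) (tau k.+1 - u) by rewrite lt_min !subr_gt0 u1.
  have [m] := inv_nat_small e0; rewrite lt_min => /andP[me1 me2].
  exact: matches_charge (Hq m) me1 me2.
(* Right continuity transfers the charges from the open interval to its left end. *)
have right q k : (k <= K)%N -> tau k < tau k.+1 -> (forall u, tau k < u < tau k.+1 -> b' u = relabel q (b u)) ->
    b' (tau k) = relabel q (b (tau k)).
  move=> kK kk bE; have [k0 kT] := br_step B kK.
  have kT' : tau k < T by exact: lt_le_trans kT.
  have [v [kv vT vS]] := gs_succ G' k0 kT'.
  pose u := (tau k + Num.min v (tau k.+1)) / 2.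
  have h : tau k < Num.min v (tau k.+1) by rewrite lt_min kv.
  have h1 : Num.min v (tau k.+1) <= v by rewrite ge_min lexx.
  have h2 : Num.min v (tau k.+1) <= tau k.+1 by rewrite ge_min lexx orbT.
  have uk : tau k < u by rewrite /u; move: h; clear; lra.
  have um : u < Num.min v (tau k.+1) by rewrite /u; move: h; clear; lra.
  rewrite -(@gs_constE _ _ _ _ _ _ _ _ _ G' _ _ u k0 vT vS); last by move: uk um h1; clear; lra.
  rewrite bE; last by move: uk um h2; clear; lra.
  by rewrite (br_const B kK (u := u))//; move: uk um h2; clear; lra.
have main k : exists q : 'S_n, (k <= K)%N -> forall u, tau k <= u <= T -> (k < K)%N ==> (u < tau k.+1) ->
    x' u = relabel q (x u) /\ b' u = relabel q (b u).
  have [kK|kK] := leqP k K; last by exists 1%g.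
  have [q [xq bq]] := open k kK.
  have [kk|kk] := ltP (tau k) (tau k.+1).
    have half u : tau k <= u < tau k.+1 -> x' u = relabel q (x u) /\ b' u = relabel q (b u).
      move=> /andP[u1 u2]; split; first by apply: xq; rewrite u1 ltW.
      move: u1; rewrite le_eqVlt => /orP[/eqP <-|u1]; first exact: right.
      by apply: bq; rewrite u1.
    exists q => _ u /andP[u1 uT] uk; have [u2|u2] := ltP u (tau k.+1); first by apply: half; rewrite u1.
    have {uk} kE : k = K by apply/eqP; rewrite eqn_leq kK leqNgt; apply: contraL uk => h; rewrite h -leNgt.
    have kT : tau k.+1 = T by rewrite kE; exact: br_T B.
    have uE : u = T by move: uT u2; rewrite kT; clear; lra.
    pose v := (tau k + T) / 2.
    have kv : tau k < v by rewrite /v; move: kk; rewrite kT; clear; lra.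
    have vT : v < T by rewrite /v; move: kk; rewrite kT; clear; lra.
    have [k0 _] := br_step B kK.
    have v0 : 0 <= v by exact: le_trans (ltW kv).
    (* Here [T] is not a collision time, so the charges of the reference are frozen up to and
       including [T], and [frozen_stability] reaches [T]. *)
    have bc w : v <= w <= T -> b w = b v.
      move=> /andP[w1 w2]; apply: (charges_const Sy v0 w1 w2) => z zw; rewrite sE /= => zs.
      have iK : ((index z s).+1 <= K)%N by rewrite index_mem.
      have := br_mono B iK; rewrite /tau /= nth_index// -kE; move: kv zw; rewrite /tau; clear; lra.
    have [rho rho0 A] := frozen_stability Sy v0 (ltW vT) (lexx T) bc ltr01.
    split; first by apply: xq; rewrite uE kT lexx ltW// (lt_trans kv).
    have vv : v <= v <= T by rewrite lexx ltW.
    have uv : v <= u <= T by rewrite uE lexx ltW.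
    have vk : tau k <= v <= tau k.+1 by rewrite kT !ltW.
    have nv : near_by rho q (x v) (x' v).
      by move=> i; rewrite xq// mxE subrr normr0 ltW.
    have bv : b' v = relabel q (b v) by apply: bq; rewrite kv kT.
    by have [_ ->] := A 0 S' g x' b' v q (ltW rho0) P0 vv nv bv u uv.
  (* The last interval is the point [T]; the permutation of the preceding interval is corrected by
     [relabel_final]. *)
  have kE : k = K.
    by apply/eqP; rewrite eqn_leq kK leqNgt; apply/negP => /(br_lt B); rewrite ltNge kk.
  have kT : tau k = T.
    have := br_last B; have := br_T B; rewrite -kE => kT1 h; move: kT1 h kk; clear; lra.
  have [k0|k0] := eqVneq k 0%N; first by move: T0; rewrite -kT k0 (br_0 B) ltxx.
  have {k0} [k' kS] : exists k', k = k'.+1 by exists k.-1; rewrite prednK// lt0n.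
  have k'K : (k' < K)%N by rewrite -kS kE.
  have k'k := br_lt B k'K.
  have [q' [xq' bq']] := open k' (ltnW k'K).
  rewrite -kS kT in k'k xq' bq'.
  have [k'0 _] := br_step B (ltnW k'K).
  have [|||q2 [h1 h2]] := relabel_final (q := q') (s := tau k') G G'; rewrite ?k'0//.
    by apply: xq'; rewrite lexx ltW.
  by exists q2 => _ u; rewrite kT => uT _; have -> : u = T by move: uT; clear; lra.
have [q Hq] := choice main.
(* Index of the last break point not after [t]; it changes only at collision times. *)
pose kap t := \max_(k < K.+1 | tau k <= t) k.
exists (q \o kap); split.
  move=> u t u0 ut tT nc; rewrite /= /kap; congr q; apply: eq_bigl => k.
  apply/idP/idP => [h|h]; first exact: le_trans ut.
  have [kz|kz] := eqVneq (k : nat) 0%N; first by rewrite kz (br_0 B).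
  rewrite leNgt; apply/negP => h2; apply: (nc (tau k)); last by rewrite h2 h.
  rewrite sE /= /tau; case: (nat_of_ord k) kz (ltn_ord k) => // m _; rewrite ltnS => mK /=.
  exact: mem_nth.
move=> t /andP[t0 tT].
have [k kt kE] : {k : 'I_K.+1 | tau k <= t & kap t = k}.
  by apply: eq_bigmax_cond; apply/card_gt0P; exists ord0; rewrite unfold_in (br_0 B).
rewrite /= kE; apply: Hq; first by rewrite -ltnS.
  by rewrite kt.
apply/implyP => kK; rewrite ltNge; apply/negP => h.
have : (k.+1 <= kap t)%N.
  have k1 : (k.+1 < K.+1)%N by rewrite ltnS.
  exact: (@leq_bigmax_cond _ (fun k : 'I_K.+1 => tau k <= t) (fun k => nat_of_ord k) (Ordinal k1)).
by rewrite kE ltnn.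
Qed.

(** * Existence *)

Lemma clamp_lip {R : realType} (a b s t : R) :
  `|Num.max a (Num.min s b) - Num.max a (Num.min t b)| <= `|s - t|.
Proof.
have h (u v : R) : u <= v -> `|Num.max a (Num.min u b) - Num.max a (Num.min v b)| <= `|u - v|.
  move=> uv; rewrite !ler_normr !ler_norml; apply/orP; right.
  by case: (leP u b) => h1; case: (leP v b) => h2; try (case: (leP a _) => h3); try (case: (leP a _) => h4);
    lra.
have [st|ts] := leP s t; first exact: h.
by rewrite distrC [leRHS]distrC; apply/h/ltW.
Qed.

(** The function is continued by constants outside [[a, b]] and integrated from [a - 1], so that
    [[a, b]] lies in the interior and the derivative exists up to its ends. *)
Lemma primitive {R : realType} (a b : R) (h : R -> R) : a <= b -> cts a b h ->
  exists H, [/\ cts a b H, H a = 0 & forall t, a < t < b -> is_derive t 1 H (h t)].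
Proof.
move=> ab ch.
pose k s := h (Num.max a (Num.min s b)).
have kE t : a <= t <= b -> k t = h t.
  by move=> /andP[at1 tb]; rewrite /k (min_idPl tb) (max_idPr at1).
have kc t : {for t, continuous k}.
  apply/cvgrPdist_lt => e e0.
  have ct : a <= Num.max a (Num.min t b) <= b by rewrite le_max lexx ge_max ab ge_min lexx orbT.
  have [d d0 Hd] := ch _ ct e e0.
  apply/nbhs_ballP; exists d => // s; rewrite /ball/= => st; rewrite distrC; apply: Hd.
    by rewrite le_max lexx ge_max ab ge_min lexx orbT.
  by apply: le_lt_trans (clamp_lip _ _ _ _) _; rewrite distrC.
have ki : (@lebesgue_measure R).-integrable `[a - 1, b + 1] (EFin \o k).
  by apply: continuous_compact_integrable; [exact: segment_compact|apply: continuous_subspaceT => t; exact: kc].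
pose F x := (\int[@lebesgue_measure R]_(t in [set` `[a - 1, x]]) (k t))%R.
have FD t : a <= t <= b -> is_derive t 1 F (k t).
  move=> tab; have h1 : t < b + 1 by move: tab; clear; lra.
  have h2 : a - 1 < t by move: tab; clear; lra.
  have [D1 D2] := continuous_FTC1_closed h1 ki h2 (kc t).
  by split; [exact: D1|rewrite -D2 derive1E].
exists (fun t => F t - F a); split; [|by rewrite subrr|].
  by apply: (@derive_cts R a b _ k) => t tab; apply: is_derive_subc; exact: FD.
move=> t tab; rewrite -kE; last by move: tab; clear; lra.
by apply: is_derive_subc; apply: FD; move: tab; clear; lra.
Qed.

Lemma gap_rate_ge {R : realType} (L c a t : R) : 0 <= c -> 0 <= - (L + 1) -> a <= t -> c <= gap_rate L c a t.
Proof.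
move=> c0 L0 at1; rewrite /gap_rate ler_peMr//.
have := expR_ge1Dx (- (L + 1) * (t - a)); have : 0 <= - (L + 1) * (t - a) by rewrite mulr_ge0// subr_ge0.
by set e := expR _; clear; lra.
Qed.

(** As the steps halve, the intervals of radius [2 * q k] around [u k] are nested; the limit is the
    supremum of their left ends. *)
Lemma geometric_limit {R : realType} (u q : nat -> R) : (forall k, 0 <= q k) -> (forall k, q k.+1 = q k / 2) ->
  (forall k, `|u k.+1 - u k| <= q k) -> exists l, forall k, `|u k - l| <= 2 * q k.
Proof.
move=> q0 qS du.
pose lo k := u k - 2 * q k; pose up k := u k + 2 * q k.
have loS k : lo k <= lo k.+1.
  by rewrite /lo qS; have := du k; rewrite ler_norml; clear; lra.
have upS k : up k.+1 <= up k.
  by rewrite /up qS; have := du k; rewrite ler_norml; clear; lra.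
have lom k m : lo k <= lo (k + m)%N.
  by elim: m => [|m IH]; rewrite ?addn0// addnS; exact: le_trans (loS _).
have upm k m : up (k + m)%N <= up k.
  by elim: m => [|m IH]; rewrite ?addn0// addnS; exact: le_trans (upS _) IH.
have loup j k : lo j <= up k.
  apply: (le_trans (lom j k)); apply: le_trans (upm k j); rewrite addnC /lo /up.
  by have := q0 (k + j)%N; clear; lra.
have sr : has_sup (range lo).
  by split; [exists (lo 0%N), 0%N|exists (up 0%N) => _ [j _ <-]].
exists (sup (range lo)) => k; rewrite ler_norml; apply/andP; split.
  have : sup (range lo) <= up k by apply: ge_sup => [|_ [j _ <-]//]; exists (lo 0%N), 0%N.
  by rewrite /up; clear; lra.
have : lo k <= sup (range lo) by apply: ub_le_sup; [by case: sr|exists k].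
by rewrite /lo; clear; lra.
Qed.

Definition lip_field {R : realType} {n : nat} (K : R) (F : 'rV[R]_n -> 'I_n -> R) :=
  forall (y z : 'rV[R]_n) (D : R), (forall i, `|y 0 i - z 0 i| <= D) -> forall i, `|F y i - F z i| <= K * D.

Lemma field_cts {R : realType} {n : nat} (F : 'rV[R]_n -> 'I_n -> R) (K a b : R) (x : R -> 'rV[R]_n) :
  0 < K -> lip_field K F ->
  (forall i, cts a b (fun t => x t 0 i)) -> forall i, cts a b (fun t => F (x t) i).
Proof.
move=> K0 FK xc i t tab e e0.
have eK : 0 < e / 2 / K by rewrite !divr_gt0.
have near k : exists d, 0 < d /\ forall s, a <= s <= b -> `|s - t| < d -> `|x s 0 k - x t 0 k| < e / 2 / K.
  by have [d d0 Hd] := xc k t tab _ eK; exists d.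
have [d Hd] := choice near.
exists (\big[Num.min/1]_k d k).
  by elim/big_ind: _ => // [u v u0 v0|k _]; [rewrite lt_min u0|have [] := Hd k].
move=> s sab sd; apply: (@le_lt_trans _ _ (K * (e / 2 / K))).
  apply: FK => k; apply/ltW; have [_] := Hd k; apply=> //; apply: (lt_le_trans sd); exact: bigmin_le_cond.
by rewrite mulrC divfK ?gt_eqF//; move: e0; clear; lra.
Qed.

Lemma half_power_small {R : realType} (M e : R) : 0 <= M -> 0 < e -> exists k : nat, M / 2 ^+ k < e.
Proof.
move=> M0 e0; have V0 : 0 <= M / e by rewrite divr_ge0// ltW.
have := archi_boundP V0; set m := Num.bound _ => hm.
exists m; rewrite ltr_pdivrMr ?exprn_gt0// mulrC -ltr_pdivrMr//; apply: (lt_trans hm).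
by rewrite -natrX ltr_nat ltn_expl.
Qed.

Definition solves {R : realType} {n : nat} (F : 'rV[R]_n -> 'I_n -> R) (a b : R) (x : R -> 'rV[R]_n) :=
  (forall i, cts a b (fun t => x t 0 i)) /\
  (forall t i, a < t < b -> is_derive t 1 (fun s => x s 0 i) (F (x t) i)).

(** Measured against the weight [exp (2 * K * (t - a))], the integral operator contracts by [1 / 2]
    on the whole of [[a, b]], whatever its length. *)
Lemma picard {R : realType} {n : nat} (F : 'rV[R]_n -> 'I_n -> R) (K a b : R) (X0 : 'rV[R]_n) :
  0 < K -> lip_field K F ->
  a <= b -> exists2 x, x a = X0 & solves F a b x.
Proof.
move=> K0 FK ab.
have step (x : R -> 'rV[R]_n) : exists y : R -> 'rV[R]_n, (forall i, cts a b (fun t => x t 0 i)) ->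
    [/\ y a = X0, forall i, cts a b (fun t => y t 0 i) &
      forall t i, a < t < b -> is_derive t 1 (fun s => y s 0 i) (F (x t) i)].
  have [xc|nxc] := pselect (forall i, cts a b (fun t => x t 0 i)); last by exists x.
  have [H HH] := choice (fun i => primitive ab (field_cts K0 FK xc i)).
  exists (fun t => \row_i (X0 0 i + H i t)) => _.
  have E i : (fun t => (\row_i (X0 0 i + H i t)) 0 i) = (fun t => X0 0 i + H i t).
    by apply/funext => t; rewrite mxE.
  split.
  - by apply/rowP => i; rewrite mxE; have [_ -> _] := HH i; rewrite addr0.
  - by move=> i; rewrite E; apply: cts_add; [exact: cts_cst|have [] := HH i].
  - move=> t i tab; rewrite E; have [_ _ /(_ t tab) D] := HH i.
    by have := is_deriveD (is_derive_cst (X0 0 i) t (1 : R)) D; rewrite add0r.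
have [Phi HPhi] := choice step.
pose x k := iter k Phi (fun=> X0).
have xc k i : cts a b (fun t => x k t 0 i).
  elim: k i => [|k IH] i; first exact: cts_cst.
  by have [_ h _] := HPhi (x k) IH.
have xa k : x k a = X0 by case: k => // k; have [] := HPhi (x k) (xc k).
have xD k t i : a < t < b -> is_derive t 1 (fun s => x k.+1 s 0 i) (F (x k t) i).
  by have [_ _] := HPhi (x k) (xc k); apply.
pose M := (\sum_i `|F X0 i|) * (b - a).
have ba0 : 0 <= b - a by rewrite subr_ge0.
have M0 : 0 <= M by rewrite mulr_ge0// sumr_ge0.
have FM i t : a <= t <= b -> `|F X0 i| * (t - a) <= M.
  move=> tab; apply: (@le_trans _ _ (`|F X0 i| * (b - a))).
    by apply: ler_wpM2l => //; move: tab; clear; lra.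
  by apply: ler_wpM2r => //; rewrite (bigD1 i)//= lerDl sumr_ge0.
(* With this parameter [gap_rate] is an exponential of rate [2 * K], so the derivative of [q k.+1]
   is [K * q k], which dominates the difference of two successive fields. *)
pose q k t := gap_rate (- (2 * K) - 1) (M / 2 ^+ k) a t.
have qD k (t : R) : is_derive t 1 (q k) (2 * K * q k t).
  have := is_derive_gap_rate (- (2 * K) - 1) (M / 2 ^+ k) a t.
  by rewrite (_ : - (- (2 * K) - 1 + 1) = 2 * K)//; ring.
have qS k t : q k.+1 t = q k t / 2 by rewrite /q /gap_rate exprS; field.
have q0 k t : 0 <= q k t by rewrite /q /gap_rate mulr_ge0 ?expR_ge0// divr_ge0// exprn_ge0.
have qb k t : a <= t <= b -> q k t <= q k b.
  move=> tab; rewrite /q /gap_rate; apply: ler_wpM2l; first by rewrite divr_ge0// exprn_ge0.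
  rewrite ler_expR; apply: ler_wpM2l; first by move: K0; clear; lra.
  by move: tab; clear; lra.
have qa k : 0 <= q k a by [].
have dx k t i : a <= t <= b -> `|x k.+1 t 0 i - x k t 0 i| <= q k t.
  elim: k t i => [|k IH] t i tab.
    have : `|x 1%N t 0 i - x 1%N a 0 i| <= `|F X0 i| * (t - a).
      have /andP[at1 tb] := tab.
      have H := @MVT_norm R a t (fun t => x 1%N t 0 i) (fun t => F (x 0%N t) i) _ set0 (finite_set0 _) at1.
      apply: H; first exact: cts_sub (xc 1%N i) _ _.
      by move=> u ut _; split; [apply: (xD 0%N); move: tb ut; clear; lra|exact: lexx].
    rewrite xa => h; apply: (le_trans h); apply: (le_trans (FM i t tab)).
    rewrite /q expr0 divr1; apply: gap_rate_ge => //; first by move: K0; clear; lra.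
    by move: tab; clear; lra.
  have main (s : bool) : 0 <= q k.+1 t - (if s then x k.+2 t 0 i - x k.+1 t 0 i else x k.+1 t 0 i - x k.+2 t 0 i).
    have H := @MVT_ge0 R a t (fun t => q k.+1 t - (if s then x k.+2 t 0 i - x k.+1 t 0 i else x k.+1 t 0 i - x k.+2 t 0 i))
      (fun t => 2 * K * q k.+1 t - (if s then F (x k.+1 t) i - F (x k t) i else F (x k t) i - F (x k.+1 t) i))
      set0 (finite_set0 _).
    have /andP[at1 tb] := tab.
    apply: le_trans (H at1 _ _).
    - by rewrite !xa; case: (s); rewrite subrr subr0.
    - apply: cts_sub2; first by apply: (derive_cts (k := fun t => 2 * K * q k.+1 t)) => u _; exact: qD.
      by case: (s); apply: cts_sub2; apply: cts_sub (xc _ i) _ _ => //.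
    - move=> u ut _; have uab : a < u < b by move: ut tb; clear; lra.
      split.
        by case: (s); exact: (is_deriveB (qD k.+1 u) (is_deriveB (xD _ u i uab) (xD _ u i uab))).
      have := FK (x k.+1 u) (x k u) (q k u) _ i.
      have -> : 2 * K * q k.+1 u = K * q k u by rewrite qS; field.
      rewrite ler_norml => /(_ _)/andP[].
        by move=> j; apply: IH; move: uab; clear; lra.
      by case: (s); clear; lra.
  by rewrite ler_norml; have := main true; have := main false; rewrite /=; clear; lra.
have lim (p : R * 'I_n) : exists l, a <= p.1 <= b -> forall k, `|x k p.1 0 p.2 - l| <= 2 * q k p.1.
  have [tab|ntab] := boolP (a <= p.1 <= b); last by exists 0.
  have [l Hl] := geometric_limit (fun k => q0 k p.1) (fun k => qS k p.1) (fun k => dx k p.1 p.2 tab).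
  by exists l.
have [l Hl] := choice lim.
pose y t := \row_i l (t, i).
have yx k t i : a <= t <= b -> `|x k t 0 i - y t 0 i| <= 2 * q k b.
  move=> tab; rewrite mxE; apply: (le_trans (Hl (t, i) tab k)); apply: ler_wpM2l => //; exact: qb.
have small e : 0 < e -> exists k, 2 * q k b < e.
  move=> e0; pose E := expR (- (- (2 * K) - 1 + 1) * (b - a)).
  have E0 : 0 < E by exact: expR_gt0.
  have [|k hk] := half_power_small M0 (e := e / (2 * E)); first by rewrite divr_gt0// mulr_gt0.
  exists k; rewrite /q /gap_rate -/E.
  have -> : 2 * (M / 2 ^+ k * E) = M / 2 ^+ k * (2 * E) by ring.
  by rewrite -ltr_pdivlMr// mulr_gt0.
have yc i : cts a b (fun t => y t 0 i).
  move=> t tab e e0; have e3 : 0 < e / 3 by rewrite divr_gt0.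
  have [k hk] := small _ e3; have [d d0 Hd] := xc k i t tab _ e3.
  exists d => // s sab sd.
  have := Hd s sab sd; have := yx k t i tab; have := yx k s i sab.
  by move: hk; rewrite !ltr_norml !ler_norml; clear; lra.
have [za zc zD] := HPhi y yc.
have zy t : a <= t <= b -> Phi y t = y t.
  move=> tab; apply/rowP => i; apply/eqP; rewrite -subr_eq0 -normr_le0 leNgt; apply/negP => d0.
  pose C := 1 + K * (b - a).
  have C0 : 0 < C by rewrite /C; apply: ltr_pwDl => //; rewrite mulr_ge0// ltW.
  have [k hk] := small _ (divr_gt0 d0 C0).
  have h1 : `|x k.+1 t 0 i - Phi y t 0 i| <= K * (2 * q k b) * (b - a).
    apply: (@le_trans _ _ (K * (2 * q k b) * (t - a))); last first.
      have KQ : 0 <= K * (2 * q k b) by apply: mulr_ge0; [exact: ltW|exact: mulr_ge0].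
      by apply: ler_wpM2l => //; move: tab; clear; lra.
    have /andP[at1 tb] := tab.
    have H := @MVT_norm R a t (fun t => x k.+1 t 0 i - Phi y t 0 i) (fun t => F (x k t) i - F (y t) i)
      (K * (2 * q k b)) set0 (finite_set0 _) at1.
    have {H} := H _ _; rewrite xa za subrr subr0; apply.
      by apply: cts_sub2; [apply: cts_sub (xc _ i) _ _|apply: cts_sub (zc i) _ _].
    move=> u ut _; have uab : a < u < b by move: ut tb; clear; lra.
    split; first by apply: is_deriveB; [exact: xD|exact: zD].
    by apply: FK => j; apply: yx; move: uab; clear; lra.
  have h2 := yx k.+1 t i tab.
  have h3 : 2 * q k.+1 b <= 2 * q k b by rewrite qS; have := q0 k b; clear; lra.
  have h4 : 2 * q k b * C < `|Phi y t 0 i - y t 0 i| by rewrite -ltr_pdivlMr.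
  have h5 : `|Phi y t 0 i - y t 0 i| <= `|x k.+1 t 0 i - Phi y t 0 i| + `|x k.+1 t 0 i - y t 0 i|.
    have -> : Phi y t 0 i - y t 0 i = (x k.+1 t 0 i - y t 0 i) - (x k.+1 t 0 i - Phi y t 0 i) by ring.
    by rewrite [leRHS]addrC; exact: ler_normB.
  by move: h1 h2 h3 h4 h5; rewrite /C; clear; lra.
(* The solution is presented as [Phi y], which carries the derivatives; it agrees with [y] on
   [[a, b]]. *)
exists (Phi y) => //; split=> // t i tab; rewrite zy; first exact: zD.
by move: tab; clear; lra.
Qed.

Lemma solves_unique {R : realType} {n : nat} (F : 'rV[R]_n -> 'I_n -> R) (K a b : R) (x y : R -> 'rV[R]_n) :
  0 < K -> lip_field K F ->
  a <= b -> solves F a b x -> solves F a b y -> x a = y a -> forall t, a <= t <= b -> x t = y t.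
Proof.
move=> K0 FK ab [xc xD] [yc yD] xya.
(* A positive initial gap [rho] makes the barrier strict; a small [rho] then contradicts any
   positive difference. *)
have main rho : 0 < rho -> forall t i, a <= t <= b -> `|x t 0 i - y t 0 i| <= gap_rate (- (K + 1) - 1) rho a t.
  move=> rho0; set th := gap_rate _ _ _.
  have thD (t : R) : is_derive t 1 th ((K + 1) * th t).
    have := is_derive_gap_rate (- (K + 1) - 1) rho a t.
    by rewrite (_ : - (- (K + 1) - 1 + 1) = K + 1)//; ring.
  have th1 t : a <= t -> rho <= th t.
    by move=> at1; apply: gap_rate_ge => //; [exact: ltW|move: K0; clear; lra].
  pose k (p : 'I_n * bool) t := th t - (if p.2 then x t 0 p.1 - y t 0 p.1 else y t 0 p.1 - x t 0 p.1).
  pose dk (p : 'I_n * bool) t := (K + 1) * th t - (if p.2 then F (x t) p.1 - F (y t) p.1 else F (y t) p.1 - F (x t) p.1).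
  have eta0 : 0 < rho / (K + 1) by rewrite divr_gt0//; move: K0; clear; lra.
  have KE : K * (rho / (K + 1)) < rho.
    by rewrite mulrA ltr_pdivrMr; [rewrite mulrDr mulr1 mulrC ltrDl|move: K0; clear; lra].
  have H := @barrier R _ xpredT k dk a b (rho / (K + 1)) set0 (finite_set0 _) ab eta0.
  have {}H : forall t p, a <= t <= b -> true -> 0 <= k p t.
    apply: H.
    - move=> [i s] _; apply: cts_sub2; first by apply: (derive_cts (k := fun t => (K + 1) * th t)) => u _; exact: thD.
      by case: (s); apply: cts_sub2.
    - move=> [i s] _; rewrite /k /= xya; have := th1 a (lexx a); case: (s); rewrite subrr; move: rho0; clear; lra.
    - move=> t [i s] tab _ _ kp kmin; split.
        rewrite /k /dk /=; case: (s) => /=.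
          exact: (is_deriveB (thD t) (is_deriveB (xD t i tab) (yD t i tab))).
        exact: (is_deriveB (thD t) (is_deriveB (yD t i tab) (xD t i tab))).
      have tha : rho <= th t by apply: th1; move: tab; clear; lra.
      have near j : `|x t 0 j - y t 0 j| <= th t + rho / (K + 1).
        have := kmin (j, true) isT; have := kmin (j, false) isT; move: kp.
        rewrite ler_norml /k /=; set kk := th t - (if _ then _ else _); clear; lra.
      have := FK _ _ _ near i; rewrite mulrDr ler_norml /dk /=.
      by case: (s); move: KE tha; clear; lra.
  move=> t i tab; have := H t (i, true) tab isT; have := H t (i, false) tab isT.
  by rewrite ler_norml /k /=; clear; lra.
move=> t tab; apply/rowP => i; apply/eqP; rewrite -subr_eq0 -normr_le0 leNgt; apply/negP => d0.
pose E := expR (- (- (K + 1) - 1 + 1) * (t - a)).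
have E0 : 0 < E by exact: expR_gt0.
have := main _ (divr_gt0 (divr_gt0 d0 E0) (ltr0n _ 2)) t i tab.
rewrite /gap_rate -/E mulrAC divfK ?gt_eqF//; move: d0; clear; lra.
Qed.

Lemma max_lip {R : realType} (e u v : R) : `|Num.max u e - Num.max v e| <= `|u - v|.
Proof.
have := @clamp_lip R e (Num.max u v) u v.
by rewrite !min_l ?le_max ?lexx ?orbT// !(maxC e).
Qed.

Definition cut_force {R : realType} (f : R -> R) (e u : R) := f (Num.max u e).

(* The interaction cut off at distance e; distances are taken with the sign
   that the order of the indices imposes on charged particles. *)
Definition cut_velocity {R : realType} {n : nat} (f g : R -> R) (B : 'rV[R]_n) (e : R) (x : 'rV[R]_n) (i : 'I_n) : R :=
  n%:R^-1 * (\sum_(j < n | j != i) B 0 i * B 0 j *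
    (if (j < i)%N then cut_force f e (x 0 i - x 0 j) else - cut_force f e (x 0 j - x 0 i))) + B 0 i * g (x 0 i).

Lemma cut_velocity_lip {R : realType} {n : nat} (f g : R -> R) (B : 'rV[R]_n) (L e : R) :
  force f -> 0 <= L -> (forall u v, `|g u - g v| <= L * `|u - v|) -> charges B -> 0 < e ->
  lip_field (2 * (- derive1 f e) + L + 1) (cut_velocity f g B e).
Proof.
move=> F L0 gL bc e0 y z D yz i.
have f'0 : 0 <= - derive1 f e by rewrite oppr_ge0; exact: force_drv_le0.
have D0 : 0 <= D by exact: le_trans (yz i).
pose w (x : 'rV[R]_n) (j : 'I_n) := if (j < i)%N then cut_force f e (x 0 i - x 0 j) else - cut_force f e (x 0 j - x 0 i).
have cut u v : `|u - v| <= 2 * D -> `|cut_force f e u - cut_force f e v| <= 2 * - derive1 f e * D.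
  move=> uv; apply: (le_trans (force_lip F e0 _ _)); rewrite ?le_max ?lexx ?orbT//.
  have -> : 2 * - derive1 f e * D = - derive1 f e * (2 * D) by ring.
  by apply: ler_wpM2l => //; exact: le_trans (max_lip _ _ _) uv.
have wd j : `|w y j - w z j| <= 2 * - derive1 f e * D.
  have h : `|(y 0 i - y 0 j) - (z 0 i - z 0 j)| <= 2 * D.
    by have := yz i; have := yz j; rewrite !ler_norml; clear; lra.
  rewrite /w; case: ifP => _; first exact: cut.
  rewrite -opprD normrN; apply: cut.
  by rewrite (_ : _ - _ = - ((y 0 i - y 0 j) - (z 0 i - z 0 j))) ?normrN//; ring.
have -> : cut_velocity f g B e y i - cut_velocity f g B e z i =
    n%:R^-1 * (\sum_(k < n | k != i) B 0 i * B 0 k * (w y k - w z k)) + B 0 i * (g (y 0 i) - g (z 0 i)).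
  rewrite /cut_velocity [X in _ = _ * X + _](_ : _ = \sum_(k < n | k != i) B 0 i * B 0 k * w y k - \sum_(k < n | k != i) B 0 i * B 0 k * w z k).
    by rewrite /w; ring.
  by rewrite -sumrB; apply: eq_bigr => k _; ring.
have Q0 : 0 <= 2 * - derive1 f e * D by rewrite mulr_ge0// mulr_ge0.
have S : `|\sum_(k < n | k != i) B 0 i * B 0 k * (w y k - w z k)| <= n%:R * (2 * - derive1 f e * D).
  apply: sum_norm_le => // k ki; rewrite normrM -[leRHS]mul1r; apply: ler_pM => //.
  by rewrite normrM; apply: mulr_ile1 => //; exact: charge_norm.
apply: (le_trans (ler_normD _ _)).
have h1 : `|n%:R^-1 * \sum_(k < n | k != i) B 0 i * B 0 k * (w y k - w z k)| <= 2 * - derive1 f e * D.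
  by rewrite normrM ger0_norm ?inv_n_ge0//; exact: (inv_n_le i).
have h2 : `|B 0 i * (g (y 0 i) - g (z 0 i))| <= L * D.
  rewrite normrM -[leRHS]mul1r; apply: ler_pM => //; first exact: charge_norm.
  by apply: (le_trans (gL _ _)); apply: ler_wpM2l.
by move: h1 h2 D0; clear; lra.
Qed.

Lemma cut_velocityE {R : realType} {n : nat} (f g : R -> R) (B x : 'rV[R]_n) (e : R) i :
  force f -> spaced e B x -> cut_velocity f g B e x i = velocity f g x B i.
Proof.
move=> F sp; rewrite /cut_velocity /velocity; congr (_ * _ + _); apply: eq_bigr => j ji.
have [->|bij] := eqVneq (B 0 i * B 0 j) 0; first by rewrite !mul0r.
congr (_ * _); rewrite /cut_force; case: ltnP => [h|h].
  by rewrite max_l//; apply: sp => //; rewrite mulrC.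
have ij : (i < j)%N by rewrite ltn_neqAle h andbT eq_sym.
by rewrite max_l ?sp// -(force_N F) opprB.
Qed.

Lemma spaced_Zn {R : realType} {n : nat} (e : R) (B x : 'rV[R]_n) : charges B -> 0 < e -> spaced e B x -> Zn (x, B).
Proof.
move=> bc e0 sp; split=> //= i j ij bij.
by rewrite -subr_gt0; apply: lt_le_trans e0 _; exact: sp.
Qed.

Lemma spaced_le {R : realType} {n : nat} (e e' : R) (B x : 'rV[R]_n) : spaced e B x -> e' <= e -> spaced e' B x.
Proof. by move=> sp h i j ij bij; exact: le_trans h (sp i j ij bij). Qed.

(** * Continuation up to the first collision *)

Lemma bounded_end {R : realType} {n : nat} (f g : R -> R) (L t0 tau c : R) (x : R -> 'rV[R]_n) (B : 'rV[R]_n) :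
  force f -> 0 <= L -> (forall u v, `|g u - g v| <= L * `|u - v|) -> t0 < tau -> 0 < c ->
  (forall t, t0 <= t < tau -> gsol f g t0 t set0 x (fun=> B)) -> (forall t, t0 <= t < tau -> sgap c (x t) B) ->
  exists M s, s < tau /\ forall t i, s <= t < tau -> `|x t 0 i| <= M.
Proof.
move=> F L0 gL t0tau c0 G sg.
(* A window so short that the linear growth of [g] cannot push a particle out of the ball of radius
   [gam]. *)
pose h := (4 * (L + 1))^-1.
have L1 : 0 < L + 1 by move: L0; clear; lra.
have h0 : 0 < h by rewrite invr_gt0 mulr_gt0.
have hL : 4 * (h * L) <= 1 /\ h <= 1.
  have hE : h * (L + 1) = 1 / 4 by rewrite /h; field; rewrite gt_eqF.
  have : 0 <= h * L by rewrite mulr_ge0// ltW.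
  by move: hE h0; rewrite mulrDr mulr1; clear; lra.
pose t1 := (Num.max t0 (tau - h) + tau) / 2.
have m1 : t0 <= Num.max t0 (tau - h) by rewrite le_max lexx.
have m2 : tau - h <= Num.max t0 (tau - h) by rewrite le_max lexx orbT.
have m3 : Num.max t0 (tau - h) < tau by rewrite gt_max t0tau; move: h0; clear; lra.
have t1t : t1 < tau by rewrite /t1; move: m3; clear; lra.
have t10 : t0 <= t1 by rewrite /t1; move: m1 m3; clear; lra.
have t1h : tau - t1 <= h by rewrite /t1; move: m2 m3; clear; lra.
pose rho := \sum_i `|x t1 0 i|.
have rho0 : 0 <= rho by exact: sumr_ge0.
have xr i : `|x t1 0 i| <= rho by rewrite /rho (bigD1 i)//= lerDl sumr_ge0.
pose A := f c + f 1 + `|g 0| + 1.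
have fc : 0 <= f c by exact: force_ge0.
have f1 : 0 <= f 1 by exact: force_ge0.
have g0 : 0 <= `|g 0| by [].
have A1 : 1 <= A by rewrite /A; move: fc f1 g0; clear; lra.
pose gam := 4 * rho + 4 * A + 4.
have gam1 : 1 <= gam by rewrite /gam; move: rho0 A1; clear; lra.
have gam0 : 0 < gam by move: gam1; clear; lra.
pose C := A + L * gam.
have Lg : 0 <= L * gam by rewrite mulr_ge0// ltW.
have C0 : 0 < C by rewrite /C; move: A1 Lg; clear; lra.
have fg : f gam <= f 1 by have [_ H] := force_nincr F; apply: H.
exists gam, t1; split=> // t i /andP[t1t' tt].
have tt0 : t0 <= t < tau by rewrite tt (le_trans t10).
(* All reference points are 0, so there is a single cluster and the hull is confined to a ball
   around the origin. *)
have H := @gs_hull R n f g t1 t _ x (fun=> B) 0 c gam rho (`|g 0| + L * gam) C F (gs_restrict (G t tt0) t10 (lexx t)) t1t' c0 gam0.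
have Ct : C * (t - t1) <= A + gam / 4.
  apply: (@le_trans _ _ (C * h)); first by apply: ler_wpM2l; [exact: ltW|move: tt t1h; clear; lra].
  rewrite /C mulrDl.
  have : A * h <= A * 1 by apply: ler_wpM2l; [move: A1; clear; lra|case: hL].
  have : 4 * (h * L) * gam <= 1 * gam by apply: ler_wpM2r; [exact: ltW|case: hL].
  by rewrite (_ : 4 * (h * L) * gam = 4 * (L * gam * h)); [clear; lra|ring].
have rC : rho + C * (t - t1) < gam by rewrite /gam in Ct *; move: Ct rho0 A1; clear; lra.
have {}H : forall u j, t1 <= u <= t -> `|x u 0 j - (0 : 'rV[R]_n) 0 j| <= rho + C * (u - t1).
  apply: H => //.
  - by move=> u ut; apply: sg; move: ut t10 tt; clear; lra.
  - by move=> j k; rewrite !mxE eqxx.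
  - move=> u j; rewrite mxE subr0 => ug.
    have -> : g u = (g u - g 0) + g 0 by ring.
    apply: (le_trans (ler_normD _ _)); rewrite addrC lerD2l; apply: (le_trans (gL _ _)).
    by rewrite subr0; exact: ler_wpM2l.
  - by move=> j; rewrite mxE subr0.
  - by rewrite /C /A; move: fg; clear; lra.
have := H t i; rewrite mxE subr0 t1t' lexx => /(_ isT) h1; apply: (le_trans h1).
exact: ltW.
Qed.

(** A bounded trajectory has a cluster point [xi] as [t] tends to [tau]. Started at a late time when
    [x] is close to [xi], the hull estimate keeps it close from then on, so [xi] is the limit. *)
Lemma end_limit {R : realType} {n : nat} (f g : R -> R) (L t0 tau c : R) (x : R -> 'rV[R]_n) (B : 'rV[R]_n) :
  force f -> 0 <= L -> (forall u v, `|g u - g v| <= L * `|u - v|) -> t0 < tau -> 0 < c ->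
  (forall t, t0 <= t < tau -> gsol f g t0 t set0 x (fun=> B)) -> (forall t, t0 <= t < tau -> sgap c (x t) B) ->
  exists xi : 'rV[R]_n, forall e, 0 < e -> exists s, s < tau /\ forall t i, s <= t < tau -> `|x t 0 i - xi 0 i| <= e.
Proof.
move=> F L0 gL t0tau c0 G sg.
have [M [s [st Hs]]] := bounded_end F L0 gL t0tau c0 G sg.
have cK : compact [set v : 'rV[R]_n | forall i, `[- M, M]%classic (v ord0 i)].
  by apply: (@rV_compact _ _ (fun=> `[- M, M]%classic)) => i; exact: segment_compact.
pose FF := fmap x (nbhs tau^'-).
have FB : FF [set v : 'rV[R]_n | forall i, `[- M, M]%classic (v ord0 i)].
  apply/near_leftP; exists s => // u /andP[su ut] i /=; rewrite in_itv /= -ler_norml; apply: Hs.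
  by rewrite ltW.
have [xi [_ cl]] := cK FF _ FB.
exists xi => e e0.
have [gam1 gam10 sep] := sep_exists xi.
pose gam := Num.min (gam1 / 4) e.
have gam0 : 0 < gam by rewrite lt_min e0 divr_gt0.
have gg : 4 * gam <= gam1.
  have : gam <= gam1 / 4 by rewrite ge_min lexx.
  by clear; lra.
have ge : gam <= e by rewrite ge_min lexx orbT.
pose G0 := \sum_i `|g (xi 0 i)| + L * gam.
have Gb u i : `|u - xi 0 i| <= gam -> `|g u| <= G0.
  move=> ui; have -> : g u = g (xi 0 i) + (g u - g (xi 0 i)) by ring.
  apply: (le_trans (ler_normD _ _)); apply: lerD.
    by rewrite (bigD1 i)//= lerDl sumr_ge0.
  by apply: (le_trans (gL _ _)); exact: ler_wpM2l.
have G00 : 0 <= G0 by rewrite addr_ge0 ?sumr_ge0// mulr_ge0// ltW.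
pose C := f c + f gam + G0 + 1.
have fc : 0 <= f c by exact: force_ge0.
have fg : 0 <= f gam by exact: force_ge0.
have C0 : 0 < C by rewrite /C; move: fc fg G00; clear; lra.
pose s1 := Num.max t0 (tau - gam / (4 * C)).
have s1t : s1 < tau by rewrite gt_max t0tau /= gtrBl divr_gt0// mulr_gt0.
have N1 : FF [set v | exists2 t1, s1 < t1 < tau & v = x t1].
  by apply/near_leftP; exists s1 => // u ut; exists u.
have N2 : nbhs xi (ball xi (gam / 2)) by apply: nbhsx_ballx; rewrite divr_gt0.
have [v [[t1 t1s ->] xb]] := cl _ _ N1 N2.
have t10 : t0 <= t1.
  have : t0 <= s1 by rewrite le_max lexx.
  by move: t1s; clear; lra.
have t1C : C * (tau - t1) <= gam / 4.
  have h : tau - gam / (4 * C) <= s1 by rewrite le_max lexx orbT.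
  have h2 : tau - t1 <= gam / (4 * C) by move: h t1s; clear; lra.
  have : C * (tau - t1) <= C * (gam / (4 * C)) by apply: ler_wpM2l => //; exact: ltW.
  by have -> : C * (gam / (4 * C)) = gam / 4 by field; rewrite gt_eqF.
have xr i : `|x t1 0 i - xi 0 i| <= gam / 2.
  by move: xb; rewrite /ball /= => -[_ /(_ ord0 i)]; rewrite /ball /= distrC => /ltW.
exists t1; split; first by move: t1s; clear; lra.
move=> t i /andP[t1t tt].
have tt0 : t0 <= t < tau by rewrite tt (le_trans t10).
have Ct : C * (t - t1) <= gam / 4.
  by apply: le_trans t1C; apply: ler_wpM2l; [exact: ltW|move: tt; clear; lra].
have rC : gam / 2 + C * (t - t1) < gam by move: Ct gam0; clear; lra.
have H := @gs_hull R n f g t1 t _ x (fun=> B) xi c gam (gam / 2) G0 C F (gs_restrict (G t tt0) t10 (lexx t)) t1t c0 gam0.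
have {}H : forall u j, t1 <= u <= t -> `|x u 0 j - xi 0 j| <= gam / 2 + C * (u - t1).
  apply: H => //.
  - by move=> u ut; apply: sg; move: ut t10 tt; clear; lra.
  - by move=> j k ne; exact: le_trans gg (sep j k ne).
  - by rewrite /C; clear; lra.
apply: (le_trans (H t i _)); first by rewrite t1t lexx.
by move: rC ge; clear; lra.
Qed.

Definition charged {R : realType} {n : nat} (B : 'rV[R]_n) : {set 'I_n} := [set i | B 0%R i != 0%R]%SET.

(** A cluster of nonzero net charge contains a particle with that very charge, since otherwise all
    its charges are zero or of the other sign; one such particle survives. In a cluster of net
    charge 0 none does. *)
Lemma survivors {R : realType} {n : nat} (c : R) (xi B : 'rV[R]_n) : charges B -> 0 < c -> sgap c xi B ->
  (forall i j : 'I_n, (i < j)%N -> B 0 i * B 0 j != 0 -> xi 0 i <= xi 0 j) ->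
  exists B' : 'rV[R]_n, [/\ forall i, B' 0 i = B 0 i \/ B' 0 i = 0,
    forall y, \sum_(i < n | xi 0 i == y) B' 0 i = \sum_(i < n | xi 0 i == y) B 0 i,
    Zn (xi, B') &
    (exists i j : 'I_n, [/\ (i < j)%N, B 0 i * B 0 j != 0 & xi 0 i = xi 0 j]) ->
      (#|charged B'| < #|charged B|)%N].
Proof.
move=> bc c0 sg ord.
pose net y := \sum_(i < n | xi 0 i == y) B 0 i.
pose rep y := [pick k : 'I_n | [&& xi 0 k == y, B 0 k == net y & B 0 k != 0]].
pose B' : 'rV[R]_n := \row_i (if rep (xi 0 i) == Some i then B 0 i else 0).
have B'B i : B' 0 i = B 0 i \/ B' 0 i = 0 by rewrite mxE; case: ifP; [left|right].
have bc' : charges B'.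
  by move=> i; have [->|->] := B'B i; [exact: bc|rewrite !inE eqxx orbT].
have lone' i k : i != k -> xi 0 i = xi 0 k -> B' 0 i = 0 \/ B' 0 k = 0.
  move=> ne e; rewrite !mxE e; case: eqP => [h1|_]; last by left.
  by case: eqP => [h2|_]; [move: h1; rewrite h2 => -[h]; rewrite h eqxx in ne|right].
have netE y : net y = \sum_(k | (xi 0 k == y) && (B 0 k != 0)) B 0 k.
  rewrite /net (bigID (fun k => B 0 k != 0)) /= [X in _ + X]big1 ?addr0// => k /andP[_]; by rewrite negbK => /eqP.
have net3 y : net y \in [:: -1; 0; 1].
  rewrite netE; apply: block_sum_charge => //.
  - by move=> k /andP[].
  - move=> p q k /andP[/eqP pp bp] /andP[/eqP qq bq] /andP[pk kq] bk; rewrite bk andbT; apply/eqP.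
    have h1 : xi 0 p <= xi 0 k by apply: ord => //; rewrite mulf_neq0.
    have h2 : xi 0 k <= xi 0 q by apply: ord => //; rewrite mulf_neq0.
    by move: h1 h2; rewrite pp qq; clear; lra.
  - move=> p q /andP[/eqP pp _] /andP[/eqP qq _] pq; apply/eqP => e.
    by have := sg p q pq e; rewrite pp qq subrr leNgt c0.
exists B'; split=> //.
- move=> y; rewrite -/(net y).
  have repP k : rep y = Some k -> xi 0 k = y /\ B 0 k = net y.
    by rewrite /rep; case: pickP => // k' /and3P[/eqP ky /eqP bk _] [<-].
  have repN : rep y = None -> forall k, xi 0 k == y -> B 0 k = net y -> B 0 k = 0.
    rewrite /rep; case: pickP => // no _ k ky bk; have := no k; rewrite ky bk eqxx /= => /negbT.
    by rewrite negbK => /eqP.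
  case R1 : (rep y) => [k|].
    have [ky bk] := repP k R1.
    rewrite (bigD1 k) /=; last exact/eqP.
    rewrite big1 ?addr0; first by rewrite mxE ky R1 eqxx bk.
    by move=> i /andP[/eqP iy ik]; rewrite mxE iy R1; case: eqP => // -[h]; rewrite h eqxx in ik.
  rewrite big1; last by move=> i /eqP iy; rewrite mxE iy R1.
  apply/esym/eqP/negPn/negP => n0.
  have no2 k : xi 0 k == y -> B 0 k = - net y \/ B 0 k = 0.
    move=> ky; have [->|bk] := eqVneq (B 0 k) 0; first by right.
    left; have ne : B 0 k <> net y by move=> e; move: bk; rewrite (repN R1 k ky e) eqxx.
    move: ne; have := charge_pm bc bk; have := net3 y; rewrite !inE (negbTE n0) /=.
    by move=> /orP[] /eqP -> [->|->]; rewrite ?opprK.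
  have [h|h] : net y = 1 \/ net y = -1.
    by have := net3 y; rewrite !inE (negbTE n0) /= => /orP[] /eqP ->; [right|left].
    have : net y <= 0 by apply: sumr_le0 => k ky; have [->|->] := no2 k ky; rewrite ?h ?oppr_le0 ?ler01.
    by rewrite h ler10.
  have : 0 <= net y by apply: sumr_ge0 => k ky; have [->|->] := no2 k ky; rewrite ?h ?opprK ?ler01.
  by rewrite h ler0N1.
- split=> //= i j ij bij.
  have bi' : B' 0 i != 0 by apply: contraNneq bij => ->; rewrite mul0r.
  have bj' : B' 0 j != 0 by apply: contraNneq bij => ->; rewrite mulr0.
  have bi : B 0 i != 0 by have [<-//|e] := B'B i; rewrite e eqxx in bi'.
  have bj : B 0 j != 0 by have [<-//|e] := B'B j; rewrite e eqxx in bj'.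
  rewrite lt_neqAle ord ?mulf_neq0// andbT; apply/eqP => e.
  have ne : i != j by rewrite -val_eqE /= ltn_eqF.
  by have [h|h] := lone' i j ne e; rewrite h eqxx in bi' bj'.
move=> [i [j [ij bij e]]]; apply: proper_card; apply/properP; split.
  apply/fintype.subsetP => k; rewrite !finset.inE; have [->//|->] := B'B k; by rewrite eqxx.
have bi : B 0 i != 0 by apply: contraNneq bij => ->; rewrite mul0r.
have bj : B 0 j != 0 by apply: contraNneq bij => ->; rewrite mulr0.
have ne : i != j by rewrite -val_eqE /= ltn_eqF.
by have [h|h] := lone' i j ne e; [exists i|exists j]; rewrite !finset.inE ?h ?eqxx.
Qed.

(** The junction joins the exceptional set, since the velocity may break there. *)
Lemma gs_concat {R : realType} {n : nat} (f g : R -> R) (t0 t1 t2 : R) (S S' : set R) (x b x' b' : R -> 'rV[R]_n) :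
  t0 < t1 -> t1 <= t2 -> gsol f g t0 t1 S x b -> gsol f g t1 t2 S' x' b' -> x' t1 = x t1 -> b' t1 = b t1 ->
  gsol f g t0 t2 (S `|` [set t1] `|` S') (fun t => if t <= t1 then x t else x' t) (fun t => if t <= t1 then b t else b' t).
Proof.
move=> t01 t12 G G' x1 b1.
have right u : t1 <= u -> (if u <= t1 then x u else x' u) = x' u.
  by move=> h; case: ifP => // h'; have -> : u = t1 by move: h h'; clear; lra.
have rightb u : t1 <= u -> (if u <= t1 then b u else b' u) = b' u.
  by move=> h; case: ifP => // h'; have -> : u = t1 by move: h h'; clear; lra.
split.
- by rewrite !finite_setU; split; [split; [exact: gs_fin G|exact: finite_set1]|exact: gs_fin G'].
- move=> t [[/(gs_times G)|->]|/(gs_times G')]; move: t01 t12; clear; lra.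
- move=> t tt; case: ifP => h; first by apply: (gs_Zn G); move: tt h; clear; lra.
  by apply: (gs_Zn G'); move: tt h => /andP[_ ->] /negbT; rewrite -ltNge => /ltW ->.
- move=> i t tt e e0.
  have [tl|tr] := ltP t t1.
    have [|d d0 Hd] := gs_cts G i (t := t) _ e0; first by move: tt tl; clear; lra.
    exists (Num.min d (t1 - t)); first by rewrite lt_min d0 subr_gt0.
    move=> s ss; rewrite lt_min => /andP[sd]; rewrite ltr_norml => st.
    rewrite (ltW tl) ifT; last by move: st; clear; lra.
    by apply: Hd => //; move: ss st; clear; lra.
  rewrite (right t tr).
  have [|d d0 Hd] := gs_cts G' i (t := t) _ e0; first by move: tt tr; clear; lra.
  have [t1E|tne] := eqVneq t t1; last first.
    exists (Num.min d (t - t1)); first by rewrite lt_min d0 subr_gt0 lt_neqAle eq_sym tne.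
    move=> s ss; rewrite lt_min => /andP[sd]; rewrite ltr_norml => st.
    rewrite right; last by move: st; clear; lra.
    by apply: Hd => //; move: ss st; clear; lra.
  rewrite t1E in Hd *.
  have [|d' d'0 Hd'] := gs_cts G i (t := t1) _ e0; first by rewrite lexx ltW.
  exists (Num.min d d'); first by rewrite lt_min d0.
  move=> s ss; rewrite lt_min => /andP[sd sd']; case: ifP => st.
    by rewrite x1; apply: Hd' => //; move: ss st; clear; lra.
  by apply: Hd => //; move: ss st => /andP[_ ->] /negbT; rewrite -ltNge => /ltW ->.
- move=> s s' h1 h2 h3 h4.
  have [s1|s1] := leP s' t1.
    rewrite (le_trans h2 s1); apply: (gs_const G) => // u us Su; apply: (h4 u us); by left; left.
  have t1s : t1 <= s by rewrite leNgt; apply/negP => ss; apply: (h4 t1); [rewrite ss ltW|left; right].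
  rewrite rightb// ; apply: (gs_const G') => // u us Su; apply: (h4 u us); by right.
- move=> s tau h1 h2 St h4.
  have [s1|s1] := leP tau t1.
    rewrite (ltW (lt_le_trans h2 s1)); apply: (gs_jumpE G) => // u us Su; apply: (h4 u us); by left; left.
  have t1s : t1 <= s by rewrite leNgt; apply/negP => ss; apply: (h4 t1); [rewrite ss|left; right].
  rewrite rightb//; have tt2 : tau <= t2.
    by case: St => [[/(gs_times G)|->]|/(gs_times G')]; move: t12; clear; lra.
  apply: (gs_jumpE G') => // u us Su; apply: (h4 u us); by right.
- move=> t i tt nS.
  have tne : t != t1 by apply/eqP => e; apply: nS; left; right.
  have [tl|tr] := ltP t t1.
    rewrite (ltW tl); apply: (@near_eq_is_derive _ _ _ (fun s => x s 0 i)).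
      apply: filterS (lt_nbhsl tl) => s /ltW ->; by [].
    by apply: (gs_ode G); [move: tt tl; clear; lra|move=> h; apply: nS; left; left].
  have {}tr : t1 < t by rewrite lt_neqAle eq_sym tne.
  rewrite (leNgt t) tr /=; apply: (@near_eq_is_derive _ _ _ (fun s => x' s 0 i)).
    apply: filterS (lt_nbhsr tr) => s h; by rewrite leNgt h.
  by apply: (gs_ode G'); [move: tt tr; clear; lra|move=> h; apply: nS; right].
Qed.

(** In contrast with [gsol], nothing is asked of the order of the particles, so a flow may end in a
    collision. *)
Definition flow {R : realType} {n : nat} (f g : R -> R) (B : 'rV[R]_n) (t0 t : R) (x : R -> 'rV[R]_n) :=
  (forall i, cts t0 t (fun s => x s 0 i)) /\
  (forall s i, t0 < s < t -> is_derive s 1 (fun u => x u 0 i) (velocity f g (x s) B i)).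

Lemma flow_gsol {R : realType} {n : nat} (f g : R -> R) (B : 'rV[R]_n) (t0 t : R) (x : R -> 'rV[R]_n) :
  flow f g B t0 t x -> (forall s, t0 <= s <= t -> Zn (x s, B)) -> gsol f g t0 t set0 x (fun=> B).
Proof. by move=> [xc xD] Z; split=> // [s i st _]; exact: xD. Qed.

Lemma spaced_extends {R : realType} {n : nat} (e s T : R) (B : 'rV[R]_n) (t0 : R) (x : R -> 'rV[R]_n) : 0 < e ->
  t0 <= s < T -> (forall i, cts t0 T (fun u => x u 0 i)) -> (forall u, t0 <= u <= s -> spaced (2 * e) B (x u)) ->
  exists2 s', s < s' <= T & forall u, t0 <= u <= s' -> spaced e B (x u).
Proof.
move=> e0 /andP[t0s sT] xc sp.
have e2 : 0 < e / 2 by rewrite divr_gt0.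
have near k : exists d, 0 < d /\ forall u, t0 <= u <= T -> `|u - s| < d -> `|x u 0 k - x s 0 k| < e / 2.
  by have [|d d0 Hd] := xc k s _ _ e2; [rewrite t0s ltW|exists d].
have [d Hd] := choice near.
pose d0 := \big[Num.min/1]_k d k.
have d00 : 0 < d0.
  by rewrite /d0; elim/big_ind: _ => // [u v u0 v0|k _]; [rewrite lt_min u0|have [] := Hd k].
exists (Num.min (s + d0 / 2) T).
  by rewrite lt_min sT andbT ge_min lexx orbT andbT; move: d00; clear; lra.
move=> u /andP[u0]; rewrite le_min => /andP[us uT] i j ij bij.
have [us'|su] := leP u s.
  by have := sp u _ i j ij bij; rewrite u0 us' => /(_ isT); move: e0; clear; lra.
have h k : `|x u 0 k - x s 0 k| < e / 2.
  have [_] := Hd k; apply; first by rewrite u0.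
  apply: (@lt_le_trans _ _ d0); last exact: bigmin_le_cond.
  by rewrite ltr_norml; move: us su d00; clear; lra.
have := sp s _ i j ij bij; rewrite t0s lexx => /(_ isT).
by have := h i; have := h j; rewrite !ltr_norml; clear; lra.
Qed.

(** A solution for the cut-off [e] solves the original equation as long as charged pairs are [e]
    apart, and by uniqueness two cut-offs give the same curve where both are inactive. The curves
    glue to a maximal one. It has a limit at its final time [tau], and without a collision there it
    could be extended unless [tau = T]. *)
Lemma flow_until_collision {R : realType} {n : nat} (f g : R -> R) (L t0 T : R) (X0 B : 'rV[R]_n) :
  force f -> 0 <= L -> (forall u v, `|g u - g v| <= L * `|u - v|) -> t0 < T -> Zn (X0, B) ->
  (exists2 x, x t0 = X0 & gsol f g t0 T set0 x (fun=> B)) \/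
  (exists tau x c, [/\ t0 < tau <= T, x t0 = X0, flow f g B t0 tau x,
     0 < c /\ (forall t, t0 <= t < tau -> Zn (x t, B) /\ sgap c (x t) B) &
     exists i j : 'I_n, [/\ (i < j)%N, B 0 i * B 0 j != 0 & x tau 0 i = x tau 0 j]]).
Proof.
move=> F L0 gL t0T Z0; have [/= bc ord0] := Z0.
have f'0 e : 0 < e -> 0 <= - derive1 f e by rewrite oppr_ge0; exact: force_drv_le0.
have K0 e : 0 < e -> 0 < 2 * (- derive1 f e) + L + 1 by move=> /f'0; move: L0; clear; lra.
have sol e : exists x, 0 < e -> x t0 = X0 /\ solves (cut_velocity f g B e) t0 T x.
  have [e0|e0] := ltP 0 e; last by exists (fun=> X0).
  by have [x x0 xs] := picard X0 (K0 e e0) (cut_velocity_lip F L0 gL bc e0) (ltW t0T); exists x.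
have [xe Hxe] := choice sol.
have identify e t y : 0 < e -> t0 <= t <= T -> y t0 = X0 -> flow f g B t0 t y ->
    (forall u, t0 <= u <= t -> spaced e B (y u)) -> forall u, t0 <= u <= t -> y u = xe e u.
  move=> e0 /andP[t0t tT] y0 [yc yD] sp.
  have [x0 [xc xD]] := Hxe e e0.
  apply: (solves_unique (K0 e e0) (cut_velocity_lip F L0 gL bc e0) t0t); last by rewrite x0.
    split=> // u i ut; rewrite (cut_velocityE _ _ F); first exact: yD.
    by apply: sp; move: ut; clear; lra.
  split; first by move=> i; apply: cts_sub (xc i) _ tT.
  by move=> u i ut; apply: xD; move: ut tT; clear; lra.
pose ok e t := 0 < e /\ forall u, t0 <= u <= t -> spaced e B (xe e u).
have okflow e t : t0 <= t <= T -> ok e t -> flow f g B t0 t (xe e).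
  move=> /andP[t0t tT] [e0 sp]; have [x0 [xc xD]] := Hxe e e0.
  split; first by move=> i; apply: cts_sub (xc i) _ tT.
  move=> u i ut; rewrite -(@cut_velocityE _ _ _ _ _ _ e)//; last by apply: sp; move: ut; clear; lra.
  by apply: xD; move: ut tT; clear; lra.
have okle e e' t : t0 <= t <= T -> ok e t -> 0 < e' <= e -> ok e' t /\ forall u, t0 <= u <= t -> xe e u = xe e' u.
  move=> tT o /andP[e'0 e'e]; have [e0 sp] := o.
  have sp' u : t0 <= u <= t -> spaced e' B (xe e u) by move=> ut; exact: spaced_le (sp u ut) e'e.
  have E := identify e' t (xe e) e'0 tT (Hxe e e0).1 (okflow e t tT o) sp'.
  by split=> //; split=> // u ut; rewrite -E//; exact: sp'.
have oksame e e' t : t0 <= t <= T -> ok e t -> ok e' t -> forall u, t0 <= u <= t -> xe e u = xe e' u.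
  move=> tT o o'; have m0 : 0 < Num.min e e' by rewrite lt_min o.1 o'.1.
  have [|_ E] := okle e (Num.min e e') t tT o; first by rewrite m0 ge_min lexx.
  have [|_ E'] := okle e' (Num.min e e') t tT o'; first by rewrite m0 ge_min lexx orbT.
  by move=> u ut; rewrite E// E'.
pose good := [set t | t0 <= t <= T /\ exists e, ok e t].
have extend y s : t0 <= s < T -> y t0 = X0 -> flow f g B t0 s y -> (forall u, t0 <= u <= s -> Zn (y u, B)) ->
    exists2 s', s < s' & good s'.
  move=> sT y0 yf yZ; have /andP[t0s sT'] := sT.
  have [e e0 sp] : exists2 e, 0 < e & forall u, t0 <= u <= s -> spaced e B (y u).
    by apply: pairs_spaced => //; [case: yf|move=> u i j ut ij bij; have [/= _] := yZ u ut; apply].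
  (* Halving the cut-off leaves room for a continuation past [s]. *)
  have e20 : 0 < e / 2 by rewrite divr_gt0.
  have e2e : e / 2 <= e by move: e0; clear; lra.
  have s1 : t0 <= s <= T by rewrite t0s ltW.
  have E := identify (e / 2) s y e20 s1 y0 yf (fun u ut => spaced_le (sp u ut) e2e).
  have [x0 [xc _]] := Hxe _ e20.
  have [|s' /andP[ss' s'T] sp'] := @spaced_extends R n (e / 2) s T B t0 (xe (e / 2)) e20 sT xc.
    by move=> u ut; rewrite -E// mulrC divfK//; exact: sp.
  exists s' => //; split; last by exists (e / 2).
  by rewrite s'T (le_trans t0s)// ltW.
have goodT t : good t -> t <= T by move=> [/andP[]].
have [t1 t01 g1] : exists2 s', t0 < s' & good s'.
  have H := extend (fun=> X0) t0 _ erefl; apply: H; first by rewrite lexx.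
    split=> [i|s i st]; first exact: cts_cst.
    by exfalso; move: st; clear; lra.
  by [].
have gsup : has_sup good by split; [exists t1|exists T => t; exact: goodT].
pose tau := sup good.
have tauT : tau <= T by apply: ge_sup => //; exists t1.
have t1tau : t1 <= tau by apply: ub_le_sup => //; case: gsup.
have t0tau : t0 < tau by exact: lt_le_trans t1tau.
have goodlt t : t0 <= t < tau -> good t.
  move=> /andP[t0t tt]; have [|v [vT [e [e0 sp]]] tv] := sup_adherent (eps := tau - t) _ gsup; first by rewrite subr_gt0.
  split; first by rewrite t0t (le_trans (ltW tt)).
  exists e; split=> // u ut; apply: sp; move: ut tv; rewrite -/tau; clear; lra.
(* The cut-off depends on [t] and may tend to 0 at [tau]. *)
have [ee Hee] : exists ee : R -> R, forall t, t0 <= t < tau -> ok (ee t) t.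
  have H t : exists e, t0 <= t < tau -> ok e t.
    have [tt|ntt] := boolP (t0 <= t < tau); last by exists 0.
    by have [_ [e oe]] := goodlt t tt; exists e.
  by have [ee h] := choice H; exists ee.
pose X t := xe (ee t) t.
have XE t u : t0 <= t < tau -> t0 <= u <= t -> X u = xe (ee t) u.
  move=> tt ut; have uu : t0 <= u < tau by move: ut tt; clear; lra.
  have [e0 sp] := Hee t tt; rewrite /X; apply: (oksame _ _ u).
  - by move: uu tauT; clear; lra.
  - exact: Hee.
  - by split=> // v vu; apply: sp; move: vu ut; clear; lra.
  - by move: uu; clear; lra.
have tTle t : t0 <= t < tau -> t0 <= t <= T by move: tauT; clear; lra.
have Xc t i : t0 <= t < tau -> cts t0 t (fun s => X s 0 i).
  move=> tt; apply: cts_ext ((okflow _ _ (tTle t tt) (Hee t tt)).1 i) => u ut.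
  by rewrite (XE t).
have XD t i : t0 < t < tau -> is_derive t 1 (fun s => X s 0 i) (velocity f g (X t) B i).
  move=> /andP[tt0 ttau]; pose v := (t + tau) / 2.
  have vv : t0 <= v < tau by rewrite /v; move: tt0 ttau; clear; lra.
  have tv : t < v by rewrite /v; move: ttau; clear; lra.
  rewrite (XE v)//; last by rewrite !ltW.
  apply: (@near_eq_is_derive _ _ _ (fun s => xe (ee v) s 0 i)).
    near=> s; rewrite (XE v)//; apply/andP; split; first by apply/ltW; near: s; exact: lt_nbhsr.
    by apply/ltW; near: s; exact: lt_nbhsl.
  by apply: (okflow _ _ (tTle v vv) (Hee v vv)).2; rewrite tt0.
have X0E : X t0 = X0.
  by rewrite /X; have [] := Hxe (ee t0) (Hee t0 _).1; rewrite ?lexx.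
have XZ t : t0 <= t < tau -> Zn (X t, B).
  move=> tt; have [e0 sp] := Hee t tt; apply: (spaced_Zn bc e0); rewrite /X; apply: sp.
  by move: tt; clear; lra.
have XG t : t0 <= t < tau -> gsol f g t0 t set0 X (fun=> B).
  move=> tt; apply: flow_gsol.
    by split=> [i|s i st]; [exact: Xc|apply: XD; move: st tt; clear; lra].
  by move=> s st; apply: XZ; move: st tt; clear; lra.
have [c c0 sg0] := sgap_exists Z0.
pose c1 := gap_rate L c t0 T; have c10 : 0 < c1 by exact: gap_rate_gt0.
have Xsg t : t0 <= t < tau -> sgap c1 (X t) B.
  move=> tt; have H := gs_sgap (e := 0) F (XG t tt) L0 c0 _ (gap_rate_gt0 L t0 t c0).
  have {}H : sgap (gap_rate L c t0 t) (X t) B.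
    apply: H; first by move=> u v; rewrite addr0.
      by rewrite X0E.
    by case/andP: tt => ->; rewrite lexx.
  apply: sgap_le H _; apply: gap_rate_decr => //; move: tt tauT; clear; lra.
have [xi Hxi] := end_limit F L0 gL t0tau c10 XG Xsg.
pose Y t := if t < tau then X t else xi.
have YX t : t < tau -> Y t = X t by rewrite /Y => ->.
have Yxi : Y tau = xi by rewrite /Y ltxx.
have Yc i : cts t0 tau (fun t => Y t 0 i).
  move=> t tt e e0; have [tl|tr] := ltP t tau.
    pose v := (t + tau) / 2.
    have tv : t < v by rewrite /v; move: tl; clear; lra.
    have vt : v < tau by rewrite /v; move: tl; clear; lra.
    have vv : t0 <= v < tau by rewrite vt andbT; move: tt tv; clear; lra.
    have [|d d0 Hd] := Xc v i vv t _ e e0; first by move: tt tv; clear; lra.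
    exists (Num.min d (v - t)); first by rewrite lt_min d0 subr_gt0.
    move=> s ss; rewrite lt_min => /andP[sd]; rewrite ltr_norml => sv.
    by rewrite !YX//; [apply: Hd => //|]; move: ss sv vt; clear; lra.
  have -> : t = tau by move: tt tr; clear; lra.
  have [|s [st Hs]] := Hxi (e / 2); first by rewrite divr_gt0.
  exists (tau - s); first by rewrite subr_gt0.
  move=> u uu; rewrite ltr_norml => us; rewrite Yxi.
  have [ul|ur] := ltP u tau; last first.
    by have -> : u = tau by [move: uu ur; clear; lra]; rewrite Yxi subrr normr0.
  rewrite YX//; apply: (@le_lt_trans _ _ (e / 2)); last by move: e0; clear; lra.
  by apply: Hs; rewrite ul andbT; move: us; clear; lra.
have YD t i : t0 < t < tau -> is_derive t 1 (fun s => Y s 0 i) (velocity f g (Y t) B i).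
  move=> tt; have /andP[_ ttau] := tt; rewrite YX//.
  apply: (@near_eq_is_derive _ _ _ (fun s => X s 0 i)); last exact: XD.
  by apply: filterS (lt_nbhsl ttau) => s st; rewrite YX.
have Yf : flow f g B t0 tau Y by [].
have Y0 : Y t0 = X0 by rewrite YX.
have Yle (i j : 'I_n) : (i < j)%N -> B 0 i * B 0 j != 0 -> Y tau 0 i <= Y tau 0 j.
  move=> ij bij; rewrite -subr_ge0.
  apply: (@cts_closed_ge R t0 tau (fun t => Y t 0 j - Y t 0 i)) => //; first exact: cts_sub2.
  move=> t tt; rewrite YX; last by case/andP: tt.
  by rewrite subr_ge0; apply/ltW; have [/= _] := XZ t tt; apply.
have [coll|ncoll] := pselect (exists i j : 'I_n, [/\ (i < j)%N, B 0 i * B 0 j != 0 & Y tau 0 i = Y tau 0 j]).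
  right; exists tau, Y, c1; split=> //; first by rewrite t0tau.
  by split=> // t tt; rewrite YX; [split; [exact: XZ|exact: Xsg]|case/andP: tt].
left; have YZ t : t0 <= t <= tau -> Zn (Y t, B).
  move=> tt; have [tl|tr] := ltP t tau; first by rewrite YX//; apply: XZ; rewrite tl; case/andP: tt => ->.
  have -> : t = tau by move: tt tr; clear; lra.
  split=> //= i j ij bij; rewrite lt_neqAle Yle// andbT; apply/eqP => e.
  by apply: ncoll; exists i, j.
have tauE : tau = T.
  apply/eqP; rewrite eq_le tauT leNgt; apply/negP => tT.
  have [|s' ss' gs'] := extend Y tau _ Y0 Yf YZ; first by rewrite ltW.
  have : s' <= tau by apply: ub_le_sup => //; case: gsup.
  by move: ss'; clear; lra.
exists Y => //; rewrite -tauE; exact: flow_gsol.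
Unshelve. all: by end_near.
Qed.

Lemma exists_gsol {R : realType} {n : nat} (f g : R -> R) (L T : R) :
  force f -> 0 <= L -> (forall u v, `|g u - g v| <= L * `|u - v|) ->
  forall m t0 (X0 B : 'rV[R]_n), t0 <= T -> Zn (X0, B) -> (#|charged B| < m)%N ->
  exists S x b, [/\ gsol f g t0 T S x b, x t0 = X0 & b t0 = B].
Proof.
move=> F L0 gL; elim=> // m IH t0 X0 B t0T Z0 cB; have [/= bc _] := Z0.
have [t0E|t0ne] := eqVneq t0 T.
  exists set0, (fun=> X0), (fun=> B); split=> //; split=> //; first by move=> i; exact: cts_cst.
  by move=> t i; rewrite t0E; clear; lra.
have {t0ne}t0T : t0 < T by rewrite lt_neqAle t0ne.
have [[x x0 G]|] := flow_until_collision F L0 gL t0T Z0; first by exists set0, x, (fun=> B).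
move=> [tau [x [c [/andP[t0tau tauT] x0 [xc xD] [c0 xH] coll]]]].
have sgt : sgap c (x tau) B.
  move=> i j ij bij; apply: (@cts_closed_ge R t0 tau (fun t => x t 0 j - x t 0 i)) => //; first exact: cts_sub2.
  by move=> t tt; have [_] := xH t tt; apply.
have ordt (i j : 'I_n) : (i < j)%N -> B 0 i * B 0 j != 0 -> x tau 0 i <= x tau 0 j.
  move=> ij bij; rewrite -subr_ge0.
  apply: (@cts_closed_ge R t0 tau (fun t => x t 0 j - x t 0 i)) => //; first exact: cts_sub2.
  by move=> t tt; rewrite subr_ge0; apply/ltW; have [[/= _ xb] _] := xH t tt; apply: xb.
have [B' [J1 J2 Z' cB']] := survivors bc c0 sgt ordt.
have [|S' [x' [b' [G' x'0 b'0]]]] := IH tau (x tau) B' tauT Z'.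
  by apply: leq_trans (cB' coll) _.
(* At [tau] itself the reduced charges are already in force, as right continuity demands. *)
pose b t := if t < tau then B else B'.
have bl t : t < tau -> b t = B by rewrite /b => ->.
have bt : b tau = B' by rewrite /b ltxx.
have G : gsol f g t0 tau [set tau] x b.
  split=> //.
  - by move=> t ->; rewrite t0tau lexx.
  - move=> t tt; have [tl|tr] := ltP t tau.
      by rewrite bl//; have [|//] := xH t; rewrite tl; case/andP: tt => ->.
    have -> : t = tau by move: tt tr; clear; lra.
    by rewrite bt.
  - move=> s s' h1 h2 h3 h4; have [s't|s't] := ltP s' tau.
      by rewrite !bl// (le_lt_trans h2).
    have s'E : s' = tau by move: s't h3; clear; lra.
    have [st|st] := ltP s tau; first by exfalso; apply: (h4 tau); rewrite // st s'E lexx.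
    by congr b; move: h2 st; rewrite s'E; clear; lra.
  - move=> s u _ su uE _; rewrite uE in su *; rewrite bt bl//; by split.
  - move=> t i tt _; rewrite bl; last by case/andP: tt.
    exact: (xD t i tt).
have GG := gs_concat t0tau tauT G G' x'0 (etrans b'0 (esym bt)).
by eexists; eexists; eexists; split; [exact: GG|rewrite /= (ltW t0tau)|rewrite /= (ltW t0tau) bl].
Qed.

(** * Assembly of the theorem *)

Lemma force_of_sign {R : realType} (f : R -> R) :
  f 0 = 0 -> (forall u : R, u != 0 -> f (- u) = - f u) ->
  (forall u : R, 0 < u -> [/\ derivable f u 1, derivable (derive1 f) u 1 &
     {for u, continuous (derive1 (derive1 f))}]) ->
  (forall u : R, 0 < u -> [/\ 0 <= f u, derive1 f u <= 0 & 0 <= derive1 (derive1 f) u]) -> force f.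
Proof.
move=> f0 fN fC2 fs; split.
- by move=> u; have [->|u0] := eqVneq u 0; [rewrite oppr0 f0 oppr0|exact: fN].
- by move=> u u0; have [D _ _] := fC2 u u0; rewrite derive1E; exact: derivableP.
- by move=> u /fs[].
- by move=> u /fs[].
move=> u v u0 uv.
have D (t : R) : 0 < t -> is_derive t 1 (derive1 f) (derive1 (derive1 f) t).
  by move=> t0; have [_ D _] := fC2 t t0; rewrite (derive1E (derive1 f)); exact: derivableP.
apply: (@MVT_ge0 R u v (derive1 f) (derive1 (derive1 f)) set0 (finite_set0 _) uv).
  by apply: derive_cts => t tuv; apply: D; move: tuv u0; clear; lra.
move=> t tuv _; have t0 : 0 < t by move: tuv u0; clear; lra.
by split; [exact: D|have [] := fs t t0].
Qed.

Theorem theorem2p7 (R : realType) (n : nat) (T : R) (x0 b0 : 'rV[R]_n)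
    (f g : R -> R) (a : R)
    (n_ge2 : (2 <= n)%N) (T_gt0 : 0 < T) (init_Zn : Zn (x0, b0))
    (g_lip : lipschitz g)
    (f_at0 : f 0 = 0)
    (f_odd : forall u : R, u != 0 -> f (- u) = - f u)
    (f_C2 : forall u : R, 0 < u ->
      [/\ derivable f u 1, derivable f^`() u 1 &
          {for u, continuous f^`()^`()}])
    (f_sign : forall u : R, 0 < u -> [/\ 0 <= f u, f^`() u <= 0 & 0 <= f^`()^`() u])
    (f_sing : u * derive1 f u @[u --> 0^'+] --> -oo)
    (a_gt : -1 < a)
    (f_upper : exists C, 0 < C /\
      forall u : R, 0 < u < 1 -> f u <= C / u `^ (1 + a)) :
  (exists x b, is_solution f g T x0 b0 x b) /\
  (forall S0 x b x' b',
     solution_with f g T x0 b0 S0 x b -> is_solution f g T x0 b0 x' b' ->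
     eq_mod_relabeling T (collision_times S0 x b) x b x' b') /\
  (forall S0 x b, solution_with f g T x0 b0 S0 x b ->
    [/\ (* (i) *)
        exists c, 0 < c /\ forall t, 0 <= t <= T ->
          (c%:E <= min_dist 1 x b t)%E /\ (c%:E <= min_dist (-1) x b t)%E,
        (* (ii) *)
        forall (i j : 'I_n) (t0 : R), 0 <= t0 <= T ->
          neighbors (b t0) i j -> b t0 0 i = - b t0 0 j ->
          exists C c, [/\ 0 < C, 0 < c &
            forall t, t0 <= t -> t <= t0 + c / C -> t <= T ->
              (c - C * (t - t0)) `^ (1 / (2 + a)) <= x t 0 j - x t 0 i],
        (* (iii) *)
        forall (tau : R) (i j : 'I_n), collide_at S0 x b tau i j -> (i < j)%N ->
          neighbors_prior_to b tau i j ->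
          exists C, 0 < C /\ forall t, 0 <= t <= tau ->
            x t 0 j - x t 0 i <= C * (tau - t) `^ (1 / (2 + a)),
        (* (iv) *)
        forall a' c' eps0 : R, -1 < a' <= a -> 0 < c' -> 0 < eps0 ->
          (forall u : R, 0 < u < eps0 -> c' / u `^ (1 + a') <= `|u * derive1 f u|) ->
          forall tau y, collision_point S0 x b tau y ->
          exists (c : R) (i j : 'I_n), [/\ 0 < c, (i < j)%N,
            x tau 0 i = y /\ x tau 0 j = y,
            left_lim (fun s : R => b s 0 i) tau != 0 /\
            left_lim (fun s : R => b s 0 j) tau != 0 &
            \forall t \near tau^'-,
              c * (tau - t) `^ (1 / (2 + a')) < x t 0 j - y /\
              x t 0 i - y < - (c * (tau - t) `^ (1 / (2 + a')))]
      & (* (v) *)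
        exists s : seq R,
        [/\ sorted <%R s, collision_times S0 x b = [set` s] &
          let tau k := nth T (0 :: s) k in
          forall (gs : R -> R -> R) (x0s : R -> 'rV[R]_n)
                 (xs bs : R -> R -> 'rV[R]_n),
            (forall sigma, sigma != 0 -> lipschitz (gs sigma)) ->
            sup_norm (fun u => gs sigma u - g u) @[sigma --> 0^'] --> 0%E ->
            (forall sigma, sigma != 0 -> Zn (x0s sigma, b0)) ->
            x0s sigma @[sigma --> 0^'] --> x0 ->
            (forall sigma, sigma != 0 ->
               is_solution f (gs sigma) T (x0s sigma) b0 (xs sigma) (bs sigma)) ->
            forall k, (k <= size s)%N ->
            exists p : R -> 'S_n,
              {uniform `[tau k, tau k.+1],
                (fun sigma t => relabel (p sigma) (xs sigma t)) @ 0^' --> x} /\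
              forall t0 t1 : R, tau k < t0 -> t0 <= t1 -> t1 < tau k.+1 ->
                \forall sigma \near 0^', forall t, t0 <= t <= t1 ->
                  relabel (p sigma) (bs sigma t) = b t]]).
Proof.
have F : force f by exact: force_of_sign.
have [L L0 gL] := (lipschitzP g).1 g_lip.
have sysP S0 x b : solution_with f g T x0 b0 S0 x b -> sys f g L T S0 x b.
  by move=> SW; split=> //; exact: sol_gsol SW.
split.
  have [S [x [b [G xE bE]]]] := exists_gsol F L0 gL (ltW T_gt0) init_Zn (ltnSn _).
  by exists x, b, S; rewrite -xE -bE; exact: gsol_sol F L0 gL G.
split.
  move=> S0 x b x' b' SW [S' SW']; have [xE bE] := sol_init SW; have [xE' bE'] := sol_init SW'.
  by apply: (unique_mod_relabeling (sysP _ _ _ SW) f_sing (sol_gsol SW')); rewrite ?xE ?bE.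
move=> S0 x b SW; have Sy := sysP _ _ _ SW; have [xE bE] := sol_init SW.
split.
- exact: sol_min_dist Sy.
- move=> i j t0 t0T nb _; exact (sol_neighbors_lower Sy a_gt t0T nb).
- move=> tau i j cl ij nb; exact (sol_upper Sy a_gt f_upper cl ij nb).
- move=> a' c' eps0 /andP[a'1 _] c'0 e0 fl tau y cp; exact (sol_lower Sy a'1 c'0 e0 fl cp).
have [s [ss sE B]] := collision_seq Sy.
exists s; split=> // tau gs x0s xs bs _ gsc _ x0c sols k ks.
rewrite -xE in x0c; rewrite -bE in sols.
exact: (sol_stability Sy f_sing B ks gsc x0c sols).
Qed.
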